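(* In the setting described in the context, $\widetilde{\Pi}_h\circ\nabla=\nabla\circ\tilde{I}_h$ on $\widetilde{H}^2_0(\Omega)$; that is, for every $v\in\widetilde{H}^2_0(\Omega)$, $\widetilde{\Pi}_h(\nabla v)=\nabla(\tilde I_h v)$, where the gradient of the IFE function $\tilde I_hv$ is taken element by element (piecewise on $T_h^\pm$ on interface elements) and $\nabla v$ is taken piecewise on $\Omega^\pm$.
   Context: $\Omega\subset\mathbb{R}^2$ is a bounded polygonal domain; $\Gamma\subset\Omega$ is a smooth simple Jordan curve not touching $\partial\Omega$ that separates $\Omega$ into subdomains $\Omega^-$ and $\Omega^+$, with normal vector $\mathbf{n}$ and tangential vector $\mathbf{t}$. $\mu=\mu^\pm$, $\beta=\beta^\pm$ in $\Omega^\pm$ are positive constants. $\mathrm{curl}\,\mathbf{v}=\partial_{x_1}v_2-\partial_{x_2}v_1$. $\mathcal{T}_h$ is a triangulation of $\Omega$ (not fitted to $\Gamma$) whose triangles have no obtuse angle; $\mathcal{N}_h$, $\mathcal{E}_h$ are its nodes and edges, $\mathring{\mathcal{E}}_h$ the interior edges. Elements cut by $\Gamma$ are interface elements (collection $\mathcal{T}_h^i$). The mesh is such that $\Gamma$ intersects the boundary of each interface element $T$ at exactly two distinct points, on two different edges; $\Gamma_h^T$ is the segment joining them, it cuts $T$ into $T_h^-$, $T_h^+$ (corresponding to $\Omega^-$, $\Omega^+$); $\bar{\mathbf t},\bar{\mathbf n}$ are unit tangent and normal to $\Gamma_h^T$, $X_m$ is its midpoint. H(curl) IFE space. $\mathcal{ND}_h(K)=\{\mathbf{a}+b[x_2,-x_1]^t:\mathbf{a}\in\mathbb{R}^2,b\in\mathbb{R}\}$.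 On $T\in\mathcal{T}_h^i$, $\mathcal{C}_T:\mathcal{ND}_h(T_h^-)\to\mathcal{ND}_h(T_h^+)$ is the linear bijection determined by $\mathcal{C}_T(\mathbf{v}_h)\cdot\bar{\mathbf{t}}=\mathbf{v}_h\cdot\bar{\mathbf{t}}$, $\frac{1}{\mu^+}\mathrm{curl}\,\mathcal{C}_T(\mathbf{v}_h)=\frac{1}{\mu^-}\mathrm{curl}\,\mathbf{v}_h$, $\beta^+\mathcal{C}_T(\mathbf{v}_h)\cdot\bar{\mathbf{n}}=\beta^-\mathbf{v}_h\cdot\bar{\mathbf{n}}$ at $X_m$, and $\mathcal{IND}_h(T)$ consists of the functions equal to $\mathbf{v}_h$ on $T_h^-$ and $\mathcal{C}_T(\mathbf{v}_h)$ on $T_h^+$, $\mathbf{v}_h\in\mathcal{ND}_h(T_h^-)$. On non-interface elements $\mathcal{IND}_h(T)=\mathcal{ND}_h(T)$. $\mathcal{IND}_h(\Omega)=\{\mathbf{v}\in \mathbf{L}^2(\Omega):\mathbf{v}|_T\in\mathcal{IND}_h(T)\ \forall T,\ \int_e[\mathbf{v}\cdot\mathbf{t}]_e\,ds=0\ \forall e\in\mathring{\mathcal{E}}_h\}$. Functions of $\mathcal{IND}_h(T)$ are uniquely determined by their three integrals $\int_{e}\mathbf{z}\cdot\mathbf{t}\,ds$ over the edges of $T$. $\widetilde{\mathbf{H}}^1(\mathrm{curl};\Omega)$ is the set of $\mathbf{u}$ with $\mathbf{u}|_{\Omega^\pm}\in\mathbf{H}^1(\Omega^\pm)$, $\mathrm{curl}\,\mathbf{u}|_{\Omega^\pm}\in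 H^1(\Omega^\pm)$, and $[\mathbf{u}\cdot\mathbf{t}]_\Gamma=0$, $[\mu^{-1}\mathrm{curl}\,\mathbf{u}]_\Gamma=0$, $[\beta\mathbf{u}\cdot\mathbf{n}]_\Gamma=0$. The interpolation $\widetilde{\Pi}_h:\widetilde{\mathbf{H}}^1(\mathrm{curl};\Omega)\to\mathcal{IND}_h(\Omega)$ is defined by $\int_e\widetilde{\Pi}_h\mathbf{u}\cdot\mathbf{t}\,ds=\int_e\mathbf{u}\cdot\mathbf{t}\,ds$ for all $e\in\mathcal{E}_h$. $H^1$ IFE space. On $T\in\mathcal{T}_h^i$, $\widetilde{S}_h(T)=\{z_h: z_h^\pm=z_h|_{T_h^\pm}\in\mathbb{P}_1(T_h^\pm),\ z_h^+=z_h^-\text{ on }\Gamma_h^T,\ \beta^-\nabla z_h^-\cdot\bar{\mathbf n}=\beta^+\nabla z_h^+\cdot\bar{\mathbf n}\}$; on non-interface elements $\widetilde S_h(T)=\mathbb{P}_1(T)$. Functions in $\widetilde S_h(T)$ are uniquely determined by their values at the vertices of $T$. $\widetilde{S}_h(\Omega)$ is the space of functions that are in $\widetilde S_h(T)$ on every $T$ and continuous at every mesh node. $\tilde I_h$ is the nodal interpolation into $\widetilde{S}_h(\Omega)$: $\tilde I_hv(X)=v(X)$ for all $X\in\mathcal{N}_h$. $\widetilde H^2_0(\Omega)$ is the set of $v$ with $v|_{\Omega^\pm}\in H^2(\Omega^\pm)$, zero trace on $\partial\Omega$, and $v^+=v^-$, $\beta^+\nabla v^+\cdot\mathbf{n}=\beta^-\nabla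 v^-\cdot\mathbf{n}$ on $\Gamma$. *)

(* Defs.v *)
From HB Require Import structures.
From mathcomp Require Import all_boot all_order all_algebra.
From mathcomp Require Import all_classical all_reals all_analysis.

Set Implicit Arguments.
Unset Strict Implicit.
Unset Printing Implicit Defensive.
Import Order.TTheory GRing.Theory Num.Theory.
Import numFieldNormedType.Exports.
Local Open Scope classical_set_scope.
Local Open Scope ring_scope.

(** The plane is [R * R] with [R : realType].  A boolean [i] names a coordinate
    (false: the first, true: the second); a boolean [s] names a side of the
    interface (false: "-", true: "+"). *)

Section Plane.
Context {R : realType}.
Implicit Types (x y a b : R * R) (i : bool).

Definition pcoord i x : R := if i then x.2 else x.1.
Definition axis i : R * R := if i then (0, 1) else (1, 0).

(* The norm that the library puts on [R * R] is the sup norm. *)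
Definition dot x y : R := x.1 * y.1 + x.2 * y.2.
Definition enorm x : R := Num.sqrt (dot x x).

Definition line a b : R -> R * R := fun t => a + t *: (b - a).
Definition segment a b : set (R * R) := line a b @` `[0, 1].
Definition tangent a b : R * R := (enorm (b - a))^-1 *: (b - a).

(* Arc-length integral of [f] over the segment [ab]. *)
Definition line_integral a b (f : R * R -> R) : R :=
  enorm (b - a) * \int[lebesgue_measure]_(t in `[0, 1]) f (line a b t).

Definition bdry (D : set (R * R)) : set (R * R) := closure D `\` interior D.

End Plane.

Section Differentiation.
Context {R : realType}.
Implicit Types (f : R * R -> R) (V : R * R -> R * R).

Definition partial (i : bool) f : R * R -> R := fun x => 'D_(axis i) f x.
Definition grad f : R * R -> R * R :=
  fun x => (partial false f x, partial true f x).
Definition curl V : R * R -> R :=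
  fun x => partial false (pcoord true \o V) x
         - partial true (pcoord false \o V) x.

Definition iter_partial (l : seq bool) f : R * R -> R := foldr partial f l.

(* C^oo on the whole plane. *)
Definition smooth f : Prop := forall l : seq bool,
  continuous (iter_partial l f) /\
  forall i x, derivable (iter_partial l f) x (axis i).

Definition test_function (D : set (R * R)) (phi : R * R -> R) : Prop :=
  smooth phi /\
  exists K : set (R * R),
    [/\ compact K, K `<=` D & forall x, ~ K x -> phi x = 0].

Definition velocity (gam : R -> R * R) (t : R) : R * R :=
  (derive1 (pcoord false \o gam) t, derive1 (pcoord true \o gam) t).

(* [gam] is a regular C^oo parametrization, of period 1, of a simple closed
   curve. *)
Definition smooth_jordan (gam : R -> R * R) : Prop :=
  [/\ forall (i : bool) (n : nat) (t : R),
        derivable (derive1n n (pcoord i \o gam)) t 1,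
      forall t, gam (t + 1) = gam t,
      forall t, velocity gam t != 0 &
      {in `[0, 1[ &, injective gam}].

(* The normal vector at [gam t], up to its (irrelevant) length. *)
Definition curve_normal (gam : R -> R * R) (t : R) : R * R :=
  ((velocity gam t).2, - (velocity gam t).1).

End Differentiation.

Section Sobolev.
Context {R : realType}.
Implicit Types (D : set (R * R)) (u : R * R -> R) (U : R * R -> R * R).

Definition area
    : {measure set (measurableTypeR R * measurableTypeR R) -> \bar R} :=
  (@lebesgue_measure R \x @lebesgue_measure R)%E.

Definition L2 d (T : measurableType d) (m : set T -> \bar R)
    (A : set T) (f : T -> R) : Prop :=
  measurable_fun A f /\ (\int[m]_(x in A) ((f x) ^+ 2)%:E < +oo)%E.

Definition L2dist2 d (T : measurableType d) (m : set T -> \bar R)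
    (A : set T) (f g : T -> R) : \bar R :=
  (\int[m]_(x in A) ((f x - g x) ^+ 2)%:E)%E.

Definition weak_partial D (i : bool) u (g : R * R -> R) : Prop :=
  forall phi, test_function D phi ->
    \int[area]_(x in D) (u x * partial i phi x) =
    - \int[area]_(x in D) (g x * phi x).

(* [u] is in H^1(D) and [U] is its weak gradient on [D]. *)
Definition H1grad D u U : Prop :=
  L2 area D u /\
  forall i, L2 area D (pcoord i \o U) /\ weak_partial D i u (pcoord i \o U).

Definition H1 D u : Prop := exists U, H1grad D u U.

Definition H2 D u : Prop :=
  exists U, H1grad D u U /\ forall i, H1 D (pcoord i \o U).

(* [g] is the trace of [u] in H^1(D) on the part of the curve [gam] over
   [0, 1] that lies in the closure of [D]: the L^2 limit on the curve of the
   restrictions of functions smooth up to the boundary that converge to [u]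
   in H^1(D).  The arc-length weight |gam'| is left out, being bounded above
   and away from 0. *)
Definition trace D (gam : R -> R * R) u (g : R * R -> R) : Prop :=
  let S := [set t | t \in `[0, 1] /\ closure D (gam t)] in
  L2 (@lebesgue_measure R) S (g \o gam) /\
  exists2 U, H1grad D u U & exists phi : nat -> R * R -> R,
    [/\ forall k, smooth (phi k),
        (fun k => L2dist2 area D (phi k) u) @ \oo --> 0%E,
        forall i, (fun k => L2dist2 area D (partial i (phi k))
                              (pcoord i \o U)) @ \oo --> 0%E &
        (fun k => L2dist2 (@lebesgue_measure R) S (phi k \o gam) (g \o gam))
          @ \oo --> 0%E].

(* The value at a point of the closure of [D] of the continuous
   representative of [u]. *)
Definition point_value D u (X : R * R) (c : R) : Prop :=
  exists ubar : R * R -> R,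
    [/\ {within closure D, continuous ubar},
        {ae area, forall x, D x -> u x = ubar x} &
        ubar X = c].

End Sobolev.

Section Domain.
Context {R : realType}.
Variables (Omega : set (R * R)) (gam : R -> R * R) (Om : bool -> set (R * R)).

(* [Omega = interior (closure Omega)] excludes slits. *)
Definition polygonal_domain : Prop :=
  [/\ Omega !=set0, open Omega, connected Omega, bounded_set Omega &
      Omega = interior (closure Omega) /\
      exists l : seq ((R * R) * (R * R)),
        bdry Omega = [set x | exists2 ab, ab \in l & segment ab.1 ab.2 x]].

(* Since [Omega] is open and [range gam] is compact, the curve does not touch
   the boundary of [Omega]. *)
Definition interface : Prop :=
  [/\ smooth_jordan gam,
      range gam `<=` Omega,
      forall s, [/\ Om s !=set0, open (Om s) & connected (Om s)],
      Om false `&` Om true = set0 &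
      Om false `|` Om true = Omega `\` range gam].

(* The last clause is the flux condition; [q s] is the trace on the curve of
   the gradient taken from the side [s]. *)
Definition H2tilde0 (beta : bool -> R) (v : R * R -> R) : Prop :=
  [/\ forall s, H2 (Om s) v,
      forall a b, a != b -> segment a b `<=` bdry Omega ->
        forall s, trace (Om s) (line a b) v (cst 0),
      exists g, forall s, trace (Om s) gam v g &
      exists G : R * R -> R * R, (forall s, H1grad (Om s) v G) /\
      exists q : bool -> R * R -> R * R,
        (forall s i, trace (Om s) gam (pcoord i \o G) (pcoord i \o q s)) /\
        {ae @lebesgue_measure R, forall t, t \in `[0, 1] ->
          beta true * dot (q true (gam t)) (curve_normal gam t) =
          beta false * dot (q false (gam t)) (curve_normal gam t)}].

(* [c] is the integral over the segment [ab] of the tangential component of a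
   vector field that is piecewise H^1; where the segment crosses the
   interface, the trace is taken from either side. *)
Definition tangential_integral (u : R * R -> R * R) (a b : R * R) (c : R)
    : Prop :=
  exists2 g, (forall s, trace (Om s) (line a b)
                          (fun x => dot (u x) (tangent a b)) g)
           & c = line_integral a b g.

End Domain.

Section Mesh.
Context {R : realType}.
Variables (Omega : set (R * R)) (gam : R -> R * R) (Om : bool -> set (R * R)).
Variables (n : nat) (node : 'I_n -> R * R) (elems : {set {set 'I_n}}).
Implicit Types (K L A : {set 'I_n}) (i j k : 'I_n).

(* The closed convex hull of the nodes in [A]: a triangle, edge or vertex
   according to the number of nodes in [A]. *)
Definition hull A : set (R * R) :=
  [set x | exists2 l : 'I_n -> R,
     (forall i, 0 <= l i) /\ \sum_(i in A) l i = 1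
     & x = \sum_(i in A) l i *: node i].

(* An element is identified with the set of its three vertices. *)
Definition triangulation : Prop :=
  [/\ injective node,
      forall i, exists2 K, K \in elems & i \in K,
      forall K, K \in elems -> #|K| = 3 /\ interior (hull K) !=set0,
      forall K L, K \in elems -> L \in elems ->
        hull K `&` hull L = hull (K :&: L)%SET &
      closure Omega = [set x | exists2 K, K \in elems & hull K x]].

Definition no_obtuse_angle : Prop :=
  forall K i j k, K \in elems -> i \in K -> j \in K -> k \in K ->
    0 <= dot (node j - node i) (node k - node i).

Definition interface_elem K : Prop :=
  K \in elems /\ interior (hull K) `&` range gam !=set0.

(* Edges of [K] are given with an orientation, from [node i] to [node j]. *)
Definition edge_of K i j : Prop :=
  [/\ K \in elems, i \in K, j \in K & i != j].

(* The open side [s] of the line through [D] with normal [nb], which points to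
   the side "+". *)
Definition side (D nb : R * R) (s : bool) : set (R * R) :=
  [set x | if s then 0 < dot (x - D) nb else dot (x - D) nb < 0].

(* [D], [E] are the two points where the interface meets the boundary of [K];
   they lie on different edges, i.e. no edge contains both.  [nb] is the unit
   normal to [DE] that points from T_h^- to T_h^+, where the vertices in T_h^s
   are those on the side [s] of the interface. *)
Definition cut K (D E nb : R * R) : Prop :=
  [/\ D != E /\ bdry (hull K) `&` range gam = [set D; E],
      forall i j, edge_of K i j ->
        ~ (segment (node i) (node j) D /\ segment (node i) (node j) E),
      enorm nb = 1, dot nb (E - D) = 0 &
      forall s i, i \in K -> side D nb s (node i) -> closure (Om s) (node i)].

(* The mesh hypothesis, with the points [D K], [E K] and the normal [nb K]
   given as functions of the interface element. *)
Definition mesh_cuts (D E nb : {set 'I_n} -> R * R) : Prop :=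
  forall K, interface_elem K -> cut K (D K) (E K) (nb K).

Section Spaces.
Variables (mu beta : bool -> R) (D E nb : {set 'I_n} -> R * R).

Definition ND (v : R * R -> R * R) : Prop :=
  exists (a : R * R) (b : R), forall x, v x = a + b *: (x.2, - x.1).

Definition P1 (w : R * R -> R) : Prop :=
  exists (c : R) (a : R * R), forall x, w x = c + dot a x.

(* The relation [C_T vm = vp]; its first condition is imposed along the
   segment Gamma_h^T, on which the tangential component of a function of [ND]
   is constant. *)
Definition CT K (vm vp : R * R -> R * R) : Prop :=
  [/\ forall x, segment (D K) (E K) x ->
        dot (vp x) (tangent (D K) (E K)) = dot (vm x) (tangent (D K) (E K)),
      forall x, (mu true)^-1 * curl vp x = (mu false)^-1 * curl vm x &
      let Xm := line (D K) (E K) (1 / 2) in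
      beta true * dot (vp Xm) (nb K) = beta false * dot (vm Xm) (nb K)].

(* Local functions are constrained on the closed element only, so that they
   carry their traces on its edges; those of [IND_loc] are two-valued, hence
   left free, on Gamma_h^T. *)
Definition IND_loc K (z : R * R -> R * R) : Prop :=
  (interface_elem K -> exists2 v : bool -> R * R -> R * R,
     (forall s, ND (v s)) /\ CT K (v false) (v true)
     & forall s x, hull K x -> side (D K) (nb K) s x -> z x = v s x) /\
  (~ interface_elem K -> exists2 v, ND v & forall x, hull K x -> z x = v x).

Definition Stilde_loc K (w : R * R -> R) : Prop :=
  (interface_elem K -> exists2 p : bool -> R * R -> R,
     [/\ forall s, P1 (p s),
         forall x, segment (D K) (E K) x -> p true x = p false x &
         forall x, beta false * dot (grad (p false) x) (nb K) =
                   beta true * dot (grad (p true) x) (nb K)]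
     & forall s x, hull K x ->
         side (D K) (nb K) s x \/ segment (D K) (E K) x -> w x = p s x) /\
  (~ interface_elem K -> exists2 p, P1 p & forall x, hull K x -> w x = p x).

(* Global functions are families of local functions indexed by elements. *)

Definition IND (z : {set 'I_n} -> R * R -> R * R) : Prop :=
  (forall K, K \in elems -> IND_loc K (z K)) /\
  forall K L i j, edge_of K i j -> edge_of L i j ->
    line_integral (node i) (node j)
      (fun x => dot (z K x) (tangent (node i) (node j))) =
    line_integral (node i) (node j)
      (fun x => dot (z L x) (tangent (node i) (node j))).

Definition Stilde (w : {set 'I_n} -> R * R -> R) : Prop :=
  (forall K, K \in elems -> Stilde_loc K (w K)) /\
  forall K L i, K \in elems -> L \in elems -> i \in K -> i \in L ->
    w K (node i) = w L (node i).

(* [z] is the edge interpolant of the piecewise H^1 vector field [u]. *)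
Definition edge_interpolant (u : R * R -> R * R)
    (z : {set 'I_n} -> R * R -> R * R) : Prop :=
  IND z /\
  forall K i j, edge_of K i j ->
    tangential_integral Om u (node i) (node j)
      (line_integral (node i) (node j)
        (fun x => dot (z K x) (tangent (node i) (node j)))).

(* [w] is the nodal interpolant of [v]. *)
Definition nodal_interpolant (v : R * R -> R)
    (w : {set 'I_n} -> R * R -> R) : Prop :=
  Stilde w /\
  forall K i, K \in elems -> i \in K ->
    point_value Omega v (node i) (w K (node i)).

(* Equality of the broken field [z] with the elementwise gradient of [w], at
   all points inside an element and off Gamma_h^T. *)
Definition eq_broken_grad (z : {set 'I_n} -> R * R -> R * R)
    (w : {set 'I_n} -> R * R -> R) : Prop :=
  forall K x, K \in elems -> interior (hull K) x ->
    (interface_elem K -> ~ segment (D K) (E K) x) ->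
    z K x = grad (w K) x.

End Spaces.
End Mesh.

(* Main.v *)
(** Functions of the local spaces are determined by their degrees of freedom, so
    everything follows from [int_e grad v . t = v(B) - v(A)] for each edge
    [e = AB].  Testing the weak gradient on a thin strip along [e] against a
    smoothed indicator of a segment of [e] times a unit mass that concentrates
    on [e] yields this on every segment off the interface, with the trace of
    [grad v . t] on the left and the continuous representative of [v] on the
    right; the interface meets [e] in finitely many points, and continuity of
    [v] joins the segments.
    On an element the difference of the edge interpolant and of the gradient of
    the nodal interpolant then has vanishing edge integrals.  By Stokes' theorem
    its curl, whose sign is constant, vanishes; the two remaining constant
    vectors vanish because the triangle has no obtuse angle. *)
Require Import Defs.
From mathcomp Require Import all_boot all_order all_algebra.
From mathcomp Require Import all_classical all_reals all_analysis.
From mathcomp Require Import measurable_realfun ring lra.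
Set Implicit Arguments.
Unset Strict Implicit.
Unset Printing Implicit Defensive.
Import Order.TTheory GRing.Theory Num.Theory.
Import numFieldNormedType.Exports.
Local Open Scope classical_set_scope.
Local Open Scope ring_scope.

(** * Smooth cut-off functions *)

Section FlatFunctions.
Context {R : realType}.
Implicit Types (f g : R -> R) (y : R) (n : nat).

(** The weak gradient and the traces are accessible only through integrals and L^2 limits, so a
    statement about an edge is always reached as a limit of area integrals over strips of width
    [ep]. The smooth approximants in the definition of [trace] give the link: between the edge and
    the mass concentrating on it, they change by the integral of one transverse derivative, whose
    L^2 norm is bounded independently of the strip. The error then has the form C lam + c ep / lam
    with [lam] free; [lam = th] and [ep <= th ^ 2] make it O(th). A strip is erected on the inner
    side of the edge, inside one element. It therefore lies in the domain and, over a short enough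
    piece of the edge, on a single side of the interface; edges on the boundary of the domain, or
    touched by the interface from outside the element, need no separate treatment. Test functions
    have to be C^oo in the sense of all iterated partial derivatives. They are taken from
    inductively defined classes that are closed under differentiation, so that smoothness is proved
    once for each class. *)

Lemma is_derive_congr (V : normedModType R) (f g : V -> R) (x v : V) (d d' : R) :
  is_derive x v f d -> f =1 g -> d = d' -> is_derive x v g d'.
Proof. by move=> fd /funext <- <-. Qed.

(** Serves at the junction point 0 of [flat], where no differentiation rule applies: the difference
    quotient is O(h). *)
Lemma is_derive0_of_sqr_bound f (C : R) :
  (forall h, `|f h| <= C * h ^+ 2) -> is_derive (0 : R) 1 f 0.
Proof.
move=> fC.
have f0 : f 0 = 0 by apply/eqP; rewrite -normr_le0 (le_trans (fC 0))// expr0n mulr0.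
have C0 : 0 <= C by have := le_trans (normr_ge0 _) (fC 1); rewrite expr1n mulr1.
have cv : (fun h => h^-1 *: ((f \o shift 0) (h *: (1 : R)) - f 0)) @ 0^' --> (0 : R).
  apply/cvgr0Pnorm_lt => e e0.
  near=> h.
  have h0 : h != 0 by near: h; exact: nbhs_dnbhs_neq.
  rewrite /= addr0 f0 subr0 /GRing.scale /= mulr1 normrM normfV.
  rewrite mulrC ltr_pdivrMr ?normr_gt0//.
  apply: (le_lt_trans (fC h)).
  rewrite -(real_normK (num_real h)) expr2 mulrA ltr_pM2r ?normr_gt0//.
  (* [C + 1] because C may be 0. *)
  have hC : `|h| < e / (C + 1).
    near: h; apply: dnbhs0_lt; apply: divr_gt0 => //; lra.
  rewrite ltr_pdivlMr in hC; last by lra.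
  by have := normr_ge0 h; nra.
apply: DeriveDef; first by apply/cvg_ex; exists 0.
by apply: (@cvg_lim R) => //.
Unshelve. all: by end_near. Qed.

(** The classical flat function exp(-1/y), with a factor y^-n so that derivatives are again linear
    combinations of members of the family. *)
Definition flat n y : R := if 0 < y then y^-1 ^+ n * expR (- y^-1) else 0.

Lemma flat_le0 n y : y <= 0 -> flat n y = 0.
Proof. by rewrite /flat ltNge => ->. Qed.

Lemma flat_gt0 n y : 0 < y -> 0 < flat n y.
Proof. by move=> y0; rewrite /flat y0 mulr_gt0 ?expR_gt0 ?exprn_gt0 ?invr_gt0. Qed.

Lemma flat_ge0 n y : 0 <= flat n y.
Proof. by have [/(flat_le0 n)->//|/(flat_gt0 n)/ltW] := leP y 0. Qed.

(** With t = 1/y this is t^(n+2) <= (n+2)! exp(t), a single term of the exponential series. *)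
Lemma flat_sqr_bound n y : `|flat n y| <= (n.+2)`!%:R * y ^+ 2.
Proof.
rewrite ger0_norm ?flat_ge0//.
have [y0|y0] := leP y 0; first by rewrite flat_le0// mulr_ge0// sqr_ge0.
rewrite /flat y0 expRN ler_pdivrMr ?expR_gt0//.
have t0 : 0 < y^-1 by rewrite invr_gt0.
have := expR_ge1Dxn n.+1 (ltW t0) => /(le_trans _) H.
have {H} : y^-1 ^+ n.+2 / (n.+2)`!%:R <= expR y^-1 by apply: H; lra.
rewrite ler_pdivrMr ?ltr0n ?fact_gt0// => H.
have -> : y^-1 ^+ n = y ^+ 2 * y^-1 ^+ n.+2.
  by rewrite -(addn2 n) exprD mulrCA -exprMn mulfV ?gt_eqF// expr1n mulr1.
rewrite (_ : _ * expR _ = y ^+ 2 * (expR y^-1 * (n.+2)`!%:R)); last by ring.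
by apply: ler_wpM2l => //; exact: sqr_ge0.
Qed.

Lemma is_derive_flat n y :
  is_derive y 1 (flat n) (flat n.+2 y - n%:R * flat n.+1 y).
Proof.
have [y0|y0|->] := ltgtP y 0.
- rewrite !flat_le0 ?(ltW y0)// mulr0 subr0.
  apply: (@near_eq_is_derive _ _ _ (cst 0)).
  have := lt_nbhsl y0; apply: filterS => x x0; by rewrite flat_le0// (ltW x0).
- have y1 := lt0r_neq0 y0.
  have dV : is_derive y 1 (fun x : R => x^-1) (- y ^- 2).
    by have := @is_deriveV _ id y 1 1 y1 _; rewrite /GRing.scale /= mulr1; exact.
  have dX : is_derive y 1 (fun x : R => x^-1 ^+ n) (- n%:R * y^-1 ^+ n.+1).
    apply: (is_derive_congr (is_deriveX n dV)) => [x|]; first by rewrite exprfctE.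
    case: n => [|n]; first by rewrite /GRing.scale/= !mul0r oppr0 mul0r.
    by rewrite /GRing.scale/= -exprVn !exprS; ring.
  have dE : is_derive y 1 (fun x : R => expR (- x^-1)) (expR (- y^-1) * y ^- 2).
    apply: (@is_derive1_comp _ expR (fun x => - x^-1)).
    by have := is_deriveN dV; rewrite opprK.
  apply: near_eq_is_derive; last first.
    apply: (is_derive_congr (is_deriveM dX dE)) => //.
    by rewrite /flat y0 /GRing.scale /= -exprVn !exprS; ring.
  have := lt_nbhsr y0; apply: filterS => x x0; by rewrite /flat x0.
- rewrite !flat_le0// mulr0 subr0.
  apply: (@is_derive0_of_sqr_bound _ (n.+2)`!%:R) => h; exact: flat_sqr_bound.
Qed.

Lemma is_derive_affine (a b y : R) : is_derive y 1 (fun y => a + b * y) b.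
Proof.
have := is_deriveD (is_derive_cst a y 1) (is_deriveZ b (is_derive_id y (1 : R))).
by rewrite add0r /GRing.scale /= mulr1.
Qed.

(* Closed under differentiation, which is what makes its members C^oo. *)
Inductive smooth1 : (R -> R) -> Prop :=
| smooth1_cst c : smooth1 (fun _ => c)
| smooth1_flat n a b : smooth1 (fun y => flat n (a + b * y))
| smooth1_add f g : smooth1 f -> smooth1 g -> smooth1 (fun y => f y + g y)
| smooth1_mul f g : smooth1 f -> smooth1 g -> smooth1 (fun y => f y * g y)
| smooth1_inv f : (forall y, f y != 0) -> smooth1 f ->
    smooth1 (fun y => (f y)^-1).

Lemma smooth1_derive f : smooth1 f ->
  exists2 f', smooth1 f' & forall y, is_derive y 1 f (f' y).
Proof.
elim=> {f}[c|n a b|f g _ [f' sf' df] _ [g' sg' dg]|f g sf [f' sf' df] sg [g' sg' dg]|f f0 sf [f'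
  sf' df]].
- by exists (fun=> 0); [exact: smooth1_cst|move=> y; exact: is_derive_cst].
- exists (fun y => (flat n.+2 (a + b * y) + (- n%:R) * flat n.+1 (a + b * y)) * b).
    apply: smooth1_mul; last exact: smooth1_cst.
    apply: smooth1_add; first exact: smooth1_flat.
    by apply: smooth1_mul; [exact: smooth1_cst|exact: smooth1_flat].
  move=> y; rewrite mulNr.
  apply: (@is_derive1_comp _ (flat n) (fun y => a + b * y)).
    exact: is_derive_flat.
  exact: is_derive_affine.
- exists (fun y => f' y + g' y); first exact: smooth1_add.
  move=> y; exact: is_deriveD.
- exists (fun y => f y * g' y + g y * f' y).
    by apply: smooth1_add; apply: smooth1_mul.
  move=> y; exact: is_deriveM.
- exists (fun y => - 1 * ((f y)^-1 * (f y)^-1) * f' y).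
    apply: smooth1_mul => //; apply: smooth1_mul; first exact: smooth1_cst.
    by apply: smooth1_mul; exact: smooth1_inv.
  move=> y; apply: (is_derive_congr (is_deriveV (f0 y) (df y))) => //.
  by rewrite /GRing.scale /= expr2 invfM mulN1r.
Qed.

Lemma smooth1_continuous f : smooth1 f -> continuous f.
Proof.
move=> /smooth1_derive[f' _ df] y; apply: differentiable_continuous.
by apply/derivable1_diffP; have [] := df y.
Qed.

(** The affine parameters of [smooth1_flat] make this closure property available. *)
Lemma smooth1_affine f a b : smooth1 f -> smooth1 (fun y => f (a + b * y)).
Proof.
elim=> {f}[c|n c d|f g _ sf _ sg|f g _ sf _ sg|f f0 _ sf].
- exact: smooth1_cst.
- rewrite (_ : (fun _ => _) = fun y => flat n ((c + d * a) + (d * b) * y)).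
    exact: smooth1_flat.
  by apply/funext => y; congr flat; ring.
- exact: smooth1_add.
- exact: smooth1_mul.
- exact: smooth1_inv.
Qed.

Let den y := flat 0 y + flat 0 (1 - y).

Let den_gt0 y : 0 < den y.
Proof.
rewrite /den; have [y0|y0] := leP y 0.
  by rewrite ltr_wpDl ?flat_ge0// flat_gt0//; lra.
by rewrite ltr_pwDl ?flat_ge0// flat_gt0//; lra.
Qed.

(** The standard smooth transition from 0 to 1 over [0, 1]; the denominator is positive because y
    and 1 - y are not both nonpositive. *)
Definition step y : R := flat 0 y / (flat 0 y + flat 0 (1 - y)).
(** The quotient rule after cancellation; in this form the sign, and the vanishing outside ]0, 1[,
    can be read off. *)
Definition dstep y : R :=
  (flat 2 y * flat 0 (1 - y) + flat 0 y * flat 2 (1 - y)) /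
  (flat 0 y + flat 0 (1 - y)) ^+ 2.

Lemma is_derive_step y : is_derive y 1 step (dstep y).
Proof.
have d1 : is_derive y 1 (flat 0) (flat 2 y).
  by have := is_derive_flat 0 y; rewrite mul0r subr0.
have d2 : is_derive y 1 (fun y => flat 0 (1 - y)) (- flat 2 (1 - y)).
  rewrite -mulrN1; apply: (@is_derive1_comp _ (flat 0) (fun y => 1 - y)).
    by have := is_derive_flat 0 (1 - y); rewrite mul0r subr0.
  rewrite (_ : (fun _ => _) = fun y => 1 + (-1) * y); first exact: is_derive_affine.
  by apply/funext => z; rewrite mulN1r.
have h : den y != 0 by rewrite gt_eqF.
apply: (is_derive_congr (is_deriveM d1 (is_deriveV h (is_deriveD d1 d2)))) => //.
rewrite /dstep -/(den y) /GRing.scale/= /den.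
rewrite /den in h; field; exact: h.
Qed.

Lemma smooth1_flat0 n : smooth1 (flat n).
Proof.
rewrite (_ : flat n = fun y => flat n (0 + 1 * y)); first exact: smooth1_flat.
by apply/funext => y; rewrite add0r mul1r.
Qed.

Lemma smooth1_flat1 n : smooth1 (fun y => flat n (1 - y)).
Proof.
rewrite (_ : (fun _ => _) = fun y => flat n (1 + (-1) * y)); first exact: smooth1_flat.
by apply/funext => y; rewrite mulN1r.
Qed.

Lemma smooth1_step : smooth1 step.
Proof.
apply: smooth1_mul; first exact: smooth1_flat0.
apply: (@smooth1_inv den) => [y|]; first by rewrite gt_eqF.
by apply: smooth1_add; [exact: smooth1_flat0|exact: smooth1_flat1].
Qed.

Lemma smooth1_dstep : smooth1 dstep.
Proof.
have s0 := smooth1_flat0; have s1 := smooth1_flat1.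
apply: smooth1_mul; first by apply: smooth1_add; apply: smooth1_mul.
rewrite (_ : (fun _ => _) = fun y => (den y * den y)^-1).
  apply: (@smooth1_inv (fun y => den y * den y)) => [y|].
    by rewrite mulf_neq0// gt_eqF.
  by apply: smooth1_mul; apply: smooth1_add.
by apply/funext => y; rewrite expr2.
Qed.

Lemma step_le0 y : y <= 0 -> step y = 0.
Proof. by move=> y0; rewrite /step flat_le0// mul0r. Qed.

Lemma step_ge1 y : 1 <= y -> step y = 1.
Proof.
move=> y1; rewrite /step [flat 0 (1 - y)]flat_le0 ?addr0 ?divff//; last by lra.
by rewrite gt_eqF// flat_gt0//; lra.
Qed.

Lemma step_ge0 y : 0 <= step y.
Proof. by rewrite divr_ge0 ?flat_ge0// ltW// den_gt0. Qed.

Lemma step_le1 y : step y <= 1.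
Proof. by rewrite ler_pdivrMr ?den_gt0// mul1r lerDl flat_ge0. Qed.

Lemma dstep_ge0 y : 0 <= dstep y.
Proof.
by rewrite divr_ge0 ?exprn_ge0 ?addr_ge0 ?mulr_ge0 ?flat_ge0.
Qed.

Lemma dstep_out y : y \notin `]0, 1[ -> dstep y = 0.
Proof.
rewrite in_itv/= negb_and -!leNgt /dstep => /orP[y0|y1].
  by rewrite !(flat_le0 _ y0) !mul0r addr0 mul0r.
have y1' : 1 - y <= 0 by lra.
by rewrite !(flat_le0 _ y1') !mulr0 addr0 mul0r.
Qed.

End FlatFunctions.

(** * Smooth functions of two variables *)

Section SmoothPlane.
Context {R : realType}.
Implicit Types (f g : R * R -> R).

(** Reduces directional derivatives to one variable: both difference quotients are the same function
    of the increment. *)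
Lemma is_derive_line (V : normedModType R) (F : V -> R) (x v : V) (h d : R) :
  is_derive h 1 (fun t => F (x + t *: v)) d <-> is_derive (x + h *: v) v F d.
Proof.
suff E : (fun k : R => k^-1 *: (((fun t => F (x + t *: v)) \o shift h) (k *: 1) - F (x + h *: v))) =
         (fun k : R => k^-1 *: ((F \o shift (x + h *: v)) (k *: v) - F (x + h *: v))).
  by split=> -[dF vF]; split; rewrite ?/derivable ?/derive;
    rewrite ?/derivable ?/derive in dF vF; move: dF vF; rewrite E.
apply/funext => k /=; congr (_ *: (F _ - _)).
by rewrite scalerDl -[k%:A]/(k * 1) mulr1 addrCA.
Qed.

(** The affine argument is general enough for the two oblique coordinates of a strip. As with
    [smooth1], closure under partial derivatives yields [smooth]. *)
Inductive smooth2 : (R * R -> R) -> Prop :=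
| smooth2_comp h (c0 c1 c2 : R) : smooth1 h ->
    smooth2 (fun x => h (c0 + c1 * x.1 + c2 * x.2))
| smooth2_add f g : smooth2 f -> smooth2 g -> smooth2 (fun x => f x + g x)
| smooth2_mul f g : smooth2 f -> smooth2 g -> smooth2 (fun x => f x * g x).

Lemma is_derive_affine_comp (f f' : R -> R) (c0 c1 c2 : R) (x v : R * R) :
  (forall y : R, is_derive y 1 f (f' y)) ->
  is_derive x v (fun x => f (c0 + c1 * x.1 + c2 * x.2))
    (f' (c0 + c1 * x.1 + c2 * x.2) * (c1 * v.1 + c2 * v.2)).
Proof.
move=> df; rewrite -[x in is_derive x](addr0) -(scale0r v).
apply/is_derive_line.
pose a := c0 + c1 * x.1 + c2 * x.2; pose b := c1 * v.1 + c2 * v.2.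
have h : is_derive (0 : R) 1 (f \o (fun t => a + b * t)) (f' (a + b * 0) * b).
  exact: is_derive1_comp (df _) (is_derive_affine _ _ _).
apply: (is_derive_congr h) => [t|]; rewrite /= ?mulr0 ?addr0 ?scale0r ?addr0//.
by congr f; rewrite /a /b /GRing.scale/=; ring.
Qed.

Lemma smooth2_continuous f : smooth2 f -> continuous f.
Proof.
elim=> {f}[f c0 c1 c2 sf|f g _ cf _ cg|f g _ cf _ cg] x.
- apply: (@continuous_comp _ _ _ (fun x : R * R => c0 + c1 * x.1 + c2 * x.2) f);
  last exact: smooth1_continuous.
  apply: cvgD; last by apply: cvgMr; exact: cvg_snd.
  by apply: cvgD; [exact: cvg_cst|apply: cvgMr; exact: cvg_fst].
- by apply: cvgD; [exact: cf|exact: cg].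
- by apply: cvgM; [exact: cf|exact: cg].
Qed.

Lemma smooth2_derive f : smooth2 f -> forall i,
  exists2 f', smooth2 f' & forall x, is_derive x (axis i) f (f' x).
Proof.
move=> + i; elim=> {f}[f c0 c1 c2 sf|f g _ [f' sf' df] _ [g' sg' dg]|f g sf [f' sf' df] sg [g'
  sg' dg]].
- have [f' sf' df] := smooth1_derive sf.
  exists (fun x => f' (c0 + c1 * x.1 + c2 * x.2) * (c1 * (@axis R i).1 + c2 * (@axis R i).2)).
    apply: smooth2_mul; first exact: smooth2_comp.
    by apply: (@smooth2_comp (fun=> _) 0 0 0); exact: smooth1_cst.
  by move=> x; exact: is_derive_affine_comp.
- exists (fun x => f' x + g' x); first exact: smooth2_add.
  move=> x; exact: is_deriveD.
- exists (fun x => f x * g' x + g x * f' x).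
    by apply: smooth2_add; exact: smooth2_mul.
  move=> x; exact: is_deriveM.
Qed.

Lemma smooth2_partial f i : smooth2 f -> smooth2 (partial i f).
Proof.
move=> /smooth2_derive/(_ i)[f' sf' df].
by rewrite (_ : partial i f = f')//; apply/funext => x; rewrite /partial derive_val.
Qed.

Lemma smooth2_smooth f : smooth2 f -> smooth f.
Proof.
move=> sf l; have {sf} : smooth2 (iter_partial l f).
  by elim: l => //= i l; exact: smooth2_partial.
move=> sf; split; first exact: smooth2_continuous.
by move=> i x; have [f' _ df] := smooth2_derive sf i; have [] := df x.
Qed.

End SmoothPlane.

(** * Integration in skew strips *)

Section PlaneMeasure.
Context {R : realType}.
Local Notation mR := (measurableTypeR R).
Local Notation plane := (mR * mR)%type.
Local Notation leb := (@lebesgue_measure R).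

(** The plane carries the product sigma-algebra, so U is exhibited as a countable union of rational
    boxes. *)
Lemma open_measurable_plane (U : set (R * R)) : open U -> measurable (U : set plane).
Proof.
move=> oU.
pose box (q : (rat * rat) * (rat * rat)) : set plane :=
  `]ratr q.1.1, ratr q.1.2[%classic `*` `]ratr q.2.1, ratr q.2.2[%classic.
pose F q : set plane := if `[< box q `<=` U >] then box q else set0.
have -> : (U : set plane) = \bigcup_q F q.
  apply/seteqP; split => [x Ux|x [q _]]; last first.
    by rewrite /F; case: ifPn => [/asboolP h /h|].
  have /nbhs_ballP[e /= e0 xe] : nbhs x U by rewrite nbhsE; exists U.
  have rat_near (y : R) : exists p q : rat, [/\ y - e < ratr p, ratr p < y, y < ratr q &
    ratr q < y + e].
    have [p] : exists p, ratr p \in `]y - e, y[ by apply: rat_in_itvoo; lra.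
    have [q] : exists q, ratr q \in `]y, y + e[ by apply: rat_in_itvoo; lra.
    by rewrite !in_itv/= => /andP[? ?] /andP[? ?]; exists p, q.
  have [p1 [q1 [h1 h2 h3 h4]]] := rat_near x.1.
  have [p2 [q2 [k1 k2 k3 k4]]] := rat_near x.2.
  exists ((p1, q1), (p2, q2)) => //.
  rewrite /F ifT; first by split; rewrite /= in_itv/= ?h2 ?h3 ?k2 ?k3.
  apply/asboolP => y [/=]; rewrite !in_itv/= => /andP[y1 y2] /andP[y3 y4].
  apply: xe; split; rewrite /ball/= ltr_norml; apply/andP; split; lra.
apply: countable_bigcupT_measurable => [|q]; first exact: countableP.
rewrite /F; case: ifPn => _ //; apply: measurableX; exact: measurable_itv.
Qed.

Lemma continuous_measurable_plane (f : R * R -> R) :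
  continuous f -> measurable_fun [set: plane] (f : plane -> R).
Proof.
move=> /continuousP cf; apply: (measurability _ (RGenOpens.measurableE R)).
move=> _ [_ [a [b ->] <-]]; rewrite setTI; apply: open_measurable_plane.
exact/cf/interval_open.
Qed.

(** The right-hand side is a measure in A, so comparison on intervals ]a, b] suffices; for k < 0
    their preimages are closed on the left instead. *)
Lemma lebesgue_measure_affine (c k : R) (A : set mR) : k != 0 -> measurable A ->
  leb A = (`|k|%:E * leb [set x : mR | A (c + k * x)%R])%E.
Proof.
move=> k0 mA.
have k1 : 0 < `|k| by rewrite normr_gt0.
pose phi (x : mR) : mR := c + k * x.
have mphi : measurable_fun setT phi by apply: measurable_funD => //; exact: measurable_funM.
have -> : [set x : mR | A (c + k * x)] = phi @^-1` A by [].
pose mu : {measure set mR -> \bar R} :=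
  measure_function_pushforward__canonical__measure_function_Measure leb mphi.
rewrite -[leb (phi @^-1` A)]/(mu A).
pose r : {nonneg R} := NngNum (ltW k1).
rewrite -[RHS]/(mscale r mu A).
apply/lebesgue_measure_unique => // _ [[a b]] _ <-/=.
rewrite /mscale/= /mu/= /pushforward.
have [kp|kn|kz] := ltgtP 0 k; last by rewrite -kz eqxx in k0.
- rewrite (_ : phi @^-1` _ = `](a - c) / k, (b - c) / k]%classic); last first.
    apply/seteqP; split => x /=; rewrite !in_itv/= /phi ltr_pdivrMr// ler_pdivlMr// =>
      /andP[? ?]; apply/andP; split; lra.
  rewrite !lebesgue_measure_itv/= !lte_fin ltr_pM2r ?invr_gt0// ltrD2r.
  case: ifPn => _; last by rewrite mule0.
  by rewrite (gtr0_norm kp) -!EFinB -EFinM; congr EFin; field; rewrite gt_eqF.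
- rewrite (_ : phi @^-1` _ = `[(b - c) / k, (a - c) / k[%classic); last first.
    apply/seteqP; split => x /=; rewrite !in_itv/= /phi ltr_ndivlMr// ler_ndivrMr// =>
      /andP[? ?]; apply/andP; split; lra.
  rewrite !lebesgue_measure_itv/= !lte_fin ltr_nM2r ?invr_lt0// ltrD2r.
  case: ifPn => _; last by rewrite mule0.
  by rewrite (ltr0_norm kn) -!EFinB -EFinM; congr EFin; field; rewrite lt_eqF.
Qed.

End PlaneMeasure.

Section Parallelogram.
Context {R : realType}.
Local Notation mR := (measurableTypeR R).
Local Notation plane := (mR * mR)%type.
Local Notation leb := (@lebesgue_measure R).
Local Notation area := (@area R).

Definition det2 (x y : R * R) : R := x.1 * y.2 - x.2 * y.1.
Definition par (a T N : R * R) (q : R * R) : R * R := a + q.1 *: T + q.2 *: N.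

Lemma continuous_par a T N : continuous (par a T N).
Proof.
move=> q; rewrite /par; apply: cvgD; last by apply: cvgZl; exact: cvg_snd.
by apply: cvgD; [exact: cvg_cst|apply: cvgZl; exact: cvg_fst].
Qed.

Lemma measurable_par a T N : measurable_fun [set: plane] (par a T N : plane -> plane).
Proof.
apply/measurable_fun_pairP; split; apply: continuous_measurable_plane.
  by move=> q; apply: continuous_comp; [exact: continuous_par|exact: cvg_fst].
by move=> q; apply: continuous_comp; [exact: continuous_par|exact: cvg_snd].
Qed.

Lemma measurable_affine (c k : R) (A : set mR) : measurable A ->
  measurable [set x : mR | A (c + k * x)].
Proof.
move=> mA; rewrite -[X in measurable X]setTI.
have : measurable_fun setT ((fun x => c + k * x) : mR -> mR).
  by apply: measurable_funD => //; exact: measurable_funM.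
by move=> /(_ measurableT _ mA).
Qed.

Let integral_if (A' : set mR) (c : \bar R) (f : mR -> \bar R) : measurable A' ->
  (forall t, A' t -> f t = c) -> (forall t, ~ A' t -> f t = 0%E) ->
  (\int[leb]_t f t = c * leb A')%E.
Proof.
move=> mA' f1 f0; rewrite -integral_cst// [RHS]integral_mkcond.
apply: eq_integral => t _; rewrite patchE; case: ifPn.
  by rewrite inE => /f1.
by rewrite notin_setE => /f0.
Qed.

Let rect_measure (lA lA' lB : \bar R) (p s d : R) : s != 0 -> d = `|p| * `|s| ->
  (lA = `|p|%:E * lA' -> d%:E * ((`|s|^-1)%:E * lB * lA') = lA * lB)%E.
Proof.
move=> s0 -> ->.
rewrite -!muleA !EFinM -!muleA; congr (_ * _)%E.
rewrite muleA -EFinM mulfV ?normr_eq0// mul1e; exact: muleC.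
Qed.

(** By uniqueness of the product measure it suffices to take a rectangle A x B. As N is parallel to
    an axis, one of the two conditions on [par a T N (t, e)] involves t alone and the other is
    affine in e with slope s; hence each section in e is either empty or of a fixed measure, and
    only the one-dimensional formula is needed. *)
Lemma area_par a T i s (A : set plane) : det2 T (s *: axis i) != 0 -> measurable A ->
  area A = (`|det2 T (s *: axis i)|%:E * area (par a T (s *: axis i) @^-1` A))%E.
Proof.
set N := s *: axis i => D0 mA.
have s0 : s != 0 by apply: contraNneq D0 => s0; rewrite /N s0 scale0r /det2/= !mulr0 subr0.
have D1 : 0 < `|det2 T N| by rewrite normr_gt0.
have mphi := @measurable_par a T N.
pose mu : {measure set plane -> \bar R} :=
  measure_function_pushforward__canonical__measure_function_Measure area mphi.
rewrite -[area (par a T N @^-1` A)]/(mu A).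
pose r : {nonneg R} := NngNum (ltW D1).
rewrite -[RHS]/(mscale r mu A).
apply/product_measure_unique => //= {mA}A B mA mB.
rewrite /mscale /mu/= /pushforward /Defs.area /product_measure1/=.
have inner (C : set mR) (c : R) : measurable C ->
    leb [set e : mR | C (c + s * e)] = ((`|s|^-1)%:E * leb C)%E.
  move=> mC; rewrite (lebesgue_measure_affine c s0 mC) muleA -EFinM mulVf ?mul1e//.
  by rewrite normr_eq0.
move: D0; rewrite /det2 /N; case: (i) => /=; rewrite /GRing.scale/= !mulr0 !mulr1 ?subr0 ?sub0r
  ?normrN => D0.
- have T0 : T.1 != 0 by apply: contraNneq D0 => ->; rewrite mul0r.
  rewrite (@integral_if [set t : mR | A (a.1 + T.1 * t)] ((`|s|^-1)%:E * leb B)%E).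
  + by apply: rect_measure (lebesgue_measure_affine a.1 T0 mA) => //; rewrite normrM.
  + exact: measurable_affine.
  + move=> t At; rewrite -(inner _ (a.2 + t * T.2))//; congr (leb _).
    apply/seteqP; split => e; rewrite /xsection/= inE/=.
      by rewrite /par/= /GRing.scale/= mulr1 => -[_]; rewrite (mulrC e).
    move=> Be; rewrite /par; split => /=; rewrite /GRing.scale/= ?mulr0 ?addr0 ?mulr1.
      by rewrite mulrC.
    by rewrite (mulrC e).
  + move=> t At; rewrite (_ : xsection _ _ = set0) ?measure0//.
    apply/seteqP; split => // e; rewrite /xsection/= inE/= => -[/=].
    by rewrite !scaler0 addr0 -[t *: T.1]/(t * T.1) mulrC.
- have T0 : T.2 != 0 by apply: contraNneq D0 => ->; rewrite mul0r oppr0.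
  rewrite muleC (@integral_if [set t : mR | B (a.2 + T.2 * t)] ((`|s|^-1)%:E * leb A)%E).
  + rewrite [RHS]muleC [LHS]muleC; apply: rect_measure (lebesgue_measure_affine a.2 T0 mB) => //;
    by rewrite normrM.
  + exact: measurable_affine.
  + move=> t At; rewrite -(inner _ (a.1 + t * T.1))//; congr (leb _).
    apply/seteqP; split => e; rewrite /xsection/= inE/=.
      by rewrite /par/= /GRing.scale/= mulr1 => -[+ _]; rewrite (mulrC e).
    move=> Be; rewrite /par; split => /=; rewrite /GRing.scale/= ?mulr0 ?addr0 ?mulr1.
      by rewrite (mulrC e).
    by rewrite mulrC.
  + move=> t At; rewrite (_ : xsection _ _ = set0) ?measure0//.
    apply/seteqP; split => // e; rewrite /xsection/= inE/= => -[/= _].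
    by rewrite !scaler0 addr0 -[t *: T.2]/(t * T.2) mulrC.
Qed.

End Parallelogram.

Section ImageMeasure.
Context d1 d2 (X : measurableType d1) (Y : measurableType d2) (R : realType).
Variables (phi : X -> Y) (mphi : measurable_fun setT phi).
Variables (m : {measure set X -> \bar R}) (m' : {measure set Y -> \bar R}).
Variable c : {nonneg R}.
Hypothesis m'E : forall A, measurable A -> m' A = (c%:num%:E * m (phi @^-1` A))%E.

(** The hypothesis makes m' the image measure of m scaled by c. *)
Lemma ge0_integral_image (D : set Y) (F : Y -> \bar R) :
  measurable D -> measurable_fun setT F -> (forall x, 0 <= F x)%E ->
  (\int[m']_(x in D) F x = c%:num%:E * \int[m]_(q in phi @^-1` D) F (phi q))%E.
Proof.
move=> mD mF F0.
pose mu : {measure set Y -> \bar R} :=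
  measure_function_pushforward__canonical__measure_function_Measure m mphi.
rewrite (eq_measure_integral (mscale c mu)); last by move=> A mA _; rewrite m'E.
rewrite ge0_integral_mscale//=; last exact: measurable_funS mF.
congr (_ * _)%E; rewrite ge0_integral_pushforward//.
exact: measurable_funS mF.
Qed.

End ImageMeasure.

Section ParallelogramIntegral.
Context {R : realType}.
Local Notation mR := (measurableTypeR R).
Local Notation plane := (mR * mR)%type.
Local Notation leb := (@lebesgue_measure R).
Local Notation area := (@area R).

Section FixedFrame.
Variables (a T : R * R) (i : bool) (s : R).
(* Along a coordinate axis, the transverse derivative is a single partial
   derivative. *)
Let N := s *: @axis R i.
Hypothesis D0 : det2 T N != 0.

Lemma ge0_integral_par (D : set plane) (F : plane -> \bar R) :
  measurable D -> measurable_fun setT F -> (forall x, 0 <= F x)%E ->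
  (\int[area]_(x in D) F x =
   `|det2 T N|%:E * \int[area]_(q in par a T N @^-1` D) F (par a T N q))%E.
Proof.
move=> mD mF F0.
have D1 : 0 <= `|det2 T N| by [].
apply: (@ge0_integral_image _ _ plane plane _ _ (@measurable_par R a T N) area area (NngNum D1))
  => //.
by move=> A mA; rewrite (area_par a D0).
Qed.

Lemma integral_par (D : set plane) (F : plane -> \bar R) :
  measurable D -> measurable_fun setT F ->
  area.-integrable (par a T N @^-1` D) (F \o par a T N) ->
  (\int[area]_(x in D) F x =
   `|det2 T N|%:E * \int[area]_(q in par a T N @^-1` D) F (par a T N q))%E.
Proof.
move=> mD mF iF.
have mD' : measurable (par a T N @^-1` D : set plane).
  by rewrite -[X in measurable X]setTI; exact: measurable_par.
rewrite integralE [in RHS]integralE muleBr//; last first.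
  apply: fin_num_adde_defr; apply: integrable_fin_num => //.
  exact: integrable_funepos.
have mp := measurable_funepos mF; have mn := measurable_funeneg mF.
rewrite (ge0_integral_par mD mp); last by move=> x; exact: funepos_ge0.
rewrite (ge0_integral_par mD mn); last by move=> x; exact: funeneg_ge0.
have -> : (fun q => F (par a T N q))^\+%E = F^\+%E \o par a T N by exact: funepos_comp.
by have -> : (fun q => F (par a T N q))^\-%E = F^\-%E \o par a T N by exact: funeneg_comp.
Qed.

Lemma integrable_par (D : set plane) (F : plane -> \bar R) :
  measurable D -> measurable_fun setT F ->
  area.-integrable (par a T N @^-1` D) (F \o par a T N) -> area.-integrable D F.
Proof.
move=> mD mF /integrableP[_ iF]; apply/integrableP; split; first exact: measurable_funS mF.
rewrite ge0_integral_par//; last exact: measurableT_comp.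
by rewrite lte_mul_pinfty.
Qed.

(** [ptau] and [peta] are the coordinates inverse to [par], by Cramer's rule. *)
Definition ptau (x : R * R) : R := det2 (x - a) N / det2 T N.
Definition peta (x : R * R) : R := det2 T (x - a) / det2 T N.

Lemma ptau_par q : ptau (par a T N q) = q.1.
Proof.
rewrite /ptau; apply: (canLR (mulfK D0)); rewrite /par /det2 -[_ *: T]/(q.1 * T.1,
  q.1 * T.2) -[_ *: N]/(q.2 * N.1, q.2 * N.2)/=; ring.
Qed.

Lemma peta_par q : peta (par a T N q) = q.2.
Proof.
rewrite /peta; apply: (canLR (mulfK D0)); rewrite /par /det2 -[_ *: T]/(q.1 * T.1,
  q.1 * T.2) -[_ *: N]/(q.2 * N.1, q.2 * N.2)/=; ring.
Qed.

Lemma par_pcoord x : par a T N (ptau x, peta x) = x.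
Proof.
have D0' := D0; rewrite /det2 in D0'.
rewrite /par /ptau /peta /det2/=; rewrite -/N -[_ *: T]/(_ * T.1, _ * T.2) -[_ *: N]/(_ * N.1,
  _ * N.2).
by rewrite [RHS]surjective_pairing; congr pair => /=; field; exact: D0'.
Qed.

(** The edge [peta = 0] is left out, so that a strip can lie in an open set that has the edge on its
    boundary. *)
Definition strip (al be ep : R) : set plane :=
  [set x | ptau x \in `[al, be] /\ peta x \in `]0, ep]].

Definition pbox (al be ep : R) : set plane := `[al, be]%classic `*` `]0, ep]%classic.

Lemma par_preimage_strip (al be ep : R) : par a T N @^-1` strip al be ep = pbox al be ep.
Proof. by apply/seteqP; split => q; rewrite /strip/= ptau_par peta_par. Qed.

Lemma measurable_pbox (al be ep : R) : measurable (pbox al be ep).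
Proof. by apply: measurableX; exact: measurable_itv. Qed.

Lemma continuous_ptau : continuous ptau.
Proof.
move=> x; rewrite /ptau /det2; apply: cvgMl; apply: cvgB; apply: cvgMl => /=.
  by apply: cvgB; [exact: cvg_fst|exact: cvg_cst].
by apply: cvgB; [exact: cvg_snd|exact: cvg_cst].
Qed.

Lemma continuous_peta : continuous peta.
Proof.
move=> x; rewrite /peta /det2; apply: cvgMl; apply: cvgB; apply: cvgMr => /=.
  by apply: cvgB; [exact: cvg_snd|exact: cvg_cst].
by apply: cvgB; [exact: cvg_fst|exact: cvg_cst].
Qed.

Lemma measurable_strip (al be ep : R) : measurable (strip al be ep).
Proof.
rewrite (_ : strip al be ep = (ptau @^-1` `[al, be]%classic) `&` (peta @^-1` `]0, ep]%classic))//.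
apply: measurableI; rewrite -[X in measurable X]setTI.
  by apply: (continuous_measurable_plane continuous_ptau) => //; exact: measurable_itv.
by apply: (continuous_measurable_plane continuous_peta) => //; exact: measurable_itv.
Qed.

Lemma area_pbox (al be ep : R) : al <= be -> 0 <= ep ->
  area (pbox al be ep) = ((be - al) * ep)%:E.
Proof.
move=> ab e0; have -> : area (pbox al be ep) = (leb `[al, be]%classic * leb `]0%R, ep]%classic)%E.
  by apply: product_measure1E; exact: measurable_itv.
rewrite !lebesgue_measure_itv/= !lte_fin EFinM; congr (_ * _)%E.
  case: ltP => // ba.
  by rewrite (_ : be = al) ?subrr//; apply/le_anti; rewrite ba ab.
case: ltP => [_|ba]; first by rewrite oppr0 adde0.
by rewrite (_ : ep = 0)//; apply/le_anti; rewrite ba e0.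
Qed.

Lemma area_strip (al be ep : R) : al <= be -> 0 <= ep ->
  area (strip al be ep) = (`|det2 T N| * ((be - al) * ep))%:E.
Proof.
move=> ab e0; rewrite (area_par a D0); last exact: measurable_strip.
by rewrite par_preimage_strip area_pbox// EFinM.
Qed.

Lemma continuous_integrable_pbox (g : R * R -> R) (al be ep : R) :
  continuous g -> al <= be -> 0 <= ep -> area.-integrable (pbox al be ep) (EFin \o g).
Proof.
move=> cg ab e0; apply: measurable_bounded_integrable.
- exact: measurable_pbox.
- by rewrite area_pbox// ltry.
- apply: measurable_funS (continuous_measurable_plane cg) => //.
- have cK : compact (`[al, be]%classic `*` `[0, ep]%classic : set (R * R)).
    by apply: compact_setX; exact: segment_compact.
  have /compact_bounded := continuous_compact (continuous_subspaceT cg) cK.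
  move=> [M [Mr hM]]; exists M; split => // K MK q [q1 q2].
  apply: (hM K MK); exists q => //; split => //.
  by move: q2 => /=; rewrite !in_itv/= => /andP[/ltW -> ->].
Qed.

Lemma continuous_integrable_strip (f : R * R -> R) (al be ep : R) :
  continuous f -> al <= be -> 0 <= ep -> area.-integrable (strip al be ep) (EFin \o f).
Proof.
move=> cf ab e0; apply: integrable_par.
- exact: measurable_strip.
- by apply/measurable_EFinP; exact: continuous_measurable_plane.
- rewrite par_preimage_strip; apply: (@continuous_integrable_pbox (f \o par a T N)) => //.
  by move=> x; apply: continuous_comp; [exact: continuous_par|exact: cf].
Qed.

(** Change of variables and Fubini. The inner interval is closed up at 0, a null set, in view of the
    fundamental theorem of calculus. *)
Lemma Rintegral_strip (f : R * R -> R) (al be ep : R) :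
  continuous f -> al <= be -> 0 <= ep ->
  \int[area]_(x in strip al be ep) f x =
  `|det2 T N| * \int[leb]_(t in `[al, be]) \int[leb]_(e in `[0, ep]) f (par a T N (t, e)).
Proof.
move=> cf ab e0.
have cg : continuous (f \o par a T N).
  by move=> x; apply: continuous_comp; [exact: continuous_par|exact: cf].
have ig := continuous_integrable_pbox cg ab e0.
have cgt t : continuous (fun e : R => f (par a T N (t, e))).
  move=> e; apply: (@continuous_comp _ _ _ (fun e : R => a + t *: T + e *: N) f); last exact: cf.
  by apply: cvgD; [exact: cvg_cst|apply: cvgZl; exact: cvg_id].
have igt t : leb.-integrable `[0, ep] (EFin \o (fun e => f (par a T N (t, e)))).
  by apply: continuous_compact_integrable; [exact: segment_compact|exact: continuous_subspaceT].
rewrite /Rintegral (integral_par (F := EFin \o f)); last 3 first.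
- exact: measurable_strip.
- by apply/measurable_EFinP; exact: continuous_measurable_plane.
- by rewrite par_preimage_strip; exact: ig.
rewrite fineM//; last first.
  rewrite par_preimage_strip; apply: integrable_fin_num; first exact: measurable_pbox.
  exact: ig.
congr (_ * fine _).
rewrite par_preimage_strip [LHS]integral_mkcond.
have Fub := @integral12_prod_meas1 _ _ mR mR R leb leb ((EFin \o (f \o par a T N)) \_ (pbox al be
  ep)).
rewrite -[LHS]Fub; last first.
  by rewrite -(integrable_mkcond (D := pbox al be ep))//; exact: measurable_pbox.
rewrite [RHS]integral_mkcond; apply: eq_integral => t _.
rewrite /fubini_F patchE; case: ifPn => [|] tab; last first.
  rewrite integral0_eq// => e _; rewrite patchE ifF//.
  apply/negbTE; move: tab; apply: contra; rewrite !inE => -[]//.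
rewrite fineK; last by apply: integrable_fin_num (igt t); exact: measurable_itv.
rewrite -integral_itv_obnd_cbnd; last first.
  by apply: measurable_funS (measurable_int _ (igt t)); rewrite ?measurable_itv//;
    exact: subset_itv_oc_cc.
rewrite [RHS]integral_mkcond; apply: eq_integral => e _.
rewrite !patchE; congr (if _ then _ else _).
by apply/idP/idP; rewrite !inE => //; rewrite !inE in tab; [case|split].
Qed.

End FixedFrame.
End ParallelogramIntegral.

(** * Square-integrable functions *)

Section SquareIntegrable.
Context d (T : measurableType d) (R : realType) (m : {measure set T -> \bar R}).
Implicit Types (A : set T) (f h : T -> R).

(* AM-GM in place of the Cauchy-Schwarz inequality: |f| <= lam f^2 + 1 / lam. *)
Lemma integral_mul_sqr_le A f h (lam M B a : R) :
  measurable A -> (m A <= a%:E)%E -> measurable_fun A f -> measurable_fun A h ->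
  (\int[m]_(x in A) ((f x) ^+ 2)%:E <= B%:E)%E ->
  0 <= M -> (forall x, A x -> `|h x| <= M) -> 0 < lam ->
  (\int[m]_(x in A) `|(f x * h x)%:E| <= (M * (lam * B + a / lam))%:E)%E.
Proof.
move=> mA ma mf mh fB M0 hM lam0.
have mf2 : measurable_fun A (fun x => ((f x) ^+ 2)%:E).
  by apply/measurable_EFinP; exact: measurable_funX.
have h1 : (\int[m]_(x in A) `|(f x * h x)%:E| <=
           \int[m]_(x in A) ((M * lam)%:E * ((f x) ^+ 2)%:E + (M / lam)%:E))%E.
  apply: ge0_le_integral => //.
  - by apply: measurableT_comp => //; apply/measurable_EFinP; exact: measurable_funM.
  - by apply: emeasurable_funD => //; exact: emeasurable_funM.
  - move=> x Ax; rewrite abse_EFin -EFinM -EFinD lee_fin normrM.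
    apply: (@le_trans _ _ (`|f x| * M)); first by rewrite ler_wpM2l// hM.
    rewrite -(real_normK (num_real (f x))).
    have : 0 <= (lam * `|f x| - 1) ^+ 2 / lam.
      by rewrite divr_ge0 ?sqr_ge0// ltW.
    have -> : (lam * `|f x| - 1) ^+ 2 / lam = lam * `|f x| ^+ 2 - `|f x| *+ 2 + lam^-1.
      by field; rewrite gt_eqF.
    move=> k; have := normr_ge0 (f x); have : 0 < lam^-1 by rewrite invr_gt0.
    by nra.
apply: (le_trans h1).
rewrite ge0_integralD//; last 3 first.
- by move=> x _; rewrite -EFinM lee_fin mulr_ge0 ?sqr_ge0// mulr_ge0// ltW.
- exact: emeasurable_funM.
- by move=> x _; rewrite lee_fin divr_ge0// ltW.
rewrite ge0_integralZl//; last 2 first.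
- by move=> x _; rewrite lee_fin sqr_ge0.
- by rewrite lee_fin mulr_ge0// ltW.
rewrite integral_cst// mulrDr EFinD; apply: leeD.
  have -> : (M * (lam * B))%:E = ((M * lam)%:E * B%:E)%E by rewrite -EFinM mulrA.
  by apply: lee_wpmul2l => //; rewrite lee_fin mulr_ge0// ltW.
have -> : (M * (a / lam))%:E = ((M / lam)%:E * a%:E)%E.
  by rewrite -EFinM mulrAC mulrA.
by apply: lee_wpmul2l => //; rewrite lee_fin divr_ge0// ltW.
Qed.

Lemma integrable_mul_sqr A f h (M B a : R) :
  measurable A -> (m A <= a%:E)%E -> measurable_fun A f -> measurable_fun A h ->
  (\int[m]_(x in A) ((f x) ^+ 2)%:E <= B%:E)%E ->
  0 <= M -> (forall x, A x -> `|h x| <= M) ->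
  m.-integrable A (EFin \o (fun x => f x * h x)).
Proof.
move=> mA ma mf mh fB M0 hM; apply/integrableP; split.
  by apply/measurable_EFinP; exact: measurable_funM.
apply: le_lt_trans (integral_mul_sqr_le mA ma mf mh fB M0 hM ltr01) _.
exact: ltry.
Qed.

Lemma Rintegral_mul_sqr_le A f h (lam M B a : R) :
  measurable A -> (m A <= a%:E)%E -> measurable_fun A f -> measurable_fun A h ->
  (\int[m]_(x in A) ((f x) ^+ 2)%:E <= B%:E)%E ->
  0 <= M -> (forall x, A x -> `|h x| <= M) -> 0 < lam ->
  `|\int[m]_(x in A) (f x * h x)| <= M * (lam * B + a / lam).
Proof.
move=> mA ma mf mh fB M0 hM lam0; rewrite -lee_fin EFin_normr_Rintegral//; last first.
  exact: integrable_mul_sqr mA ma mf mh fB M0 hM.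
apply: le_trans (integral_mul_sqr_le mA ma mf mh fB M0 hM lam0).
apply: le_abse_integral => //; apply/measurable_EFinP; exact: measurable_funM.
Qed.

End SquareIntegrable.

Section L2Convergence.
Context d (T : measurableType d) (R : realType) (m : {measure set T -> \bar R}).
Implicit Types (A P : set T) (f h : T -> R).

Lemma integrable_scale A f (r : R) : measurable A ->
  m.-integrable A (EFin \o f) -> m.-integrable A (EFin \o (fun x => r * f x)).
Proof. by move=> mA fi; exact: (integrableZl mA r fi). Qed.

Lemma L2_sqr_le A f : L2 m A f -> measurable A ->
  exists2 B : R, 0 <= B & forall P, measurable P -> P `<=` A ->
    (\int[m]_(x in P) ((f x) ^+ 2)%:E <= B%:E)%E.
Proof.
move=> [mf foo] mA.
have f0 : (0 <= \int[m]_(x in A) ((f x) ^+ 2)%:E)%E.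
  by apply: integral_ge0 => x _; rewrite lee_fin sqr_ge0.
exists (fine (\int[m]_(x in A) ((f x) ^+ 2)%:E)); first exact: fine_ge0.
move=> P mP PA; rewrite fineK ?ge0_fin_numE//; apply: ge0_subset_integral => //.
  by apply/measurable_EFinP; exact: measurable_funX.
by move=> x _; rewrite lee_fin sqr_ge0.
Qed.

Lemma L2dist2_sqr_near A (f_ : nat -> T -> R) f (e : R) :
  measurable A -> (forall k, measurable_fun A (f_ k)) -> measurable_fun A f ->
  (fun k => L2dist2 m A (f_ k) f) @ \oo --> 0%E -> 0 < e ->
  \forall k \near \oo, forall P, measurable P -> P `<=` A ->
    (\int[m]_(x in P) ((f_ k x - f x) ^+ 2)%:E <= e%:E)%E.
Proof.
move=> mA mf_ mf cv e0.
have : nbhs (0%E : \bar R) [set x : \bar R | (x < e%:E)%E] by exact: (lt_nbhsl e0).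
move=> lt_e.
have cve : \forall k \near \oo, (L2dist2 m A (f_ k) f < e%:E)%E := cv _ lt_e.
apply: filterS cve => k ke P mP PA.
apply: (le_trans _ (ltW ke)); apply: ge0_subset_integral => //.
  by apply/measurable_EFinP; apply: measurable_funX; exact: measurable_funB.
by move=> x _; rewrite lee_fin sqr_ge0.
Qed.

(** L^2 convergence tested against a bounded function on a set of finite measure. *)
Lemma L2dist2_cvg_Rintegral A P (f_ : nat -> T -> R) f h (M a e : R) :
  measurable A -> measurable P -> P `<=` A -> (m P <= a%:E)%E ->
  (forall k, measurable_fun A (f_ k)) -> L2 m A f ->
  (fun k => L2dist2 m A (f_ k) f) @ \oo --> 0%E ->
  measurable_fun P h -> 0 <= M -> (forall x, P x -> `|h x| <= M) -> 0 < e ->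
  \forall k \near \oo,
    `|\int[m]_(x in P) (f_ k x * h x) - \int[m]_(x in P) (f x * h x)| <= e.
Proof.
move=> mA mP PA ma mf_ fL cv mh M0 hM e0.
have [mf _] := fL.
have [B B0 fB] := L2_sqr_le fL mA.
have mPf : measurable_fun P f by exact: measurable_funS mf.
have ma0 : 0 <= a by rewrite -lee_fin (le_trans _ ma).
(* With these [lam] and [c], the two terms [lam * c] and [a / lam] of the AM-GM bound are both at
   most [e / (2 * (M + 1))]. The added units avoid division by 0. *)
pose lam := (a + 1) * (M + 1) * 2 / e.
have lam0 : 0 < lam by rewrite divr_gt0// !mulr_gt0//; lra.
pose c := e / (2 * (M + 1) * lam).
have M1 : 0 < M + 1 by lra.
have c0 : 0 < c by rewrite divr_gt0// mulr_gt0// mulr_gt0.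
have := L2dist2_sqr_near mA mf_ mf cv c0; apply: filterS => k /(_ P mP PA) kc.
have mfk : measurable_fun P (fun x => f_ k x - f x).
  by apply: measurable_funB => //; apply: measurable_funS (mf_ k).
have i1 := integrable_mul_sqr mP ma mfk mh kc M0 hM.
have i2 := integrable_mul_sqr mP ma mPf mh (fB P mP PA) M0 hM.
have E (x : T) : f_ k x * h x = (f_ k x - f x) * h x + f x * h x by ring.
under eq_Rintegral do rewrite E.
rewrite RintegralD// addrK.
apply: le_trans (Rintegral_mul_sqr_le mP ma mfk mh kc M0 hM lam0) _.
have -> : lam * c = e / (2 * (M + 1)).
  by rewrite /c; field; rewrite !gt_eqF//; lra.
have -> : a / lam = (a / (a + 1)) * (e / (2 * (M + 1))).
  by rewrite /lam; field; rewrite !gt_eqF//; lra.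
have a1 : a / (a + 1) <= 1 by rewrite ler_pdivrMr; lra.
apply: (@le_trans _ _ (M * (2 * (e / (2 * (M + 1)))))).
  have q0 : 0 <= e / (2 * (M + 1)) by rewrite divr_ge0//; lra.
  by apply: ler_wpM2l => //; nra.
have -> : M * (2 * (e / (2 * (M + 1)))) = e * (M / (M + 1)).
  by field; rewrite gt_eqF//; lra.
by rewrite ler_piMr ?(ltW e0)// ler_pdivrMr; lra.
Qed.

End L2Convergence.

Lemma Rintegral_subset0 d (T : measurableType d) (R : realType)
    (m : {measure set T -> \bar R}) (A P : set T) (f : T -> R) :
  P `<=` A -> (forall x, A x -> ~ P x -> f x = 0) ->
  \int[m]_(x in A) f x = \int[m]_(x in P) f x.
Proof.
move=> PA f0; rewrite Rintegral_mkcond [RHS]Rintegral_mkcond; congr Rintegral.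
apply/funext => x; rewrite !patchE; have [Px|Px] := boolP (x \in P).
  by rewrite ifT// inE; apply: PA; rewrite -inE.
by case: ifPn => //; rewrite inE => Ax; apply: f0 => //; rewrite -notin_setE.
Qed.

(** * Traces as limits of integrals over strips *)

Section StripTest.
Context {R : realType}.
Local Notation mR := (measurableTypeR R).
Local Notation plane := (mR * mR)%type.
Local Notation area := (@area R).
Variables (a T : R * R) (i : bool) (s : R).
Let N := s *: @axis R i.
Hypothesis D0 : det2 T N != 0.
Local Notation ptau := (ptau a T i s).
Local Notation peta := (peta a T i s).
Local Notation strip := (strip a T i s).

(** The affine form demanded by [smooth2_comp]. *)
Lemma ptauE x : ptau x = (a.2 * N.1 - a.1 * N.2) / det2 T N
  + N.2 / det2 T N * x.1 + (- N.1 / det2 T N) * x.2.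
Proof. by rewrite /StripTest.ptau /det2/= -/N; field; exact: D0. Qed.

Lemma petaE x : peta x = (T.2 * a.1 - T.1 * a.2) / det2 T N
  + (- T.2 / det2 T N) * x.1 + T.1 / det2 T N * x.2.
Proof. by rewrite /StripTest.peta /det2/= -/N; field; exact: D0. Qed.

Lemma continuous_bounded_strip (f : R * R -> R) (al be ep : R) :
  continuous f -> exists2 M : R, 0 <= M & forall x, strip al be ep x -> `|f x| <= M.
Proof.
move=> cf.
have cg : continuous (f \o par a T N).
  by move=> x; apply: continuous_comp; [exact: continuous_par|exact: cf].
have cK : compact (`[al, be]%classic `*` `[0, ep]%classic : set (R * R)).
  by apply: compact_setX; exact: segment_compact.
have /compact_bounded := continuous_compact (continuous_subspaceT cg) cK.
move=> [M [Mr hM]]; exists (`|M| + 1) => [|x [x1 x2]]; first by rewrite addr_ge0.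
apply: (hM (`|M| + 1)); first by rewrite (le_lt_trans (ler_norm M))// ltrDl.
exists (ptau x, peta x); last by rewrite /= par_pcoord.
split => //=; move: x2; rewrite !in_itv/= => /andP[/ltW -> ->]//.
Qed.

Section Test.
Variables (chi om chi' : R -> R).
Hypotheses (schi : smooth1 chi) (som : smooth1 om).
Hypothesis dchi : forall y : R, is_derive y 1 chi (chi' y).
Definition strip_test (x : R * R) : R := chi (ptau x) * om (peta x).

Lemma smooth2_strip_test : smooth2 strip_test.
Proof.
apply: (@smooth2_mul _ (fun x => chi (ptau x)) (fun x => om (peta x))).
  by under eq_fun do rewrite ptauE; exact: smooth2_comp.
by under eq_fun do rewrite petaE; exact: smooth2_comp.
Qed.

(** In the direction T the coordinate [peta] is constant and [ptau] has slope 1, so the derivative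
    of [om] drops out. *)
Lemma strip_test_tangential x :
  T.1 * partial false strip_test x + T.2 * partial true strip_test x =
  chi' (ptau x) * om (peta x).
Proof.
have [om' som' dom] := smooth1_derive som.
have d j : partial j strip_test x =
    chi (ptau x) * (om' (peta x) * (- T.2 / det2 T N * (@axis R j).1 + T.1 / det2 T N * (@axis R
      j).2))
    + om (peta x) * (chi' (ptau x) * (N.2 / det2 T N * (@axis R j).1 + (- N.1 / det2 T N) *
      (@axis R j).2)).
  have d1 : is_derive x (axis j) (fun x => chi (ptau x))
      (chi' (ptau x) * (N.2 / det2 T N * (@axis R j).1 + (- N.1 / det2 T N) * (@axis R j).2)).
    by rewrite ptauE; under eq_fun do rewrite ptauE; exact: is_derive_affine_comp.
  have d2 : is_derive x (axis j) (fun x => om (peta x))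
      (om' (peta x) * (- T.2 / det2 T N * (@axis R j).1 + T.1 / det2 T N * (@axis R j).2)).
    by rewrite petaE; under eq_fun do rewrite petaE; exact: is_derive_affine_comp.
  by have [_ <-] := is_deriveM d1 d2.
have D0' : T.1 * N.2 - T.2 * N.1 != 0 := D0.
rewrite !d /det2; move: D0'; move: (N.1) (N.2) => n1 n2 /= D0'.
by field; exact: D0'.
Qed.

Variables (al be e1 ep : R).
Hypotheses (e10 : 0 < e1).
Hypothesis chi0 : forall y, y \notin `[al, be] -> chi y = 0.
Hypothesis om0 : forall y, y \notin `[e1, ep] -> om y = 0.

(** The compact set required by [test_function]: a closed parallelogram, which fits in the strip
    because [e1 > 0] keeps it off the edge. *)
Let K : set (R * R) := par a T N @` (`[al, be]%classic `*` `[e1, ep]%classic).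

Let compactK : compact K.
Proof.
apply: continuous_compact; first exact/continuous_subspaceT/continuous_par.
by apply: compact_setX; exact: segment_compact.
Qed.

Let Kstrip : K `<=` strip al be ep.
Proof.
move=> _ [q [q1 q2] <-]; split; rewrite ?ptau_par ?peta_par//.
by move: q2; rewrite /= !in_itv/= => /andP[e1q ->]; rewrite (lt_le_trans e10).
Qed.

Let test0 x : ~ K x -> strip_test x = 0.
Proof.
move=> Kx; rewrite /strip_test.
have [/chi0 ->|tx] := boolP (ptau x \notin `[al, be]); first by rewrite mul0r.
have [/om0 ->|ex] := boolP (peta x \notin `[e1, ep]); first by rewrite mulr0.
exfalso; apply: Kx; exists (ptau x, peta x); last by rewrite par_pcoord.
by rewrite negbK in tx; rewrite negbK in ex.
Qed.

Lemma strip_test_function (Om : set (R * R)) : strip al be ep `<=` Om ->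
  test_function Om strip_test.
Proof.
move=> PO; split; first exact/smooth2_smooth/smooth2_strip_test.
by exists K; split => //; exact: subset_trans PO.
Qed.

Lemma partial_strip_test0 j x : ~ strip al be ep x -> partial j strip_test x = 0.
Proof.
move=> Px.
have oK : open (~` K).
  apply: closed_openC; apply: compact_closed compactK.
  exact: (@norm_hausdorff R (R * R)%type).
suff : is_derive x (axis j) strip_test 0 by move=> h; rewrite /partial derive_val.
apply: (@near_eq_is_derive _ _ _ (cst 0)).
have : nbhs x (~` K) by apply: open_nbhs_nbhs; split => // /Kstrip.
by apply: filterS => y /test0 ->.
Qed.

Lemma strip_test0 x : ~ strip al be ep x -> strip_test x = 0.
Proof. by move=> Px; apply: test0 => /Kstrip. Qed.

End Test.

(** The two weak partial derivatives, tested with the same [strip_test], are combined with weights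
    T.1 and T.2 into integration by parts along T. The left-hand integrand involves only [chi'], by
    [strip_test_tangential]. *)
Lemma weak_strip (Om : set (R * R)) (v : R * R -> R) (G : R * R -> R * R)
    (chi om chi' : R -> R) (al be e1 ep : R) :
  open Om -> H1grad Om v G -> strip al be ep `<=` Om ->
  smooth1 chi -> smooth1 om -> (forall y : R, is_derive y 1 chi (chi' y)) ->
  0 < e1 -> al <= be -> 0 <= ep ->
  (forall y, y \notin `[al, be] -> chi y = 0) ->
  (forall y, y \notin `[e1, ep] -> om y = 0) ->
  \int[area]_(x in strip al be ep) (v x * (chi' (ptau x) * om (peta x))) =
  - \int[area]_(x in strip al be ep) (dot (G x) T * (chi (ptau x) * om (peta x))).
Proof.
move=> oO [vL vG] PO schi som dchi e10 ab ep0 chi0 om0.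
have mO := open_measurable_plane oO.
have mP : measurable (strip al be ep : set plane) := measurable_strip a T i s al be ep.
have sP : (area (strip al be ep) <= (`|det2 T N| * ((be - al) * ep))%:E)%E.
  by rewrite area_strip.
pose psi := strip_test chi om.
have s2 : smooth2 psi by exact: smooth2_strip_test.
have tf : test_function Om psi by exact: (strip_test_function schi som e10 chi0 om0 PO).
have cpsi := smooth2_continuous s2.
have [M M0 hM] := continuous_bounded_strip al be ep cpsi.
have cd j := smooth2_continuous (smooth2_partial j s2).
have mpsi : measurable_fun (strip al be ep : set plane) (psi : plane -> R).
  by apply: measurable_funS (continuous_measurable_plane cpsi).
have mdpsi j : measurable_fun (strip al be ep : set plane) (partial j psi : plane -> R).
  by apply: measurable_funS (continuous_measurable_plane (cd j)).
have iv j : area.-integrable (strip al be ep) (EFin \o (fun x => v x * partial j psi x)).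
  have [Md Md0 hMd] := continuous_bounded_strip al be ep (cd j).
  have [B B0 vB] := L2_sqr_le vL mO; have [mv _] := vL.
  by apply: (integrable_mul_sqr mP sP _ (mdpsi j) (vB _ mP PO) Md0 hMd); exact: measurable_funS mv.
have iG j : area.-integrable (strip al be ep) (EFin \o (fun x => pcoord j (G x) * psi x)).
  have [GL _] := vG j; have [mG _] := GL.
  have [B B0 GB] := L2_sqr_le GL mO.
  by apply: (integrable_mul_sqr mP sP _ mpsi (GB _ mP PO) M0 hM); exact: measurable_funS mG.
have w j : \int[area]_(x in strip al be ep) (v x * partial j psi x) =
           - \int[area]_(x in strip al be ep) (pcoord j (G x) * psi x).
  have [_ /(_ psi tf)] := vG j.
  rewrite !(Rintegral_subset0 _ PO)// => x _ Px.
    by rewrite /psi (strip_test0 e10 chi0 om0)// mulr0.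
  by rewrite /psi (partial_strip_test0 e10 chi0 om0)// mulr0.
have -> : \int[area]_(x in strip al be ep) (v x * (chi' (ptau x) * om (peta x))) =
    T.1 * \int[area]_(x in strip al be ep) (v x * partial false psi x) +
    T.2 * \int[area]_(x in strip al be ep) (v x * partial true psi x).
  rewrite -!RintegralZl// -RintegralD//; last 2 first.
  - exact: integrable_scale.
  - exact: integrable_scale.
  by apply: eq_Rintegral => x _; rewrite -strip_test_tangential//; ring.
have -> : \int[area]_(x in strip al be ep) (dot (G x) T * (chi (ptau x) * om (peta x))) =
    T.1 * \int[area]_(x in strip al be ep) (pcoord false (G x) * psi x) +
    T.2 * \int[area]_(x in strip al be ep) (pcoord true (G x) * psi x).
  rewrite -!RintegralZl// -RintegralD//; last 2 first.
  - exact: integrable_scale.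
  - exact: integrable_scale.
  by apply: eq_Rintegral => x _; rewrite /psi /strip_test /dot/=; ring.
by rewrite !w; ring.
Qed.

End StripTest.

(** * Smooth ramps and unit masses on the line *)

Section Ramp.
Context {R : realType}.
Local Notation leb := (@lebesgue_measure R).

Implicit Types c d x y : R.

Lemma continuous_integrable_itv (f : R -> R) (x y : R) : continuous f ->
  leb.-integrable `[x, y] (EFin \o f).
Proof.
move=> cf; apply: continuous_compact_integrable; first exact: segment_compact.
exact: continuous_subspaceT.
Qed.

Lemma is_derive_continuous (f f' : R -> R) :
  (forall y : R, is_derive y 1 f (f' y)) -> continuous f.
Proof.
move=> df y; apply: differentiable_continuous.
by apply/derivable1_diffP; have [] := df y.
Qed.

Lemma Rintegral_is_derive (f F : R -> R) (x y : R) : x <= y -> continuous f ->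
  (forall z : R, is_derive z 1 F (f z)) ->
  \int[leb]_(z in `[x, y]) f z = F y - F x.
Proof.
rewrite le_eqVlt => /predU1P[->|xy] cf dF.
  by rewrite subrr set_itv1 Rintegral_set1.
have cF := is_derive_continuous dF.
rewrite /Rintegral (@continuous_FTC2 _ f F)//.
- exact: continuous_subspaceT.
- split => [z _||]; first by have [] := dF z.
    by apply: cvg_at_right_filter; exact: cF.
  by apply: cvg_at_left_filter; exact: cF.
- by move=> z _; rewrite derive1E derive_val.
Qed.

(** Rises from 0 at c to 1 at c + d, so that [dramp c d] is a smooth unit mass on [c, c + d]. The
    argument is (y - c) / d, written in the form of [smooth1_affine]. *)
Definition ramp (c d y : R) : R := step (- c / d + d^-1 * y).
Definition dramp (c d y : R) : R := dstep (- c / d + d^-1 * y) * d^-1.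

Lemma is_derive_ramp c d y : is_derive y 1 (ramp c d) (dramp c d y).
Proof.
apply: (@is_derive1_comp _ step (fun y => - c / d + d^-1 * y)).
  exact: is_derive_step.
exact: is_derive_affine.
Qed.

Lemma smooth1_ramp c d : smooth1 (ramp c d).
Proof. exact/smooth1_affine/smooth1_step. Qed.

Lemma smooth1_dramp c d : smooth1 (dramp c d).
Proof.
apply: smooth1_mul; last exact: smooth1_cst.
exact/smooth1_affine/smooth1_dstep.
Qed.

Let rescale c d y : d != 0 -> - c / d + d^-1 * y = (y - c) / d.
Proof. by move=> d0; field. Qed.

Lemma ramp_le c d y : 0 < d -> y <= c -> ramp c d y = 0.
Proof.
move=> d0 yc; rewrite /ramp rescale ?gt_eqF// step_le0//.
by rewrite pmulr_lle0 ?invr_gt0// subr_le0.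
Qed.

Lemma ramp_ge c d y : 0 < d -> c + d <= y -> ramp c d y = 1.
Proof.
move=> d0 yc; rewrite /ramp rescale ?gt_eqF// step_ge1//.
by rewrite ler_pdivlMr// mul1r; lra.
Qed.

Lemma ramp_ge0 c d y : 0 <= ramp c d y. Proof. exact: step_ge0. Qed.
Lemma ramp_le1 c d y : ramp c d y <= 1. Proof. exact: step_le1. Qed.

Lemma dramp_ge0 c d y : 0 < d -> 0 <= dramp c d y.
Proof. by move=> d0; rewrite mulr_ge0 ?dstep_ge0// invr_ge0 ltW. Qed.

Lemma dramp_out c d y : 0 < d -> y \notin `]c, c + d[ -> dramp c d y = 0.
Proof.
move=> d0 yc; rewrite /dramp rescale ?gt_eqF// dstep_out ?mul0r//.
apply: contra yc; rewrite !in_itv/= ltr_pdivlMr// ltr_pdivrMr// => /andP[? ?].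
by apply/andP; split; lra.
Qed.

Lemma Rintegral_dramp c d x y : 0 < d -> x <= c -> c + d <= y ->
  \int[leb]_(z in `[x, y]) dramp c d z = 1.
Proof.
move=> d0 xc cy; have xy : x <= y by lra.
have cd := smooth1_continuous (smooth1_dramp c d).
rewrite (Rintegral_is_derive xy cd (is_derive_ramp c d)).
by rewrite ramp_ge// ramp_le// subr0.
Qed.

End Ramp.

Section StripTrace.
Context {R : realType}.
Local Notation mR := (measurableTypeR R).
Local Notation leb := (@lebesgue_measure R).
Local Notation area := (@area R).
Variables (a T : R * R) (i : bool) (s : R).
Let N := s *: @axis R i.
Hypothesis D0 : det2 T N != 0.
Local Notation ptau := (ptau a T i s).
Local Notation peta := (peta a T i s).
Local Notation strip := (strip a T i s).
(** A unit mass on [ep / 2, ep], hence at a positive distance from the edge as test functions must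
    be; [Omega ep] is its primitive. *)
Local Notation omega ep := (dramp (ep / 2) (ep / 2)).
Local Notation Omega ep := (ramp (ep / 2) (ep / 2)).

Lemma Rintegral_strip_dramp (c d al be ep : R) :
  0 < d -> al <= c -> c + d <= be -> 0 < ep ->
  \int[area]_(x in strip al be ep) (dramp c d (ptau x) * omega ep (peta x)) = `|det2 T N|.
Proof.
move=> d0 ac cb e0.
have ct : continuous (fun x => dramp c d (ptau x) * omega ep (peta x)).
  by apply: smooth2_continuous; apply: smooth2_strip_test => //; exact: smooth1_dramp.
rewrite Rintegral_strip//; [|lra|exact: ltW].
under eq_Rintegral => t _.
  under eq_Rintegral => e _ do rewrite ptau_par// peta_par//=.
  rewrite RintegralZl//; last first.
    by apply: continuous_integrable_itv; exact: smooth1_continuous (smooth1_dramp _ _).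
  rewrite Rintegral_dramp ?mulr1; [|lra..].
  over.
by rewrite Rintegral_dramp// mulr1.
Qed.

(* Integration by parts in the direction N against the cut-off 1 - Omega,
   which is 1 on the edge eta = 0 and 0 on the opposite one. *)
Lemma strip_trace_identity (phi : R * R -> R) (chi : R -> R) (al be ep : R) :
  smooth phi -> continuous chi -> al <= be -> 0 < ep ->
  \int[area]_(x in strip al be ep) (phi x * (chi (ptau x) * omega ep (peta x)))
  - \int[area]_(x in strip al be ep)
      (partial i phi x * (s * ((1 - Omega ep (peta x)) * chi (ptau x)))) =
  `|det2 T N| * \int[leb]_(t in `[al, be]) (phi (a + t *: T) * chi t).
Proof.
move=> sphi cchi ab e0.
have cphi : continuous phi by have [] := sphi [::].
have cdphi : continuous (partial i phi) by have [] := sphi [:: i].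
have dphi x : is_derive x (axis i) phi (partial i phi x).
  by have [_ /(_ i x)] := sphi [::]; exact: derivableP.
have com : continuous (omega ep) := smooth1_continuous (smooth1_dramp _ _).
have cOm : continuous (Omega ep) := smooth1_continuous (smooth1_ramp _ _).
have c1 : continuous (fun x => chi (ptau x)).
  by move=> x; apply: continuous_comp; [exact: continuous_ptau|exact: cchi].
have c2 : continuous (fun x => omega ep (peta x)).
  by move=> x; apply: continuous_comp; [exact: continuous_peta|exact: com].
have c3 : continuous (fun x => Omega ep (peta x)).
  by move=> x; apply: continuous_comp; [exact: continuous_peta|exact: cOm].
pose f1 x := phi x * (chi (ptau x) * omega ep (peta x)).
pose f2 x := partial i phi x * (s * ((1 - Omega ep (peta x)) * chi (ptau x))).
have cf1 : continuous f1.
  by move=> x; apply: cvgM; [exact: cphi|apply: cvgM; [exact: c1|exact: c2]].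
have cf2 : continuous f2.
  move=> x; apply: cvgM; [exact: cdphi|apply: cvgMr; apply: cvgM; last exact: c1].
  by apply: cvgB; [exact: cvg_cst|exact: c3].
rewrite -[X in X - _ = _]/(\int[area]_(x in strip al be ep) f1 x).
rewrite -[X in _ - X = _]/(\int[area]_(x in strip al be ep) f2 x).
have cf : continuous (fun x => f1 x - f2 x).
  by move=> x; apply: cvgB; [exact: cf1|exact: cf2].
rewrite -RintegralB; last 3 first.
- exact: measurable_strip.
- by apply: continuous_integrable_strip => //; exact: ltW.
- by apply: continuous_integrable_strip => //; exact: ltW.
rewrite Rintegral_strip//; last exact: ltW.
congr (_ * _); apply: eq_Rintegral => t _.
have dline (e : R) : is_derive e 1 (fun e => phi (par a T N (t,
  e))) (partial i phi (par a T N (t, e)) * s).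
  have := dphi (a + t *: T + (s * e) *: axis i) => /is_derive_line h.
  have := @is_derive1_comp _ _ (fun e => 0 + s * e) e _ s; rewrite add0r =>
    /(_ _ _ h)/(_ (is_derive_affine _ _ _)).
  rewrite -[X in partial i phi X](_ : par a T N (t, e) = _); last first.
    by rewrite /par /N /= scalerA mulrC.
  by move=> h'; apply: (is_derive_congr h') => // e'; rewrite /= /par /N scalerA add0r mulrC.
(* A primitive of the integrand in e that vanishes at [e = ep], where [Omega] is 1, and equals
   [- phi * chi] on the edge, where [Omega] is 0. *)
pose F e := phi (par a T N (t, e)) * (Omega ep e - 1) * chi t.
have cf12 : continuous (fun e : R => f1 (par a T N (t, e)) - f2 (par a T N (t, e))).
  move=> e; apply: (@continuous_comp _ _ _ (fun e : R => a + t *: T + e *: N) (fun x =>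
    f1 x - f2 x)); last exact: cf.
  by apply: cvgD; [exact: cvg_cst|apply: cvgZl; exact: cvg_id].
have dF (e : R) : is_derive e 1 F (f1 (par a T N (t, e)) - f2 (par a T N (t, e))).
  rewrite /f1 /f2 ptau_par// peta_par//=.
  have dO : is_derive e 1 (fun e => Omega ep e - 1) (omega ep e - 0).
    by apply: is_deriveB; exact: is_derive_ramp.
  have h := is_deriveM (is_deriveM (dline e) dO) (is_derive_cst (chi t) e (1 : R)).
  apply: (is_derive_congr h) => //.
  by rewrite /GRing.scale/= /cst; ring.
rewrite (Rintegral_is_derive (ltW e0) cf12 dF).
rewrite /F ramp_ge; [|lra|lra]; rewrite ramp_le; [|lra|lra].
by rewrite subrr mulr0 mul0r /par scale0r addr0; ring.
Qed.

End StripTrace.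

Lemma within_continuous_dist (R : realType) (V : normedModType R) (C : set V)
    (f : V -> R) (x : V) (e : R) :
  {within C, continuous f} -> C x -> 0 < e ->
  exists2 r : R, 0 < r & forall y, C y -> `|y - x| < r -> `|f y - f x| < e.
Proof.
move=> /subspace_continuousP cf Cx e0.
have /cvgrPdist_lt /(_ e e0) := cf x Cx.
rewrite near_withinE => /nbhs_ballP[r /= r0 h]; exists r => // y Cy yx.
rewrite distrC; apply: h => //.
by rewrite -ball_normE /= distrC.
Qed.

Lemma measurable_trace_set (R : realType) (Om : set (R * R)) (a T : R * R) :
  measurable ([set t : R | t \in `[0, 1] /\ closure Om (a + t *: T)]
              : set (measurableTypeR R)).
Proof.
rewrite (_ : [set t | _] = `[0, 1]%classic `&` (fun t : R => a + t *: T) @^-1` closure Om)//.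
apply: measurableI; first exact: measurable_itv.
apply: closed_measurable; apply: preimage_closed; last exact: closed_closure.
by move=> t _; apply: cvgD; [exact: cvg_cst|apply: cvgZl; exact: cvg_id].
Qed.

Section StripLimit.
Context {R : realType}.
Local Notation mR := (measurableTypeR R).
Local Notation plane := (mR * mR)%type.
Local Notation leb := (@lebesgue_measure R).
Local Notation area := (@area R).
Variables (a T : R * R) (i : bool) (s : R).
Let N := s *: @axis R i.
Hypothesis D0 : det2 T N != 0.
Local Notation ptau := (ptau a T i s).
Local Notation peta := (peta a T i s).
Local Notation strip := (strip a T i s).
Local Notation omega ep := (dramp (ep / 2) (ep / 2)).
Local Notation Omega ep := (ramp (ep / 2) (ep / 2)).
Variables (Om : set (R * R)) (al be e0 : R).
Hypotheses (oO : open Om) (al0 : 0 <= al) (ab : al <= be) (be1 : be <= 1).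
Hypothesis stripOm : forall ep, ep <= e0 -> strip al be ep `<=` Om.

(* As [ep] tends to 0, [omega ep (peta x)] becomes a unit mass on the edge. *)
Lemma strip_trace_limit (u g : R * R -> R) :
  trace Om (fun t => a + t *: T) u g ->
  (forall t, t \in `[al, be] -> closure Om (a + t *: T)) ->
  exists2 C : R, 0 <= C & forall (chi : R -> R) (ep lam : R),
    continuous chi -> (forall y, `|chi y| <= 1) -> 0 < ep -> ep <= e0 -> 0 < lam ->
    `|\int[area]_(x in strip al be ep) (u x * (chi (ptau x) * omega ep (peta x)))
      - `|det2 T N| * \int[leb]_(t in `[al, be]) (g (a + t *: T) * chi t)|
    <= C * lam + `|s| * (`|det2 T N| * (be - al) * ep) / lam.
Proof.
move=> [gL [U [uL wU] [phi [sphi cv0 cvd cvg]]]] clO.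
have mO := open_measurable_plane oO.
have [UL _] := wU i; have [mU _] := UL; have [mu _] := uL.
have [B B0 UB] := L2_sqr_le UL mO.
(* B bounds the integral of the square of the transverse weak derivative over all of [Om]. For k
   large the derivative of [phi k] is within 1 of it in squared L^2 distance, so its square has
   integral at most 2 (1 + B) on every strip, independently of [ep] and [lam]. *)
exists (`|s| * (2 * (1 + B))); first by rewrite mulr_ge0// mulr_ge0//; lra.
move=> chi ep lam cchi chi1 ep0 epe lam0.
have PO := stripOm epe.
set P := strip al be ep in PO *.
have mP : measurable (P : set plane) := measurable_strip a T i s al be ep.
have sP : (area P <= (`|det2 T N| * ((be - al) * ep))%:E)%E.
  by rewrite area_strip// ltW.
have cphi k : continuous (phi k) by have [] := sphi k [::].
have cdphi k : continuous (partial i (phi k)) by have [] := sphi k [:: i].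
have mphi k : measurable_fun (Om : set plane) (phi k : plane -> R).
  exact: measurable_funS (continuous_measurable_plane (cphi k)).
have mdphi k : measurable_fun (Om : set plane) (partial i (phi k) : plane -> R).
  exact: measurable_funS (continuous_measurable_plane (cdphi k)).
have com : continuous (omega ep) := smooth1_continuous (smooth1_dramp _ _).
have cOm : continuous (Omega ep) := smooth1_continuous (smooth1_ramp _ _).
have c1 : continuous (fun x => chi (ptau x)).
  by move=> x; apply: continuous_comp; [exact: continuous_ptau|exact: cchi].
have c2 : continuous (fun x => omega ep (peta x)).
  by move=> x; apply: continuous_comp; [exact: continuous_peta|exact: com].
have c3 : continuous (fun x => Omega ep (peta x)).
  by move=> x; apply: continuous_comp; [exact: continuous_peta|exact: cOm].
have ch : continuous (fun x => chi (ptau x) * omega ep (peta x)).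
  by move=> x; apply: cvgM; [exact: c1|exact: c2].
have ch2 : continuous (fun x => s * ((1 - Omega ep (peta x)) * chi (ptau x))).
  move=> x; apply: cvgMr; apply: cvgM; last exact: c1.
  by apply: cvgB; [exact: cvg_cst|exact: c3].
have [M M0 hM] := continuous_bounded_strip a D0 al be ep ch.
have mh : measurable_fun (P : set plane) (fun x : plane => chi (ptau x) * omega ep (peta x)).
  exact: measurable_funS (continuous_measurable_plane ch).
have mh2 : measurable_fun (P : set plane) (fun x : plane =>
  s * ((1 - Omega ep (peta x)) * chi (ptau x))).
  exact: measurable_funS (continuous_measurable_plane ch2).
set S := [set t : R | t \in `[0, 1] /\ closure Om (a + t *: T)] in gL cvg.
have mS : measurable (S : set mR) by exact: measurable_trace_set.
have abS : `[al, be]%classic `<=` S.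
  move=> t tab; split; last by apply: clO.
  by move: tab; rewrite /= !in_itv/= => /andP[/(le_trans al0) -> /le_trans/(_ be1) ->].
have cline k : continuous (fun t : R => phi k (a + t *: T)).
  move=> t; apply: (@continuous_comp _ _ _ (fun t : R => a + t *: T) (phi k)); last exact: cphi.
  by apply: cvgD; [exact: cvg_cst|apply: cvgZl; exact: cvg_id].
have mline k : measurable_fun (S : set mR) (phi k \o (fun t : R => a + t *: T) : mR -> R).
  apply: measurable_funS (continuous_measurable_fun (cline k)) => //.
have mchi : measurable_fun (`[al, be]%classic : set mR) (chi : mR -> R).
  exact: measurable_funS (continuous_measurable_fun cchi).
have sI : (leb `[al, be]%classic <= 1%:E)%E.
  rewrite lebesgue_measure_itv/= lte_fin; case: ifPn => _; last by rewrite lee_fin.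
  by rewrite -EFinB lee_fin lerBlDr (le_trans be1)// lerDl.
(* The slack [th] pays for replacing u and g by [phi k]. The index k may depend on [ep], as it does
   not occur in the final bound. *)
apply/ler_addgt0Pr => th th0.
pose th' := th / (1 + `|det2 T N|).
have n1 : 0 < 1 + `|det2 T N| by rewrite ltr_pwDl.
have th'0 : 0 < th' by rewrite divr_gt0.
have ev1 := L2dist2_cvg_Rintegral mO mP PO sP mphi uL cv0 mh M0 hM th'0.
have ev2 := L2dist2_cvg_Rintegral mS (measurable_itv `[al, be]) abS sI mline gL cvg mchi ler01
  (fun x _ => chi1 x) th'0.
have ev3 := L2dist2_sqr_near mO mdphi mU (cvd i) ltr01.
have [k [[/= k1 k2] k3]] := filter_ex (filterI (filterI ev1 ev2) ev3).
have {}k3 := k3 P mP PO.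
have dB : (\int[area]_(x in P) ((partial i (phi k) x) ^+ 2)%:E <= (2 * (1 + B))%:E)%E.
  have mU' : measurable_fun (P : set plane) (pcoord i \o U : plane ->
    R) by exact: measurable_funS mU.
  have md' : measurable_fun (P : set plane) (partial i (phi k) : plane ->
    R) by exact: measurable_funS (mdphi k).
  have mdU : measurable_fun (P : set plane) (fun x : plane =>
    (partial i (phi k) x - (pcoord i \o U) x)) by exact: measurable_funB.
  apply: (@le_trans _ _ (\int[area]_(x in P)
     (2%:E * (((partial i (phi k) x - (pcoord i \o U) x) ^+ 2)%:E + (((pcoord i \o U) x) ^+
       2)%:E)))%E).
    apply: ge0_le_integral => //.
    - by move=> x _; rewrite lee_fin sqr_ge0.
    - by apply/measurable_EFinP; exact: measurable_funX.
    - apply: emeasurable_funM => //; apply: emeasurable_funD; apply/measurable_EFinP;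
      exact: measurable_funX.
    - move=> x _; rewrite -EFinD -EFinM lee_fin.
      set p := partial _ _ _; set q := (_ \o _) _.
      (* 2 (p - q)^2 + 2 q^2 - p^2 is exactly this square. *)
      by have := sqr_ge0 (p - 2 * q); nra.
  rewrite ge0_integralZl//; last 2 first.
  - apply: emeasurable_funD; apply/measurable_EFinP; exact: measurable_funX.
  - by move=> x _; rewrite -EFinD lee_fin addr_ge0// sqr_ge0.
  rewrite ge0_integralD//; last 4 first.
  - by move=> x _; rewrite lee_fin sqr_ge0.
  - by apply/measurable_EFinP; exact: measurable_funX.
  - by move=> x _; rewrite lee_fin sqr_ge0.
  - by apply/measurable_EFinP; exact: measurable_funX.
  rewrite EFinM lee_pmul2l// EFinD; apply: leeD; [exact: k3|exact: UB].
have md : measurable_fun (P : set plane) (partial i (phi k) : plane ->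
  R) by exact: measurable_funS (mdphi k).
have h2s x : P x -> `|s * ((1 - Omega ep (peta x)) * chi (ptau x))| <= `|s|.
  move=> _; rewrite normrM ler_piMr// normrM mulr_ile1//.
  have := ramp_ge0 (ep / 2) (ep / 2) (peta x); have := ramp_le1 (ep / 2) (ep / 2) (peta x).
  by move=> ? ?; rewrite ger0_norm; lra.
have Zb := Rintegral_mul_sqr_le mP sP md mh2 dB (normr_ge0 s) h2s lam0.
have ID := strip_trace_identity a D0 (sphi k) cchi ab ep0.
move: k1 k2 Zb ID.
rewrite -/P /=.
set X := \int[area]_(x in P) (u x * _).
set Xk := \int[area]_(x in P) (phi k x * _).
set Y := \int[leb]_(t in `[al, be]) (g _ * _).
set Yk := \int[leb]_(t in `[al, be]) (phi k _ * _).
set Z := \int[area]_(x in P) (partial i (phi k) x * _).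
move=> k1 k2 Zb ID.
have -> : X - `|det2 T N| * Y = (X - Xk) + Z + `|det2 T N| * (Yk - Y).
  by rewrite mulrBr -ID; ring.
have E : `|s| * (2 * (1 + B)) * lam + `|s| * (`|det2 T N| * (be - al) * ep) / lam + th =
    th' + `|s| * (lam * (2 * (1 + B)) + `|det2 T N| * ((be - al) * ep) / lam) + `|det2 T N| * th'.
  by rewrite /th'; field; rewrite !gt_eqF.
rewrite E; apply: (le_trans (ler_normD _ _)); apply: lerD; last first.
  by rewrite normrM normr_id ler_wpM2l.
by apply: (le_trans (ler_normD _ _)); apply: lerD => //; rewrite distrC.
Qed.

(** The weight is nonnegative of total mass [|det2 T N|] and vanishes off the small parallelogram
    over [c, c + d], on which v is almost everywhere within [th] of k. *)
Lemma strip_point_approx (v vb : R * R -> R) (k th c d ep : R) :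
  L2 area Om v -> {ae area, forall x, Om x -> v x = vb x} ->
  0 < d -> al <= c -> c + d <= be -> 0 < ep -> ep <= e0 -> 0 <= th ->
  (forall x, strip c (c + d) ep x -> `|vb x - k| <= th) ->
  `|\int[area]_(x in strip al be ep) (v x * (dramp c d (ptau x) * omega ep (peta x)))
    - k * `|det2 T N| | <= th * `|det2 T N|.
Proof.
move=> vL vae d0 ac cb ep0 epe th0 vk.
have mO := open_measurable_plane oO; have PO := stripOm epe.
set P := strip al be ep in PO *.
have mP : measurable (P : set plane) := measurable_strip a T i s al be ep.
have sP : (area P <= (`|det2 T N| * ((be - al) * ep))%:E)%E.
  by rewrite area_strip// ltW.
pose w x := dramp c d (ptau x) * omega ep (peta x).
have cw : continuous w.
  by apply: smooth2_continuous; apply: smooth2_strip_test => //; exact: smooth1_dramp.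
have w0 x : 0 <= w x by rewrite mulr_ge0// dramp_ge0// divr_gt0.
have iw : area.-integrable P (EFin \o w).
  by apply: continuous_integrable_strip => //; exact: ltW.
have mw : measurable_fun (P : set plane) (w : plane -> R).
  exact: measurable_funS (continuous_measurable_plane cw).
have [M M0 hM] := continuous_bounded_strip a D0 al be ep cw.
have [B B0 vB] := L2_sqr_le vL mO; have [mv _] := vL.
have mvP : measurable_fun (P : set plane) (v : plane -> R) by exact: measurable_funS mv.
have ivw := integrable_mul_sqr mP sP mvP mw (vB P mP PO) M0 hM.
have Iw : \int[area]_(x in P) w x = `|det2 T N| by exact: Rintegral_strip_dramp.
rewrite -[X in _ - _ * X]Iw -[X in _ <= _ * X]Iw -!RintegralZl// -RintegralB//; last first.
  exact: integrable_scale.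
have iD : area.-integrable P (EFin \o (fun x => v x * w x - k * w x)).
  have := integrableB mP ivw (integrable_scale k mP iw).
  by apply: eq_integrable.
rewrite -lee_fin EFin_normr_Rintegral//.
rewrite [leRHS]fineK; last exact: integrable_fin_num (integrable_scale th mP iw).
apply: (le_trans (le_abse_integral _ _ _)) => //; first by case/integrableP: iD.
apply: ae_ge0_le_integral => //.
- by apply: measurableT_comp => //; case/integrableP: iD.
- by move=> x _; rewrite lee_fin mulr_ge0.
- by case/integrableP: (integrable_scale th mP iw).
case: vae => Z [mZ Z0 vZ]; exists Z; split => //; apply: subset_trans vZ => x.
apply: contra_not => vx Px; move: {vx}(vx : Om x -> v x = vb x) => vx.
rewrite /= lee_fin -mulrBl normrM (ger0_norm (w0 x)).
have [wx0|wx0] := eqVneq (w x) 0; first by rewrite wx0 !mulr0.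
rewrite ler_wpM2r// vx; last exact: PO.
apply: vk; case: Px => _ xe; split => //.
move: wx0; apply: contraNT => h; rewrite /w dramp_out ?mul0r//.
by apply: contra h; rewrite !in_itv/= => /andP[/ltW -> /ltW ->].
Qed.

End StripLimit.

(** * The fundamental theorem of calculus on an edge *)

Section StripFTC.
Context {R : realType}.
Local Notation mR := (measurableTypeR R).
Local Notation plane := (mR * mR)%type.
Local Notation leb := (@lebesgue_measure R).
Local Notation area := (@area R).

Lemma dotZr (x y : R * R) (k : R) : dot x (k *: y) = k * dot x y.
Proof. by rewrite /dot /=; rewrite -![k *: _]/(k * _); ring. Qed.

Lemma enorm_gt0 (x : R * R) : x != 0 -> 0 < enorm x.
Proof.
move=> x0; rewrite sqrtr_gt0 /dot -!expr2 lt0r addr_ge0 ?sqr_ge0// andbT.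
apply: contraNneq x0 => /eqP; rewrite paddr_eq0 ?sqr_ge0// !sqrf_eq0 => /andP[/eqP x1 /eqP x2].
by rewrite [x]surjective_pairing x1 x2.
Qed.

Lemma ramp_sub_le1 (c c' d y : R) : `|ramp c d y - ramp c' d y| <= 1.
Proof.
have := ramp_ge0 c d y; have := ramp_le1 c d y.
have := ramp_ge0 c' d y; have := ramp_le1 c' d y.
by rewrite ler_norml => ? ? ? ?; apply/andP; split; lra.
Qed.

(** The difference of ramps departs from the indicator of [t1, t2] by at most 1, and only on
    [t1, t1 + d] and [t2, t2 + d], of total length at most 2 d. As g is merely square integrable,
    the error is again estimated by AM-GM. *)
Lemma Rintegral_ramp_approx (g : R -> R) (al be t1 t2 d B lam : R) :
  measurable_fun (`[al, be]%classic : set mR) (g : mR -> R) ->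
  (forall P : set mR, measurable P -> P `<=` `[al, be]%classic ->
     (\int[leb]_(x in P) ((g x) ^+ 2)%:E <= B%:E)%E) ->
  al <= t1 -> t2 + d <= be -> 0 < d -> d <= t2 - t1 -> 0 < lam ->
  `|\int[leb]_(t in `[al, be]) (g t * (ramp t1 d t - ramp t2 d t))
    - \int[leb]_(t in `[t1, t2]) g t| <= lam * B + (2 * d) / lam.
Proof.
move=> mg gB at1 t2b d0 d12 lam0.
pose h t : R := ramp t1 d t - ramp t2 d t - \1_(`[t1, t2]%classic : set mR) t.
pose E := (`[t1, t1 + d]%classic `|` `[t2, t2 + d]%classic : set mR).
have mE : measurable E by apply: measurableU; exact: measurable_itv.
have sE : (leb E <= (2 * d)%:E)%E.
  have l (t : R) : leb `[t, t + d]%classic = d%:E.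
    by rewrite lebesgue_measure_itv/= lte_fin ltrDl d0 -EFinB addrAC subrr add0r.
  have -> : (2 * d)%:E = (leb `[t1, (t1 + d)%R]%classic + leb `[t2, (t2 + d)%R]%classic)%E.
    by rewrite !l -EFinD; congr EFin; ring.
  by apply: measureU2; exact: measurable_itv.
have EI : E `<=` `[al, be]%classic.
  by move=> x [] /=; rewrite !in_itv/= => /andP[? ?]; apply/andP; split; lra.
have sI : (leb `[al, be]%classic <= (be - al)%:E)%E.
  by rewrite lebesgue_measure_itv/= lte_fin; case: ltP => [|ba]; rewrite ?lee_fin ?lexx//; lra.
have mh : measurable_fun setT (h : mR -> R).
  apply: measurable_funB => //.
  by apply: measurable_funB; apply: continuous_measurable_fun;
    exact: smooth1_continuous (smooth1_ramp _ _).
have r0 := @ramp_ge0 R; have r1 := @ramp_le1 R.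
have hE x : ~ E x -> h x = 0.
  move=> Ex; rewrite /h indicE.
  have [xt1|t1x] := ltP x t1.
    rewrite !ramp_le ?memNset/= ?subrr//; try by lra.
    by rewrite in_itv/= => /andP[? _]; lra.
  have [xt1d|t1dx] := leP x (t1 + d).
    by exfalso; apply: Ex; left; rewrite /= in_itv/= t1x.
  have [xt2|t2x] := ltP x t2.
    rewrite ramp_ge ?ramp_le ?mem_set/= ?in_itv/= ?t1x ?(ltW xt2)//; try by lra.
  have [xt2d|t2dx] := leP x (t2 + d).
    by exfalso; apply: Ex; right; rewrite /= in_itv/= t2x.
  rewrite !ramp_ge ?memNset/= ?subrr//; try by lra.
  by rewrite in_itv/= => /andP[_ ?]; lra.
have h1 x : `|h x| <= 1.
  rewrite /h indicE; have := r0 t1 d x; have := r1 t1 d x; have := r0 t2 d x; have := r1 t2 d x.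
  case: (boolP (x \in _)) => [|].
    rewrite inE/= in_itv/= => /andP[? ?]; rewrite (@ramp_le _ t2)// => ? _ ? ?.
    by rewrite /= ler_norml; apply/andP; split; lra.
  rewrite notin_setE/= in_itv/= => /negP; rewrite negb_and -!ltNge => /orP[xt|xt].
    by rewrite !ramp_le ?subrr ?normr0//; lra.
  rewrite (@ramp_ge _ t1)//; last by lra.
  by move=> ? ? _ _; rewrite /= ler_norml; apply/andP; split; lra.
have mI := measurable_itv `[al, be] : measurable (`[al, be]%classic : set mR).
have B0 : 0 <= B.
  have := gB set0 measurable0 (@sub0set _ _); by rewrite integral_set0 lee_fin.
have mhI : measurable_fun (`[al, be]%classic : set mR) (h : mR -> R) by exact: measurable_funS mh.
have mi : measurable_fun (`[al, be]%classic : set mR) (\1_(`[t1, t2]%classic : set mR) : mR -> R).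
  exact: measurable_indic.
have i1 := integrable_mul_sqr mI sI mg mhI (gB _ mI (@subset_refl _ _)) ler01 (fun x _ => h1 x).
have ind1 x : `|\1_(`[t1, t2]%classic : set mR) x : R| <= 1.
  by rewrite indicE; case: (_ \in _); rewrite ?normr1 ?normr0.
have i2 := integrable_mul_sqr mI sI mg mi (gB _ mI (@subset_refl _ _)) ler01 (fun x _ => ind1 x).
have -> : \int[leb]_(t in `[t1, t2]) g t =
    \int[leb]_(t in `[al, be]) (g t * \1_(`[t1, t2]%classic : set mR) t).
  rewrite [RHS](@Rintegral_subset0 _ mR R leb `[al, be]%classic `[t1, t2]%classic); last 2 first.
  - move=> x /=; rewrite !in_itv/= => /andP[? ?]; apply/andP; split; lra.
  - by move=> x _ xt; rewrite indicE memNset// mulr0.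
  by apply: eq_Rintegral => x xt; rewrite indicE xt mulr1.
have -> : \int[leb]_(t in `[al, be]) (g t * (ramp t1 d t - ramp t2 d t)) =
    \int[leb]_(t in `[al, be]) (g t * h t + g t * \1_(`[t1, t2]%classic : set mR) t).
  by apply: eq_Rintegral => x _; rewrite /h; ring.
rewrite RintegralD// addrK (@Rintegral_subset0 _ _ _ _ _ E)//; last first.
  by move=> x _ /hE ->; rewrite mulr0.
rewrite -[leRHS]mul1r.
apply: (@Rintegral_mul_sqr_le _ _ _ _ E g h lam 1 B (2 * d)) => //.
- exact: measurable_funS mg.
- exact: measurable_funS mh.
- exact: gB.
Qed.

Variables (a b : R * R) (i : bool) (s : R).
Let T := b - a.
Let N := s *: @axis R i.
Hypothesis D0 : det2 T N != 0.
Local Notation ptau := (ptau a T i s).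
Local Notation peta := (peta a T i s).
Local Notation strip := (strip a T i s).
Local Notation omega ep := (dramp (ep / 2) (ep / 2)).

Lemma strip_dist (c d ep : R) (x : R * R) :
  strip c (c + d) ep x -> `|x - line a b c| <= d * `|T| + ep * `|N|.
Proof.
move=> [xt xe]; rewrite -(par_pcoord a D0 x) /par /line -/T -/N.
have -> : a + (ptau x, peta x).1 *: T + (ptau x, peta x).2 *: N - (a + c *: T) =
    (ptau x - c) *: T + peta x *: N.
  rewrite /= scalerBl.
  have aux (V : zmodType) (p X Y Z : V) : p + X + Y - (p + Z) = X - Z + Y.
    by rewrite opprD addrA -(addrA p) [p + _]addrC addrK addrAC.
  exact: aux.
apply: (le_trans (ler_normD _ _)); rewrite (normrZ _ T) (normrZ _ N).
move: xt xe; rewrite !in_itv/= => /andP[? ?] /andP[? ?].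
by apply: lerD; rewrite ler_wpM2r// ger0_norm; lra.
Qed.

(* The test function is [(ramp t1 d - ramp t2 d) (ptau x) * omega ep (peta x)]:
   its tangential derivative tends to the difference of the unit masses at the
   ends of the segment. *)
Lemma strip_ftc (Om : set (R * R)) (v vb g : R * R -> R) (G : R * R -> R * R)
    (C : set (R * R)) (al be e0 t1 t2 : R) :
  open Om -> H1grad Om v G ->
  {ae area, forall x, Om x -> v x = vb x} ->
  {within C, continuous vb} ->
  trace Om (line a b) (fun x => dot (G x) (tangent a b)) g ->
  0 <= al -> be <= 1 -> 0 < e0 -> strip al be e0 `<=` Om -> strip al be e0 `<=` C ->
  (forall t, t \in `[al, be] -> closure Om (line a b t)) ->
  C (line a b t1) -> C (line a b t2) ->
  al <= t1 -> t1 < t2 -> t2 < be ->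
  enorm T * \int[leb]_(t in `[t1, t2]) g (line a b t) =
  vb (line a b t2) - vb (line a b t1).
Proof.
move=> oO HG vae cvb trg al0 be1 e00 sO sC clO Ct1 Ct2 at1 t12 t2b.
have ab : al <= be by lra.
have T0 : T != 0 by apply: contraNneq D0 => ->; rewrite /det2/= !mul0r subrr.
have nT0 : 0 < enorm T by exact: enorm_gt0.
have mO := open_measurable_plane oO.
have stripOm ep : ep <= e0 -> strip al be ep `<=` Om.
  move=> epe x [x1 x2]; apply: sO; split => //.
  by move: x2; rewrite !in_itv/= => /andP[-> /le_trans]; exact.
have vL : L2 area Om v by case: HG.
have [K K0 tl] := strip_trace_limit D0 oO al0 ab be1 stripOm trg clO.
have sub : `[al, be]%classic `<=` [set t : R | t \in `[0, 1] /\ closure Om (line a b t)].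
  move=> t tab; split; last exact: clO.
  by move: tab; rewrite /= !in_itv/= => /andP[/(le_trans al0) -> /le_trans/(_ be1) ->].
have [B B0 gB] : exists2 B : R, 0 <= B & forall P : set mR, measurable P -> P `<=` `[al,
  be]%classic ->
     (\int[leb]_(x in P) ((g (line a b x)) ^+ 2)%:E <= B%:E)%E.
  have [B B0 gB] := L2_sqr_le trg.1 (measurable_trace_set Om a T).
  by exists B => // P mP PI; apply: gB => //; exact: subset_trans sub.
have mg : measurable_fun (`[al, be]%classic : set mR) (fun t : mR => g (line a b t)).
  by case: trg => -[mg _] _; apply: measurable_funS mg => //; exact: measurable_trace_set.
pose D := `|det2 T N|; have Dp : 0 < D by rewrite normr_gt0.
(* The sum of the errors per unit of [th]: [2 * D] from the two end values, the middle term from the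
   passage to the trace, the last from replacing ramps by the indicator of [t1, t2]. *)
pose c0 := 2 * D + enorm T * (K + `|s| * (D * (be - al))) + enorm T * D * (B + 2).
have c00 : 0 <= c0.
  by rewrite !addr_ge0 ?mulr_ge0 ?addr_ge0 ?mulr_ge0 ?subr_ge0// ltW.
set I := \int[leb]_(t in `[t1, t2]) _.
set dv := vb _ - vb _.
suff main th : 0 < th -> D * `|enorm T * I - dv| <= c0 * th.
  apply/eqP; rewrite -subr_eq0 -normr_le0 leNgt; apply/negP => x0.
  have p0 : 0 < D * `|enorm T * I - dv| by exact: mulr_gt0.
  have th0 : 0 < D * `|enorm T * I - dv| / (2 * (c0 + 1)) by rewrite divr_gt0//; lra.
  have := main _ th0; rewrite mulrA ler_pdivlMr; last by lra.
  by nra.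
move=> th0.
have [r1 r10 h1] := within_continuous_dist cvb Ct1 th0.
have [r2 r20 h2] := within_continuous_dist cvb Ct2 th0.
pose r := Num.min r1 r2.
have r0 : 0 < r by rewrite lt_min r10.
(* With d and [ep] at most q, [strip_dist] puts the parallelograms that carry the end masses within
   r of the end points, where [vb] varies by less than [th]. *)
pose q := r / (2 * (1 + `|T| + `|N|)).
have q0 : 0 < q by rewrite divr_gt0// mulr_gt0// -addrA ltr_pwDl// addr_ge0.
(* The bound [th ^+ 2], here and for [ep], turns the errors [2 * d / th] and [ep / th] of the AM-GM
   estimates into multiples of [th]. *)
pose d := Num.min (Num.min q (th ^+ 2)) (Num.min (be - t2) (t2 - t1)).
have d0 : 0 < d by rewrite !lt_min q0 exprn_gt0//= !subr_gt0 t2b.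
have [dq dth dbe dt] : [/\ d <= q, d <= th ^+ 2, d <= be - t2 & d <= t2 - t1].
  have := lexx d; rewrite {2}/d !le_min => /andP[/andP[-> ->] /andP[-> ->]]//.
clearbody d.
pose ep := Num.min (Num.min q e0) (th ^+ 2).
have ep0 : 0 < ep by rewrite !lt_min q0 e00 exprn_gt0.
have [eq_ epe epth] : [/\ ep <= q, ep <= e0 & ep <= th ^+ 2].
  have := lexx ep; rewrite {2}/ep !le_min => /andP[/andP[-> ->] ->]//.
clearbody ep.
pose chi t := ramp t1 d t - ramp t2 d t.
pose chi' t := dramp t1 d t - dramp t2 d t.
have cchi : continuous chi.
  by move=> t; apply: cvgB; exact: smooth1_continuous (smooth1_ramp _ _) t.
have chi1 y : `|chi y| <= 1.
  exact: ramp_sub_le1.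
have Xlim := tl chi ep th cchi chi1 ep0 epe th0.
have t2d : t2 + d <= be by rewrite addrC -lerBrDr.
have Ylim := Rintegral_ramp_approx mg gB at1 t2d d0 dt th0.
have PO := stripOm _ epe.
have mP : measurable (strip al be ep : set plane) := measurable_strip a T i s al be ep.
have sP : (area (strip al be ep) <= (`|det2 T N| * ((be - al) * ep))%:E)%E.
  by rewrite area_strip// ltW.
have near_t (t : R) : al <= t -> t + d <= be -> forall x, strip t (t + d) ep x ->
    C x /\ `|x - line a b t| < r.
  move=> at_ tb x Px; split.
    case: Px => xt xe; apply: sC; split.
      by move: xt; rewrite !in_itv/= => /andP[x1 x2]; rewrite (le_trans at_ x1) (le_trans x2 tb).
    by move: xe; rewrite !in_itv/= => /andP[-> /le_trans]; exact.
  apply: (le_lt_trans (strip_dist Px)).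
  have := normr_ge0 T; have := normr_ge0 N.
  have : q * (2 * (1 + `|T| + `|N|)) = r.
    rewrite /q mulfVK// gt_eqF// mulr_gt0// -addrA ltr_pwDl// addr_ge0//.
  by nra.
have q_near (t : R) : al <= t -> t + d <= be -> line a b t = line a b t1 \/ line a b t = line a b
  t2 ->
    forall x, strip t (t + d) ep x -> `|vb x - vb (line a b t)| <= th.
  move=> at_ tb tt x /(near_t _ at_ tb)[Cx]; rewrite lt_min => /andP[xr1 xr2]; apply: ltW.
  by move: xr1 xr2; case: tt => ->; [move=> ? _; exact: h1|move=> _; exact: h2].
have t1d : t1 + d <= be.
  by move: dt; rewrite lerBrDl => /le_trans -> //; rewrite ltW.
have at2 : al <= t2 := le_trans at1 (ltW t12).
have A1 := strip_point_approx D0 oO ab stripOm vL vae d0 at1 t1d ep0 epe (ltW th0)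
  (q_near _ at1 t1d (or_introl erefl)).
have A2 := strip_point_approx D0 oO ab stripOm vL vae d0 at2 t2d ep0 epe (ltW th0)
  (q_near _ at2 t2d (or_intror erefl)).
have schi : smooth1 chi.
  rewrite (_ : chi = fun y => ramp t1 d y + (-1) * ramp t2 d y).
    apply: smooth1_add; first exact: smooth1_ramp.
    by apply: smooth1_mul; [exact: smooth1_cst|exact: smooth1_ramp].
  by apply/funext => y; rewrite /chi mulN1r.
have dchi (y : R) : is_derive y 1 chi (chi' y).
  by apply: is_deriveB; exact: is_derive_ramp.
have chi0 y : y \notin `[al, be] -> chi y = 0.
  rewrite in_itv/= negb_and -!ltNge /chi => /orP[yal|bey].
    by rewrite !ramp_le ?subrr// ltW// (lt_le_trans yal).
  by rewrite !ramp_ge ?subrr// ltW// (le_lt_trans _ bey).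
have ep20 : 0 < ep / 2 by rewrite divr_gt0.
have om0 y : y \notin `[ep / 2, ep] -> omega ep y = 0.
  move=> h; apply: dramp_out => //; apply: contra h; rewrite !in_itv/= => /andP[y1 y2].
  by rewrite (ltW y1)/= (splitr ep) ltW.
have WS := weak_strip D0 oO HG PO schi (smooth1_dramp _ _) dchi ep20 ab (ltW ep0) chi0 om0.
have [mv mw mu] : [/\ measurable_fun (strip al be ep : set plane) (v : plane -> R),
    forall c, measurable_fun (strip al be ep : set plane)
      (fun x : plane => dramp c d (ptau x) * omega ep (peta x)) &
    measurable_fun (strip al be ep : set plane)
      (fun x : plane => chi (ptau x) * omega ep (peta x))].
  split; first by have [mv _] := vL; exact: measurable_funS mv.
    move=> c; apply: (measurable_funS measurableT) => //.
    apply: continuous_measurable_plane; apply: smooth2_continuous.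
    by apply: smooth2_strip_test => //; exact: smooth1_dramp.
  apply: (measurable_funS measurableT) => //.
  apply: continuous_measurable_plane; apply: smooth2_continuous.
  by apply: smooth2_strip_test => //; exact: smooth1_dramp.
have iv c : area.-integrable (strip al be ep)
    (EFin \o (fun x => v x * (dramp c d (ptau x) * omega ep (peta x)))).
  have cw : continuous (fun x => dramp c d (ptau x) * omega ep (peta x)).
    by apply: smooth2_continuous; apply: smooth2_strip_test => //; exact: smooth1_dramp.
  have [M M0 hM] := continuous_bounded_strip a D0 al be ep cw.
  have [Bv _ vB] := L2_sqr_le vL mO.
  exact: (integrable_mul_sqr mP sP mv (mw c) (vB _ mP PO) M0 hM).
have iu : area.-integrable (strip al be ep)
    (EFin \o (fun x => dot (G x) (tangent a b) * (chi (ptau x) * omega ep (peta x)))).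
  have cw : continuous (fun x => chi (ptau x) * omega ep (peta x)).
    by apply: smooth2_continuous; apply: smooth2_strip_test => //; exact: smooth1_dramp.
  have [M M0 hM] := continuous_bounded_strip a D0 al be ep cw.
  have uL : L2 area Om (fun x => dot (G x) (tangent a b)) by case: trg => _ [U [uL _] _].
  have [Bu _ uB] := L2_sqr_le uL mO.
  have mu' : measurable_fun (strip al be ep : set plane) (fun x : plane => dot (G x) (tangent a b)).
    by have [mu' _] := uL; exact: measurable_funS mu'.
  exact: (integrable_mul_sqr mP sP mu' mu (uB _ mP PO) M0 hM).
have E1 : \int[area]_(x in strip al be ep) (v x * (chi' (ptau x) * omega ep (peta x))) =
    \int[area]_(x in strip al be ep) (v x * (dramp t1 d (ptau x) * omega ep (peta x))) -
    \int[area]_(x in strip al be ep) (v x * (dramp t2 d (ptau x) * omega ep (peta x))).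
  by rewrite -RintegralB//; apply: eq_Rintegral => x _; rewrite /chi'; ring.
have E2 : \int[area]_(x in strip al be ep) (dot (G x) T * (chi (ptau x) * omega ep (peta x))) =
    enorm T * \int[area]_(x in strip al be ep)
      (dot (G x) (tangent a b) * (chi (ptau x) * omega ep (peta x))).
  rewrite -RintegralZl//; apply: eq_Rintegral => x _.
  by rewrite /tangent dotZr -/T !mulrA mulfV ?gt_eqF// mul1r.
rewrite E1 E2 in WS.
move: Xlim Ylim A1 A2 WS; rewrite -/I -/D.
set X := \int[area]_(x in _) (dot _ _ * _).
set Y := \int[leb]_(t in `[al, be]) (g _ * _).
set V1 := \int[area]_(x in _) _; set V2 := \int[area]_(x in _) _.
move=> Xlim Ylim A1 A2 WS.
have {}Xlim : `|X - D * Y| <= (K + `|s| * (D * (be - al))) * th.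
  apply: (le_trans Xlim); rewrite mulrDl lerD2l -!mulrA ler_wpM2l// ler_wpM2l ?(ltW Dp)//.
  by rewrite ler_wpM2l ?subr_ge0// ler_pdivrMr// -expr2.
have {}Ylim : `|Y - I| <= (B + 2) * th.
  apply: (le_trans Ylim); by rewrite [leRHS]mulrDl (mulrC B) lerD2l -mulrA ler_wpM2l//
    ler_pdivrMr//.
have -> : D * `|enorm T * I - dv| = `|D * (enorm T * I - dv)|.
  by rewrite normrM (gtr0_norm Dp).
have -> : D * (enorm T * I - dv) = enorm T * D * (I - Y) + enorm T * (D * Y - X) +
    ((V2 - vb (line a b t2) * D) - (V1 - vb (line a b t1) * D)).
  have -> : V2 - vb (line a b t2) * D - (V1 - vb (line a b t1) * D) =
      - (V1 - V2) - D * dv by rewrite /dv; ring.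
  by rewrite WS; ring.
have -> : c0 * th = enorm T * D * ((B + 2) * th) +
    (enorm T * ((K + `|s| * (D * (be - al))) * th) + (th * D + th * D)).
  by rewrite /c0; ring.
have nTD : 0 < enorm T * D by exact: mulr_gt0.
rewrite -[X in `|X|]addrA; apply: (le_trans (ler_normD _ _)); apply: lerD.
  by rewrite normrM (gtr0_norm nTD) ler_pM2l// distrC.
apply: (le_trans (ler_normD _ _)); apply: lerD.
  by rewrite normrM (gtr0_norm nT0) ler_pM2l// distrC.
by apply: (le_trans (ler_normB _ _)); exact: lerD.
Qed.

End StripFTC.

(** * From short segments to a whole edge *)

Lemma integrable_setU d (T : measurableType d) (R : realType) (m : {measure set T -> \bar R})
    (A B : set T) (f : T -> \bar R) : measurable A -> measurable B ->
  m.-integrable A f -> m.-integrable B f -> m.-integrable (A `|` B) f.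
Proof.
move=> mA mB /integrableP[mfA fA] /integrableP[mfB fB]; apply/integrableP.
have mf : measurable_fun (A `|` B) f by apply/measurable_funU.
split=> //.
have mf2 : measurable_fun (A `|` B) (fun x => `|f x|%E) by exact: measurableT_comp.
have E : A `|` B = A `|` (B `\` A).
  apply/seteqP; split => x; last by case=> [|[]]; [left|right].
  by move=> ABx; have [Ax|Ax] := pselect (A x); [left|right; case: ABx].
rewrite E in mf2 *.
rewrite ge0_integral_setU//; last 2 first.
- exact: measurableD.
- by apply/disj_setPS => x [Ax []].
apply: lte_add_pinfty => //; apply: le_lt_trans fB.
apply: ge0_subset_integral => //; first exact: measurableD.
exact: measurableT_comp.
Qed.

(** Each one-sided trace is known to be square integrable only on the part of the edge in the
    closure of its own side; this puts the two parts together. *)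
Lemma L2_setU d (T : measurableType d) (R : realType) (m : {measure set T -> \bar R})
    (A B : set T) (f : T -> R) : measurable A -> measurable B ->
  L2 m A f -> L2 m B f -> L2 m (A `|` B) f.
Proof.
move=> mA mB [mfA fA] [mfB fB].
have abs_sqr : (fun x => `|((f x) ^+ 2)%:E|%E) = (fun x => ((f x) ^+ 2)%:E).
  by apply/funext => x; rewrite gee0_abs// lee_fin sqr_ge0.
have sqr_int (P : set T) : measurable_fun P f -> (\int[m]_(x in P) ((f x) ^+ 2)%:E < +oo)%E ->
    m.-integrable P (fun x => ((f x) ^+ 2)%:E).
  move=> mf fi; apply/integrableP; rewrite abs_sqr; split=> //.
  by apply/measurable_EFinP; exact: measurable_funX.
split; first exact/measurable_funU.
by have /integrableP[_] := integrable_setU mA mB (sqr_int _ mfA fA) (sqr_int _ mfB fB);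
  rewrite abs_sqr.
Qed.

Lemma exists_notin_itv (R : realType) (l : seq R) (x y : R) : x < y ->
  exists2 t, t \in `]x, y[ & t \notin l.
Proof.
move=> xy; suff [x' [y' [xx' x'y' y'y h]]] : exists x' y',
    [/\ x <= x', x' < y', y' <= y & forall t, t \in `]x', y'[ -> t \notin l].
  exists ((x' + y') / 2); first by rewrite in_itv/=; apply/andP; split; lra.
  by apply: h; rewrite in_itv/=; apply/andP; split; lra.
elim: l => [|c l [x' [y' [xx' x'y' y'y h]]]]; first by exists x, y.
have [cx'|x'c] := leP c x'.
  exists x', y'; split => // t tx; rewrite inE negb_or h// andbT.
  by move: tx; rewrite in_itv/= => /andP[? _]; rewrite gt_eqF//; lra.
have [y'c|cy'] := leP y' c.
  exists x', y'; split => // t tx; rewrite inE negb_or h// andbT.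
  by move: tx; rewrite in_itv/= => /andP[_ ?]; rewrite lt_eqF//; lra.
exists c, y'; split => //; first by lra.
move=> t; rewrite in_itv/= => /andP[ct ty].
rewrite inE negb_or gt_eqF//= h// in_itv/= ty andbT; lra.
Qed.

(** Without exceptional points the derivative is 0 and the mean value theorem concludes. An
    exceptional point inside the interval splits it in two; continuity on the closed halves joins
    them. *)
Lemma locally_constant_eq (R : realType) (F : R -> R) (l : seq R) (x y : R) :
  x <= y -> {within `[x, y], continuous F} ->
  (forall t, t \in `]x, y[ -> t \notin l -> exists al be, [/\ al < t, t < be &
     forall t1 t2, al < t1 -> t1 < t2 -> t2 < be -> F t1 = F t2]) ->
  F x = F y.
Proof.
elim: l x y => [|c l IH] x y; rewrite le_eqVlt => /predU1P[->//|xy] cF loc.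
  have dF z : z \in `]x, y[ -> is_derive z 1 F (cst 0 z).
    move=> /loc/(_ isT)[al [be [alz zbe h]]].
    have d0 : is_derive z 1 (cst (F z)) (0 : R) by exact: is_derive_cst.
    apply: (near_eq_is_derive _ d0).
    have : \forall t \near z, t \in `]al, be[.
      by apply: near_in_itvoo; rewrite in_itv/= alz.
    apply: filterS => t; rewrite in_itv/= => /andP[alt tbe] /=.
    by have [tz|zt|->//] := ltgtP t z; [apply/esym|]; apply: h.
  have [z _] := MVT xy dF cF.
  by rewrite mul0r => /eqP; rewrite subr_eq0 => /eqP.
have sub x' y' : x <= x' -> y' <= y -> {within `[x', y'], continuous F}.
  move=> xx' y'y; apply: continuous_subspaceW cF => t /=; rewrite !in_itv/= => /andP[? ?].
  by apply/andP; split; lra.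
have [/andP[xc cy]|] := boolP ((x < c) && (c < y)); last first.
  move=> /negP xcy; apply: (IH x y (ltW xy) cF) => t txy tl.
  apply: loc => //; rewrite inE negb_or tl andbT; apply: contra_notN xcy => /eqP <-.
  by move: txy; rewrite in_itv.
transitivity (F c); [apply: (IH x c); [lra|apply: sub; lra|]|apply: (IH c y); [lra|apply: sub;
  lra|]];
  move=> t; rewrite in_itv/= => /andP[t1 t2] tl; apply: loc;
  rewrite ?in_itv/= ?inE ?negb_or ?tl ?andbT; try (by apply/andP; split; lra).
  by rewrite lt_eqF.
by rewrite gt_eqF.
Qed.

Lemma line0 (R : realType) (a b : R * R) : line a b 0 = a.
Proof. by rewrite /line scale0r addr0. Qed.

Lemma line1 (R : realType) (a b : R * R) : line a b 1 = b.
Proof. by rewrite /line scale1r addrC subrK. Qed.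

Section EdgeFTC.
Context {R : realType}.
Local Notation mR := (measurableTypeR R).
Local Notation leb := (@lebesgue_measure R).
Local Notation area := (@area R).

(** A point of the edge is the limit of strip points as [peta] decreases to 0. *)
Lemma strip_closure (a T : R * R) (i : bool) (s : R) (Om : set (R * R)) (al be e0 t : R) :
  det2 T (s *: axis i) != 0 -> 0 < e0 ->
  strip a T i s al be e0 `<=` Om -> t \in `[al, be] -> closure Om (a + t *: T).
Proof.
move=> D0 e00 sO tab B.
set N := s *: axis i in D0 *.
have cl : continuous (fun e : R => a + t *: T + e *: N).
  by move=> e; apply: cvgD; [exact: cvg_cst|apply: cvgZl; exact: cvg_id].
move=> nB; have : nbhs (0 : R) ((fun e : R => a + t *: T + e *: N) @^-1` B).
  by apply: cl; rewrite scale0r addr0.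
move=> /nbhs_ballP[r /= r0 rB].
pose e := Num.min (r / 2) e0.
have e0' : 0 < e by rewrite lt_min e00 andbT; lra.
exists (par a T N (t, e)); split.
  apply: sO; split; rewrite ?ptau_par ?peta_par//=.
  by rewrite in_itv/= e0'/= ge_min lexx orbT.
apply: rB; rewrite /ball/= sub0r normrN gtr0_norm//.
by rewrite gt_min; apply/orP; left; lra.
Qed.

Lemma edge_ftc (C : set (R * R)) (Om : bool -> set (R * R)) (v vb g : R * R -> R)
    (G : R * R -> R * R) (a b : R * R) (i : bool) (s : R) (l : seq R) :
  (forall r, open (Om r)) -> (forall r, H1grad (Om r) v G) ->
  (forall r, {ae area, forall x, Om r x -> v x = vb x}) ->
  (forall r, Om r `<=` C) -> {within C, continuous vb} ->
  (forall r, trace (Om r) (line a b) (fun x => dot (G x) (tangent a b)) g) ->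
  (forall t, t \in `[0, 1] -> C (line a b t)) ->
  det2 (b - a) (s *: axis i) != 0 ->
  (forall t, t \in `]0, 1[ -> t \notin l -> exists r al be e0,
    [/\ [/\ 0 <= al, al < t, t < be & be <= 1], 0 < e0 &
        strip a (b - a) i s al be e0 `<=` Om r]) ->
  line_integral a b g = vb b - vb a.
Proof.
move=> oO HG vae OC cvb trg lC D0 loc.
pose S r := [set t : R | t \in `[0, 1] /\ closure (Om r) (line a b t)].
have mS r : measurable (S r : set mR) by exact: measurable_trace_set.
have cline : continuous (line a b).
  by move=> t; apply: cvgD; [exact: cvg_cst|apply: cvgZl; exact: cvg_id].
(* Points of the edge off l are in one of the closures by [strip_closure]. They are dense in the
   edge, and the union of the two closures is closed. *)
have SE : `[0, 1]%classic = S false `|` S true.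
  apply/seteqP; split => [t t01|t [] []//].
  apply: contrapT => /not_orP[Sf St].
  have cl r : closed (line a b @^-1` closure (Om r)).
    by apply: preimage_closed; [move=> ? _; exact: cline|exact: closed_closure].
  have : nbhs t (~` (line a b @^-1` closure (Om false)) `&` ~` (line a b @^-1` closure (Om true))).
    apply: filterI; apply: open_nbhs_nbhs; split; [exact/closed_openC/cl| |exact/closed_openC/cl|].
      by move=> h; apply: Sf.
    by move=> h; apply: St.
  move=> /nbhs_ballP[e /= e0 eB].
  have [] := @exists_notin_itv R l (Num.max 0 (t - e)) (Num.min 1 (t + e)).
    move: t01; rewrite /= in_itv/= => /andP[? ?].
    by rewrite lt_min !gt_max ltr01/=; apply/andP; split; [lra|apply/andP; split; lra].
  move=> t'; rewrite in_itv/= lt_min gt_max => /andP[/andP[t'0 t'e] /andP[t'1 t'e']] t'l.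
  have [|r [al [be [f [[al0 alt tbe be1] f0 sO]]]]] := loc t' _ t'l.
    by rewrite in_itv/= t'0.
  have : closure (Om r) (line a b t').
    by apply: strip_closure sO _ => //; rewrite in_itv/= !ltW.
  have [] := eB t'; first by rewrite /ball/= ltr_norml; apply/andP; split; lra.
  by case: r {sO}.
pose h := g \o line a b.
have hL : L2 leb (`[0, 1]%classic : set mR) (h : mR -> R).
  by rewrite SE; apply: L2_setU => //; have [] := trg false; have [] := trg true.
have mI : measurable (`[0, 1]%classic : set mR) by exact: measurable_itv.
have hi : leb.-integrable `[0, 1] (EFin \o h).
  have [mh _] := hL; have [B _ hB] := L2_sqr_le hL mI.
  have sI : (leb `[0%R, 1%R]%classic <= 1%:E)%E.
    by rewrite lebesgue_measure_itv/= lte_fin ltr01 sube0.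
  have := integrable_mul_sqr mI sI mh (@measurable_cst _ _ _ _ _ (1 : R)) (hB _ mI (@subset_refl
    _ _)) ler01.
  move=> /(_ (fun x _ => _)) h1.
  apply: eq_integrable (h1 _) => //; first by move=> x _; rewrite /= mulr1.
  by move=> x; rewrite /= normr1.
(* The claim is F 0 = F 1. Continuity holds because h is integrable; off l, [strip_ftc] makes F
   locally constant. *)
pose F t := vb (line a b t) - enorm (b - a) * \int[leb]_(z in `[0, t]) h z.
have cF : {within `[0, 1], continuous F}.
  have cv : {within `[0, 1], continuous (vb \o line a b)}.
    apply/subspace_continuousP => t t01; apply/cvgrPdist_lt => e e0.
    have [r r0 vr] := within_continuous_dist cvb (lC t t01) e0.
    have /cvgrPdist_lt/(_ r r0) := cline t.
    rewrite near_withinE; apply: filterS => t' tt' t'01.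
    by rewrite distrC; apply: vr; [exact: lC|rewrite distrC].
  have cI := parameterized_integral_continuous ler01 hi.
  by move=> t; apply: cvgB; [exact: cv|apply: cvgMr; exact: cI].
have F01 : F 0 = F 1.
  apply: (locally_constant_eq (l := l)) => // t t01 tl.
  have [r [al [be [f [[al0 alt tbe be1] f0 sO]]]]] := loc t t01 tl.
  exists al, be; split => // t1 t2 at1 t12 t2b.
  have FTC := strip_ftc D0 (oO r) (HG r) (vae r) cvb (trg r) al0 be1 f0 sO
     (subset_trans sO (OC r)) (fun t => strip_closure D0 f0 sO) _ _ (ltW at1) t12 t2b.
  have hi2 : leb.-integrable `[0, t2] (EFin \o h).
    apply: integrableS hi => //; move=> z /=; rewrite !in_itv/= => /andP[-> zt2]/=; lra.
  have := @Rintegral_itvB _ h (BLeft 0) (BRight t2) t1 hi2.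
  rewrite !bnd_simp => /(_ _ _) B.
  have {}B : \int[leb]_(z in `[0, t2]) h z = \int[leb]_(z in `[0,
    t1]) h z + \int[leb]_(z in `[t1, t2]) h z.
    rewrite -(@Rintegral_itv_obnd_cbnd _ t1 (BRight t2)).
      rewrite -B; [by rewrite addrC subrK| |exact: ltW].
      exact: le_trans al0 (ltW at1).
    apply: integrableS hi2 => //.
    by move=> z /=; rewrite !in_itv/= => /andP[? ->]; rewrite andbT (le_trans al0)//
      (le_trans (ltW at1))// ltW.
  have {}FTC : enorm (b - a) * \int[leb]_(z in `[t1, t2]) h z = vb (line a b t2) - vb (line a b t1).
    have t10 : 0 <= t1 := le_trans al0 (ltW at1).
    have t21 : t2 <= 1 := le_trans (ltW t2b) be1.
    have t12' := ltW t12.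
    by apply: FTC; apply: lC; rewrite in_itv/= ?t10 ?t21 ?(le_trans t10) ?(le_trans t12').
  by rewrite /F B mulrDr FTC; ring.
move: F01; rewrite /F /line_integral set_itv1 Rintegral_set1 mulr0 subr0.
rewrite line0 line1 => ->; rewrite opprB addrCA subrr addr0.
by [].
Qed.

End EdgeFTC.

(** * Unisolvence of the local spaces *)

Section Unisolvence.
Context {R : realType}.
Implicit Types (u v w n a y : R * R).

(** The clockwise quarter turn, which is the rotational field of [ND]. *)
Definition rot x : R * R := (x.2, - x.1).

(* The hypotheses say that the triangle 0, u, v has no obtuse angle. *)
Lemma no_obtuse_bound u v (d e : R) :
  0 <= dot u v -> 0 <= dot u (u - v) -> 0 <= dot v (v - u) ->
  0 < d -> d <= 1 -> 0 < e -> e <= 1 ->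
  0 <= d * e * dot (e *: v - d *: u) (v - u) <= dot (e *: v - d *: u) (e *: v - d *: u).
Proof.
move=> uv0 uu0 vv0 d0 d1 e0 e1; set w := e *: v - d *: u.
pose a := dot u u; pose b := dot v v; pose c := dot u v.
have ca : c <= a by rewrite -subr_ge0; rewrite (_ : a - c = dot u (u - v))//;
  rewrite /a /c /dot/=; ring.
have cb : c <= b by rewrite -subr_ge0; rewrite (_ : b - c = dot v (v - u))//;
  rewrite /b /c /dot/=; ring.
have c0 : 0 <= c by [].
have -> : dot w (v - u) = e * (b - c) + d * (a - c).
  by rewrite /w /a /b /c /dot/= -![_ *: _]/(_ * _); ring.
have -> : dot w w = b * e ^+ 2 - 2 * c * d * e + a * d ^+ 2.
  by rewrite /w /a /b /c /dot/= -![_ *: _]/(_ * _); ring.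
apply/andP; split.
  by rewrite mulr_ge0 ?addr_ge0 ?mulr_ge0 ?subr_ge0// ltW.
rewrite -subr_ge0.
(* The three angle conditions say that [a - c], [b - c] and c are nonnegative; the difference is a
   combination of them whose coefficients are nonnegative for d, e in ]0, 1]. *)
have -> : b * e ^+ 2 - 2 * c * d * e + a * d ^+ 2 - d * e * (e * (b - c) + d * (a - c)) =
   (b - c) * (e ^+ 2 * (1 - d)) + (a - c) * (d ^+ 2 * (1 - e)) + c * (e - d) ^+ 2 by ring.
apply: addr_ge0; [apply: addr_ge0|]; apply: mulr_ge0; rewrite ?subr_ge0 ?sqr_ge0//;
  by apply: mulr_ge0; rewrite ?subr_ge0 ?sqr_ge0.
Qed.

Lemma dot_eq0 u v a : det2 u v != 0 -> dot a u = 0 -> dot a v = 0 -> a = 0.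
Proof.
move=> uv0 au av.
have e1 : a.1 * det2 u v = 0.
  have -> : a.1 * det2 u v = v.2 * dot a u - u.2 * dot a v by rewrite /det2 /dot; ring.
  by rewrite au av !mulr0 subrr.
have e2 : a.2 * det2 u v = 0.
  have -> : a.2 * det2 u v = u.1 * dot a v - v.1 * dot a u by rewrite /det2 /dot; ring.
  by rewrite au av !mulr0 subrr.
move/eqP: e1; move/eqP: e2; rewrite !mulf_eq0 (negbTE uv0) !orbF => /eqP a2 /eqP a1.
by rewrite [a]surjective_pairing a1 a2.
Qed.

Lemma perp_rot w n : w != 0 -> dot n w = 0 -> exists k : R, n = k *: rot w.
Proof.
move=> w0 nw; pose W := dot w w.
have W0 : W != 0.
  apply: contraNneq w0 => W0.
  suff : enorm w = 0 by have := @enorm_gt0 R w; case: eqVneq => // _ /(_ isT) /[swap] ->;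
    rewrite ltxx.
  by rewrite /enorm -/W W0 sqrtr0.
exists (dot n (rot w) / W).
have h1 : n.1 * W = dot n (rot w) * w.2.
  have -> : n.1 * W = w.1 * dot n w + dot n (rot w) * w.2 by rewrite /W /dot /rot/=; ring.
  by rewrite nw mulr0 add0r.
have h2 : n.2 * W = - (dot n (rot w) * w.1).
  have -> : n.2 * W = w.2 * dot n w - dot n (rot w) * w.1 by rewrite /W /dot /rot/=; ring.
  by rewrite nw mulr0 add0r.
rewrite [n in LHS]surjective_pairing /rot -[_ *: _]/(_ * w.2, _ * - w.1).
congr pair; apply: (mulIf W0).
  by rewrite h1 mulrAC divfK.
by rewrite h2 mulrAC divfK// mulrN.
Qed.

(* Stokes' theorem kills the curls; then [a0 - a1] is normal to the chord, and
   [no_obtuse_bound] makes the equation for its length definite. *)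
Lemma cut_unisolvence u v n (d e : R) a0 a1 (b0 b1 mu0 mu1 beta0 beta1 : R) :
  det2 u v != 0 ->
  0 <= dot u v -> 0 <= dot u (u - v) -> 0 <= dot v (v - u) ->
  0 < d -> d <= 1 -> 0 < e -> e <= 1 ->
  0 < mu0 -> 0 < mu1 -> 0 < beta0 -> 0 < beta1 ->
  n != 0 -> dot n (e *: v - d *: u) = 0 ->
  d * dot a0 u + (1 - d) * dot a1 u = 0 ->
  e * dot a0 v + (1 - e) * dot a1 v = 0 ->
  dot (a1 + b1 *: rot u) (v - u) = 0 ->
  dot (a1 + b1 *: rot (d *: u)) (e *: v - d *: u) =
    dot (a0 + b0 *: rot (d *: u)) (e *: v - d *: u) ->
  mu1^-1 * b1 = mu0^-1 * b0 ->
  let m := (1 / 2 : R) *: (d *: u + e *: v) in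
  beta1 * dot (a1 + b1 *: rot m) n = beta0 * dot (a0 + b0 *: rot m) n ->
  [/\ a0 = 0, b0 = 0, a1 = 0 & b1 = 0].
Proof.
move=> D0 uv uu vv d0 d1 e0 e1 m00 m10 be00 be10 n0 nw H1 H2 H3 H4 H5 m H6.
have de1 : d * e <= 1 by rewrite mulr_ile1// ltW.
have de0 : 0 < d * e by rewrite mulr_gt0.
(* The common value of b / mu on the two pieces, that is, of curl / mu up to the factor -2. *)
pose k := b1 / mu1.
have b1E : b1 = mu1 * k by rewrite /k mulrC divfK// gt_eqF.
have b0E : b0 = mu0 * k by rewrite /k mulrC [b1 / _]mulrC H5 mulrAC mulVf ?mul1r// gt_eqF.
have k0 : k = 0.
  (* The curls are weighted by area: the corner cut off by the chord is the fraction [d * e] of the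
     triangle. The contributions of the chord from its two sides cancel by H4. *)
  have : (b0 * (d * e) + b1 * (1 - d * e)) * det2 u v = 0.
    have : dot (a1 + b1 *: rot (d *: u)) (e *: v - d *: u) - dot (a0 + b0 *: rot (d *: u)) (e *:
      v - d *: u) = 0.
      by rewrite H4 subrr.
    move: H1 H2 H3; rewrite /dot /rot /det2/= -![_ *: _]/(_ * _).
    move: (u.1) (u.2) (v.1) (v.2) (a0.1) (a0.2) (a1.1) (a1.2) => u1 u2 v1 v2 p1 p2 q1 q2.
    clear; move=> H1 H2 H3 H4.
    lra.
  rewrite b0E b1E => /eqP; rewrite mulf_eq0 (negbTE D0) orbF.
  have -> : mu0 * k * (d * e) + mu1 * k * (1 - d * e) = k * (mu0 * (d * e) + mu1 * (1 - d * e))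
    by ring.
  rewrite mulf_eq0 => /orP[/eqP//|]; rewrite gt_eqF// ltr_pwDl ?mulr_gt0//.
  by rewrite mulr_ge0 ?subr_ge0// ltW.
rewrite k0 mulr0 in b1E; rewrite k0 mulr0 in b0E.
move: H3 H4 H6; rewrite b0E b1E !scale0r !addr0 => H3 H4 H6.
set w := e *: v - d *: u in nw H4.
have w0 : w != 0.
  apply: contraNneq D0 => w0.
  have : det2 u w = 0 by rewrite w0 /det2/= !mulr0 subrr.
  have -> : det2 u w = e * det2 u v by rewrite /w /det2/= -![_ *: _]/(_ * _); ring.
  by move/eqP; rewrite mulf_eq0 gt_eqF//= => /eqP.
have [W0 X0] : 0 < dot w w /\ 0 <= d * e * dot w (v - u) <= dot w w.
  split; last exact: no_obtuse_bound.
  have := enorm_gt0 w0; rewrite /enorm; have [W0|//] := leP (dot w w) 0.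
  by rewrite ler0_sqrtr// ltxx.
have [kn nE] := perp_rot w0 nw.
have kn0 : kn != 0 by apply: contraNneq n0 => kn0; rewrite nE kn0 scale0r.
have [g gE] : exists g : R, a0 - a1 = g *: rot w.
  apply: perp_rot => //; move: H4; rewrite /dot/=; lra.
have a0E : a0 = a1 + g *: rot w by rewrite -gE addrC subrK.
(* The edge condition along u, with [dot (rot w) u = det2 u w = e * det2 u v]. *)
have a1u : dot a1 u = - g * (d * e * det2 u v).
  have : d * dot (a0 - a1) u + dot a1 u = 0 by rewrite -H1 /dot/=; ring.
  rewrite gE /rot /w /dot /det2/= -![_ *: _]/(_ * _).
  by move=> h; apply/eqP; rewrite -subr_eq0 -h; apply/eqP; ring.
have a1v : dot a1 v = - g * (d * e * det2 u v).
  by rewrite -a1u; move: H3; rewrite /dot/=; lra.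
have a1w : dot a1 (rot w) = - g * (d * e * dot w (v - u)).
  apply: (mulIf D0).
  have -> : dot a1 (rot w) * det2 u v = dot w v * dot a1 u - dot w u * dot a1 v.
    rewrite /rot /dot /det2/=; ring.
  rewrite a1u a1v /dot/=; ring.
have {}H6 : beta1 * dot a1 (rot w) = beta0 * (dot a1 (rot w) + g * dot w w).
  apply: (mulfI kn0); move: H6; rewrite nE a0E /rot /dot/= -![_ *: _]/(_ * _) => H6.
  apply/eqP; rewrite -subr_eq0; apply/eqP; move/eqP: H6; rewrite -subr_eq0 => /eqP <-.
  ring.
have g0 : g = 0.
  (* With X = d e w.(v - u), the flux condition becomes g (beta0 (|w|^2 - X) + beta1 X) = 0. As 0 <=
     X <= |w|^2 and both coefficients are positive, the second factor is positive. *)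
  have : g * (beta0 * (dot w w - d * e * dot w (v - u)) + beta1 * (d * e * dot w (v - u))) = 0.
    by move: H6; rewrite a1w; lra.
  move/eqP; rewrite mulf_eq0 => /orP[/eqP//|]; rewrite gt_eqF//.
  case/andP: X0; move: (d * e * dot w (v - u)) => X X0 XW.
  have [->|Xn] := eqVneq X 0; first by rewrite subr0 mulr0 addr0 mulr_gt0.
  apply: ltr_wpDl; first by rewrite mulr_ge0 ?subr_ge0// ltW.
  by rewrite mulr_gt0// lt0r Xn.
have a10 : a1 = 0.
  by apply: (dot_eq0 D0); rewrite ?a1u ?a1v g0 oppr0 mul0r.
by rewrite a0E a10 g0 scale0r addr0.
Qed.

(** With a vertex at the origin, the rotational part has no tangential component on the two edges
    through it; these edges determine a, and the third determines b. *)
Lemma ND_unisolvence u v a (b : R) : det2 u v != 0 ->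
  dot a u = 0 -> dot a v = 0 -> dot (a + b *: rot u) (v - u) = 0 -> a = 0 /\ b = 0.
Proof.
move=> D0 au av h; have a0 := dot_eq0 D0 au av; split=> //.
move: h; rewrite a0 add0r => h.
have : b * det2 u v = 0.
  have -> : b * det2 u v = - dot (b *: rot u) (v - u).
    by rewrite /dot /rot /det2/= -![_ *: _]/(_ * _); ring.
  by rewrite h oppr0.
by move/eqP; rewrite mulf_eq0 (negbTE D0) orbF => /eqP.
Qed.

End Unisolvence.

(** * Triangles and strips along their edges *)

Section Triangle.
Context {R : realType}.
Implicit Types (A B C x : R * R) (p q t : R).

(* The point with barycentric coordinates (1 - p - q, p, q). *)
Definition bary A B C p q : R * R := A + p *: (B - A) + q *: (C - A).

Definition triangle A B C : set (R * R) :=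
  [set x | exists p q, [/\ 0 <= p, 0 <= q, p + q <= 1 & x = bary A B C p q]].

Definition baryp A B C x : R := det2 (x - A) (C - A) / det2 (B - A) (C - A).
Definition baryq A B C x : R := det2 (B - A) (x - A) / det2 (B - A) (C - A).

Section Coordinates.
Variables (A B C : R * R).
Hypothesis D0 : det2 (B - A) (C - A) != 0.

Lemma baryp_bary p q : baryp A B C (bary A B C p q) = p.
Proof.
rewrite /baryp; apply: (canLR (mulfK D0)).
by rewrite /bary /det2/= -![_ *: _]/(_ * _); ring.
Qed.

Lemma baryq_bary p q : baryq A B C (bary A B C p q) = q.
Proof.
rewrite /baryq; apply: (canLR (mulfK D0)).
by rewrite /bary /det2/= -![_ *: _]/(_ * _); ring.
Qed.

Lemma bary_coord x : bary A B C (baryp A B C x) (baryq A B C x) = x.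
Proof.
move: D0; rewrite /bary /baryp /baryq /det2/= => D0'.
rewrite [RHS]surjective_pairing.
rewrite -[X in _ + X + _]/(_ * (B.1 - A.1), _ * (B.2 - A.2)).
rewrite -[X in _ + X]/(_ * (C.1 - A.1), _ * (C.2 - A.2)).
by congr pair => /=; field; exact: D0'.
Qed.

Lemma continuous_baryp : continuous (baryp A B C).
Proof.
move=> x; rewrite /baryp /det2; apply: cvgMl; apply: cvgB; apply: cvgMl => /=.
  by apply: cvgB; [exact: cvg_fst|exact: cvg_cst].
by apply: cvgB; [exact: cvg_snd|exact: cvg_cst].
Qed.

Lemma continuous_baryq : continuous (baryq A B C).
Proof.
move=> x; rewrite /baryq /det2; apply: cvgMl; apply: cvgB; apply: cvgMr => /=.
  by apply: cvgB; [exact: cvg_snd|exact: cvg_cst].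
by apply: cvgB; [exact: cvg_fst|exact: cvg_cst].
Qed.

Lemma triangleP x : triangle A B C x <->
  [/\ 0 <= baryp A B C x, 0 <= baryq A B C x & baryp A B C x + baryq A B C x <= 1].
Proof.
split=> [[p [q [p0 q0 pq ->]]]|[p0 q0 pq]]; first by rewrite baryp_bary baryq_bary.
by exists (baryp A B C x), (baryq A B C x); rewrite bary_coord.
Qed.

Lemma closed_triangle : closed (triangle A B C).
Proof.
rewrite (_ : triangle A B C = baryp A B C @^-1` [set y | 0 <= y] `&`
  (baryq A B C @^-1` [set y | 0 <= y] `&`
   (fun x => baryp A B C x + baryq A B C x) @^-1` [set y | y <= 1])); last first.
  by apply/seteqP; split => x; [move/triangleP => []|case=> ? [? ?]; apply/triangleP].
apply: closedI; [|apply: closedI]; apply: preimage_closed.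
- by move=> x _; exact: continuous_baryp.
- exact: closed_ge.
- by move=> x _; exact: continuous_baryq.
- exact: closed_ge.
- by move=> x _; apply: cvgD; [exact: continuous_baryp|exact: continuous_baryq].
- exact: closed_le.
Qed.

Lemma interior_triangle p q : 0 < p -> 0 < q -> p + q < 1 ->
  interior (triangle A B C) (bary A B C p q).
Proof.
move=> p0 q0 pq.
have np : \forall x \near bary A B C p q, 0 < baryp A B C x.
  have h : nbhs (baryp A B C (bary A B C p q)) [set y | 0 < y].
    by rewrite baryp_bary; exact: lt_nbhsr.
  exact: (@continuous_baryp _ _ h).
have nq : \forall x \near bary A B C p q, 0 < baryq A B C x.
  have h : nbhs (baryq A B C (bary A B C p q)) [set y | 0 < y].
    by rewrite baryq_bary; exact: lt_nbhsr.
  exact: (@continuous_baryq _ _ h).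
have npq : \forall x \near bary A B C p q, baryp A B C x + baryq A B C x < 1.
  have c : continuous (fun x => baryp A B C x + baryq A B C x).
    by move=> x; apply: cvgD; [exact: continuous_baryp|exact: continuous_baryq].
  have h : nbhs (baryp A B C (bary A B C p q) + baryq A B C (bary A B C p q)) [set y | y < 1].
    by rewrite baryp_bary baryq_bary; exact: lt_nbhsl.
  exact: (c _ _ h).
apply: filterS3 np nq npq => x /ltW xp /ltW xq /ltW xpq.
exact/triangleP.
Qed.

(** From a point with [baryq = 0], a small step in the direction A - C leaves the triangle. *)
Lemma interior_triangle_gt0 x : interior (triangle A B C) x -> 0 < baryq A B C x.
Proof.
move=> ix; have /triangleP[_ q0 _] := interior_subset ix.
rewrite lt0r q0 andbT; apply/eqP => xq.
have c : continuous (fun e : R => x + (- e) *: (C - A)).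
  by move=> e; apply: cvgD; [exact: cvg_cst|apply: cvgZl; apply: cvgN; exact: cvg_id].
have : \forall e \near (0 : R), triangle A B C (x + (- e) *: (C - A)).
  by apply: (c 0); rewrite /= oppr0 scale0r addr0.
move=> /nbhs_ballP[r /= r0 rB].
have /rB/triangleP[_ + _] : ball (0 : R) r (r / 2).
  by rewrite /ball/= sub0r normrN gtr0_norm; lra.
rewrite -(bary_coord x) xq (_ : _ + _ = bary A B C (baryp A B C x) (- (r / 2))).
  by rewrite baryq_bary; lra.
by rewrite /bary scale0r addr0.
Qed.

Lemma bdry_triangle x : bdry (triangle A B C) x ->
  [\/ segment A B x, segment A C x | segment B C x].
Proof.
case=> clx nix.
have /triangleP[p0 q0 pq] : triangle A B C x.
  by move: clx; rewrite -(closure_id _).1//; exact: closed_triangle.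
have xE := bary_coord x.
set p := baryp A B C x in p0 pq xE; set q := baryq A B C x in q0 pq xE.
have [qz|qn] := eqVneq q 0.
  constructor 1; exists p; last by rewrite -xE qz /bary scale0r addr0.
  by rewrite /= in_itv/= p0/=; lra.
have [pz|pn] := eqVneq p 0.
  constructor 2; exists q; last by rewrite -xE pz /bary scale0r addr0.
  by rewrite /= in_itv/= q0/=; lra.
constructor 3; exists q; first by rewrite /= in_itv/= q0/=; lra.
have [pq1|pq1] := eqVneq (p + q) 1.
  have -> : q = 1 - p by lra.
  rewrite -xE (_ : q = 1 - p); last by lra.
  rewrite /line /bary [LHS]surjective_pairing [RHS]surjective_pairing /= -![_ *: _]/(_ * _).
  by congr pair; ring.
exfalso; apply: nix; rewrite -xE; apply: interior_triangle; rewrite lt_def ?pn ?qn//.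
by rewrite eq_sym pq1.
Qed.

End Coordinates.

(** A degenerate triangle lies in a line with normal m, and a small step along m leaves it. The
    cases only secure a nonzero m when a side vanishes. *)
Lemma det2_triangle A B C : interior (triangle A B C) !=set0 ->
  det2 (B - A) (C - A) != 0.
Proof.
case=> x ix; apply/eqP => D0.
have [m [m0 mu mv]] : exists m, [/\ m != 0, dot m (B - A) = 0 & dot m (C - A) = 0].
  have [u0|u0] := eqVneq (B - A) 0; last first.
    exists (rot (B - A)); split; last by rewrite -oppr0 -D0 /dot /rot /det2/=; ring.
      apply: contraNneq u0 => -[u2 /eqP]; rewrite oppr_eq0 => /eqP u1.
      by rewrite [B - A]surjective_pairing /= u1 u2.
    by rewrite /dot /rot/=; ring.
  have [v0|v0] := eqVneq (C - A) 0.
    exists (1, 0); split; rewrite ?u0 ?v0 /dot/= ?mulr0 ?addr0//.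
    by apply/eqP => -[] /eqP; rewrite oner_eq0.
  exists (rot (C - A)); split.
  - apply: contraNneq v0 => -[u2 /eqP]; rewrite oppr_eq0 => /eqP u1.
    by rewrite [C - A]surjective_pairing /= u1 u2.
  - by rewrite u0 /dot/= !mulr0 addr0.
  - by rewrite /dot /rot/=; ring.
have flat y : triangle A B C y -> dot m (y - A) = 0.
  move=> [p [q [_ _ _ ->]]].
  have -> : dot m (bary A B C p q - A) = p * dot m (B - A) + q * dot m (C - A).
    by rewrite /dot /bary/= -![_ *: _]/(_ * _); ring.
  by rewrite mu mv !mulr0 addr0.
have c : continuous (fun e : R => x + e *: m).
  by move=> e; apply: cvgD; [exact: cvg_cst|apply: cvgZl; exact: cvg_id].
have : \forall e \near (0 : R), triangle A B C (x + e *: m).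
  by apply: (c 0); rewrite /= scale0r addr0.
move=> /nbhs_ballP[r /= r0 rB].
have /rB/flat : ball (0 : R) r (r / 2).
  by rewrite /ball/= sub0r normrN gtr0_norm; lra.
have -> : dot m (x + (r / 2) *: m - A) = dot m (x - A) + (r / 2) * dot m m.
  by rewrite /dot/= -![_ *: _]/(_ * _); ring.
rewrite flat; last exact: interior_subset.
rewrite add0r => /eqP; rewrite mulf_eq0 gt_eqF/=; last by lra.
move=> /eqP mm; have := enorm_gt0 m0.
by rewrite /enorm mm sqrtr0 ltxx.
Qed.

Lemma hull_triangle (n : nat) (node : 'I_n -> R * R) (i j k : 'I_n) :
  i != j -> i != k -> j != k ->
  hull node [set i; j; k]%SET = triangle (node i) (node j) (node k).
Proof.
move=> ij ik jk.
have sum3 (V : nmodType) (F : 'I_n -> V) : \sum_(l in [set i; j; k]%SET) F l = F i + F j + F k.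
  rewrite finset.setUC big_setU1/=; last by rewrite !inE negb_or eq_sym ik eq_sym jk.
  rewrite big_setU1/=; last by rewrite !inE.
  by rewrite big_set1 addrC.
apply/seteqP; split => x [].
- move=> l [l0]; rewrite !sum3 => l1 ->.
  exists (l j), (l k); split => //; first by have := l0 i; lra.
  have -> : l i = 1 - l j - l k by lra.
  rewrite /bary [LHS]surjective_pairing [RHS]surjective_pairing /= -![_ *: _]/(_ * _).
  by congr pair; ring.
- move=> p [q [p0 q0 pq ->]].
  pose l (r : 'I_n) := if r == j then p else if r == k then q else 1 - p - q.
  have [li lj lk] : [/\ l i = 1 - p - q, l j = p & l k = q].
    by rewrite /l eqxx (negbTE ij) (negbTE ik) [k == j]eq_sym (negbTE jk) eqxx.
  exists l; rewrite !sum3 li lj lk; last first.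
    rewrite /bary [LHS]surjective_pairing [RHS]surjective_pairing /= -![_ *: _]/(_ * _).
    by congr pair; ring.
  split; last by ring.
  by move=> r; rewrite /l; do ! case: ifP => // _; lra.
Qed.

End Triangle.

(** * Strips inside a triangle and on one side of the interface *)

Section StripGeometry.
Context {R : realType}.
Local Notation mR := (measurableTypeR R).
Local Notation plane := (mR * mR)%type.
Local Notation leb := (@lebesgue_measure R).
Local Notation area := (@area R).

(** The positive quotient says that [s *: axis i] points to the same side of u as v, that is, into
    the triangle. Some axis is not parallel to u, and s supplies the sign. *)
Lemma transverse_axis (u v : R * R) : det2 u v != 0 ->
  exists i s, 0 < det2 u (s *: axis i) / det2 u v.
Proof.
move=> D0.
suff [i ui] : exists i, det2 u (axis i) != 0.
  exists i, (det2 u (axis i) * det2 u v).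
  have -> (s : R) : det2 u (s *: axis i) = s * det2 u (axis i).
    by rewrite /det2/= -![_ *: _]/(_ * _); ring.
  rewrite mulrAC mulfK//.
  by rewrite -expr2 exprn_even_gt0.
have [u1|u1] := eqVneq u.1 0; last by exists true; rewrite /det2/= mulr0 subr0 mulr1.
exists false; rewrite /det2/= mulr0 mulr1 sub0r oppr_eq0.
by apply: contraNneq D0 => u2; rewrite /det2 u1 u2 !mul0r subrr.
Qed.

(** Writing N = n1 u + n2 v with n2 > 0, the strip point (t, e) has barycentric coordinates t + e n1
    and e n2. A skew strip could leave through the other two sides; the margins al and 1 - be leave
    room for a small width. *)
Lemma strip_triangle (A B C : R * R) (i : bool) (s al be : R) :
  det2 (B - A) (C - A) != 0 -> 0 < det2 (B - A) (s *: axis i) / det2 (B - A) (C - A) ->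
  0 < al -> be < 1 ->
  exists2 e0 : R, 0 < e0 &
    strip A (B - A) i s al be e0 `<=` interior (triangle A B C).
Proof.
move=> D0 n20 al0 be1.
set u := B - A in D0 n20 *; set v := C - A in D0 n20 *; set N := s *: axis i in n20 *.
have DN : det2 u N != 0 by apply: contraTneq n20 => ->; rewrite mul0r ltxx.
pose n1 := det2 N v / det2 u v; pose n2 := det2 u N / det2 u v.
pose M := Num.min al (1 - be).
have M0 : 0 < M by rewrite lt_min al0 subr_gt0.
have k0 : 0 < `|n1| + n2 + 1 by rewrite -addrA ltr_wpDl// addr_gt0.
exists (M / (`|n1| + n2 + 1)); first by rewrite divr_gt0.
move=> x [xt xe].
have xE := par_pcoord A DN x; set t := ptau _ _ _ _ _ in xt xE; set e := peta _ _ _ _ _ in xe xE.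
have -> : x = bary A B C (t + e * n1) (e * n2).
  rewrite -xE /bary /par -/u -/v /= scalerDl -!addrA; congr (_ + (_ + _)).
  rewrite /n1 /n2; move: D0; rewrite /det2 => D0.
  rewrite [LHS]surjective_pairing [RHS]surjective_pairing /= -/N -![_ *: _]/(_ * _).
  by congr pair; field; exact: D0.
move: xt xe; rewrite !in_itv/= => /andP[t1 t2] /andP[e1].
rewrite ler_pdivlMr// => e2.
have [M1 M2] : M <= al /\ M <= 1 - be by rewrite !ge_min !lexx orbT.
have en : - (e * `|n1|) <= e * n1 <= e * `|n1|.
  by rewrite -mulrN !ler_pM2l// lerNl -normrN ler_norm normrN ler_norm.
have en2 : 0 < e * n2 by rewrite mulr_gt0.
have en1 : 0 <= e * `|n1| by rewrite mulr_ge0// ltW.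
have {e2}e2 : e * `|n1| + e * n2 + e <= M by move: e2; rewrite !mulrDr mulr1.
case/andP: en => en3 en4.
by apply: interior_triangle => //; lra.
Qed.

(** A strip is convex. A segment in it that starts in [O true] meets [O true] in a relatively open
    and closed set, hence stays there. *)
Lemma strip_one_side (a T : R * R) (i : bool) (s al be e0 : R) (O : bool -> set (R * R)) :
  det2 T (s *: axis i) != 0 -> (forall r, open (O r)) ->
  O false `&` O true = set0 ->
  strip a T i s al be e0 `<=` O false `|` O true ->
  exists r, strip a T i s al be e0 `<=` O r.
Proof.
move=> D0 oO O0 sO.
have [[x [Px Ox]]|nx] := pselect (exists x, strip a T i s al be e0 x /\ O true x); last first.
  by exists false => x Px; case: (sO x Px) => // Ox; exfalso; apply: nx; exists x.
exists true => y Py.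
have Lsub t : t \in `[0, 1] -> strip a T i s al be e0 (line x y t).
  rewrite in_itv/= => /andP[t0 t1].
  have l1 : (line x y t).1 = (1 - t) * x.1 + t * y.1.
    by rewrite /line/= -[_ *: _]/(_ * _); ring.
  have l2 : (line x y t).2 = (1 - t) * x.2 + t * y.2.
    by rewrite /line/= -[_ *: _]/(_ * _); ring.
  have pE : ptau a T i s (line x y t) = (1 - t) * ptau a T i s x + t * ptau a T i s y.
    by rewrite !(ptauE _ D0) l1 l2; ring.
  have eE : peta a T i s (line x y t) = (1 - t) * peta a T i s x + t * peta a T i s y.
    by rewrite !(petaE _ D0) l1 l2; ring.
  case: Px => + +; case: Py; rewrite /strip/= pE eE !in_itv/=.
  move: (ptau _ _ _ _ x) (ptau _ _ _ _ y) (peta _ _ _ _ x) (peta _ _ _ _ y) => p p' q q'.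
  move=> /andP[? ?] /andP[? ?] /andP[? ?] /andP[? ?].
  by split; apply/andP; split; nra.
have cL : connected (segment x y).
  apply: connected_continuous_connected; first exact: segment_connected.
  apply: continuous_subspaceT => t.
  by apply: cvgD; [exact: cvg_cst|apply: cvgZl; exact: cvg_id].
have LE : segment x y `&` O true = segment x y.
  apply: cL.
  - exists x; split=> //; exists 0; rewrite ?line0//.
    by rewrite /= in_itv/= lexx ler01.
  - by exists (O true).
  - exists (~` O false); first exact/open_closedC.
    apply/seteqP; split => z [Lz Oz]; split=> //.
      by move=> Ofz; have : set0 z by rewrite -O0.
    by case: Lz => t t01 tz; case: (sO z _) => //; rewrite -tz; exact: Lsub.
have : (segment x y `&` O true) y.
  rewrite LE; exists 1; rewrite ?line1//.
  by rewrite /= in_itv/= lexx ler01.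
by case.
Qed.

(** By periodicity the range is the image of [0, 1], which is compact. *)
Lemma closed_range_jordan (gam : R -> R * R) : smooth_jordan gam -> closed (range gam).
Proof.
case=> dgam per _ _.
have cgam : continuous gam.
  have c i : continuous (pcoord i \o gam).
    move=> t; apply: differentiable_continuous; apply/derivable1_diffP.
    exact: (dgam i 0%N t).
  move=> t; rewrite (_ : gam = fun t => (pcoord false \o gam) t *: axis false + (pcoord true \o
    gam) t *: axis true).
    by apply: cvgD; apply: cvgZl; [exact: (c false)|exact: (c true)].
  apply/funext => t' /=; rewrite [LHS]surjective_pairing -![_ *: (_, _)]/(_ * _, _ * _).
  by congr pair; rewrite /= ?mulr1 ?mulr0 ?addr0 ?add0r.
have perN (k : nat) t : gam (t + k%:R) = gam t.
  by elim: k => [|k IH]; rewrite ?addr0// -natr1 addrA per.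
have perZ (k : int) t : gam (t + k%:~R) = gam t.
  case: k => k; first exact: perN.
  by rewrite NegzE mulrNz -[in RHS](subrK k.+1%:R t) perN.
have -> : range gam = gam @` `[0, 1].
  apply/seteqP; split => [_ [t _ <-]|_ [t _ <-]]; last by exists t.
  exists (t - (Num.floor t)%:~R).
    rewrite /= in_itv/= subr_ge0 floor_le/=.
    have := floorD1_gt t; rewrite intrD => /ltW; lra.
  by rewrite -mulrNz perZ.
apply: (@compact_closed (R * R)%type); first exact: (@norm_hausdorff R (R * R)%type).
by apply: continuous_compact; [exact: continuous_subspaceT|exact: segment_compact].
Qed.

Lemma area_ball_gt0 (x : R * R) (r : R) : 0 < r ->
  (0 < area (ball x r : set plane))%E.
Proof.
move=> r0; pose Q : set plane := `](x.1 - r / 2), (x.1 + r / 2)[%classic `*` `](x.2 - r / 2),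
  (x.2 + r / 2)[%classic.
have mQ : measurable Q by apply: measurableX; exact: measurable_itv.
have Qpos : (0 < area Q)%E.
  have -> : area Q = (leb `](x.1 - r / 2)%R, (x.1 + r / 2)%R[%classic * leb `](x.2 - r / 2)%R,
    (x.2 + r / 2)%R[%classic)%E.
    by apply: product_measure1E; exact: measurable_itv.
  have l (t : R) : leb `](t - r / 2)%R, (t + r / 2)%R[%classic = r%:E.
    rewrite lebesgue_measure_itv/= lte_fin ifT; last by lra.
    by rewrite -EFinB; congr EFin; lra.
  by rewrite !l -EFinM lte_fin mulr_gt0.
apply: (lt_le_trans Qpos); apply: le_measure; rewrite ?inE//.
  apply: open_measurable_plane; exact: ball_open.
move=> y [/=]; rewrite !in_itv/= => /andP[? ?] /andP[? ?].
by split; rewrite /ball/= ltr_norml; apply/andP; split; lra.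
Qed.

(** [point_value] provides a separate representative at each node, whereas the values at both ends
    of an edge have to come from the same one. If f and g differed at X, they would differ on a ball
    in O near X; since v cannot equal both there, two null sets would cover that ball. *)
Lemma continuous_representative_unique (O : set (R * R)) (v f g : R * R -> R) (X : R * R) :
  open O -> {within closure O, continuous f} -> {within closure O, continuous g} ->
  {ae area, forall x, O x -> v x = f x} -> {ae area, forall x, O x -> v x = g x} ->
  closure O X -> f X = g X.
Proof.
move=> oO cf cg vf vg OX; apply/eqP; rewrite -subr_eq0 -normr_le0 leNgt; apply/negP => fg0.
pose e := `|f X - g X| / 2; have e0 : 0 < e by rewrite divr_gt0.
have [r1 r10 h1] := within_continuous_dist cf OX e0.
have [r2 r20 h2] := within_continuous_dist cg OX e0.
pose r := Num.min r1 r2; have r0 : 0 < r by rewrite lt_min r10.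
have [y [Oy By]] : (O `&` ball X r) !=set0 by apply: OX; exact: nbhsx_ballx.
have : nbhs y (O `&` ball X r).
  by apply: filterI; apply: open_nbhs_nbhs; split=> //; exact: ball_open.
move=> /nbhs_ballP[q /= q0 qB].
case: vf => Z1 [mZ1 Z10 vZ1]; case: vg => Z2 [mZ2 Z20 vZ2].
have bZ : ball y q `<=` Z1 `|` Z2.
  move=> z /qB[Oz Xz].
  have [fz|fz] := pselect (Z1 z); first by left.
  have [gz|gz] := pselect (Z2 z); first by right.
  exfalso.
  have vfz : v z = f z by apply: contrapT => h; apply: fz; apply: vZ1 => /= /(_ Oz).
  have vgz : v z = g z by apply: contrapT => h; apply: gz; apply: vZ2 => /= /(_ Oz).
  have zX : `|z - X| < r by rewrite distrC; move: Xz; rewrite -ball_normE.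
  move: zX; rewrite lt_min => /andP[z1 z2].
  have d1 := h1 z (subset_closure Oz) z1; have d2 := h2 z (subset_closure Oz) z2.
  rewrite -vfz in d1; rewrite -vgz in d2.
  have : `|f X - g X| < e + e.
    have -> : f X - g X = - (v z - f X) + (v z - g X) by ring.
    by apply: (le_lt_trans (ler_normD _ _)); rewrite normrN ltrD.
  by rewrite -splitr ltxx.
have : (area (ball y q : set plane) <= 0)%E.
  apply: (@le_trans _ _ (area (Z1 `|` Z2))).
    apply: le_measure; rewrite ?inE//; last exact: measurableU.
    by apply: open_measurable_plane; exact: ball_open.
  apply: (le_trans (measureU2 _ mZ1 mZ2)).
  by rewrite [X in (X + _)%E]Z10 [X in (_ + X)%E]Z20 adde0.
by rewrite leNgt area_ball_gt0.
Qed.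

End StripGeometry.

(** * Line integrals of piecewise constant functions *)

Section PiecewiseConstant.
Context {R : realType}.
Local Notation leb := (@lebesgue_measure R).

Lemma Rintegral_itv_cst (h : R -> R) (x y c : R) : x <= y ->
  (forall t, x < t -> t < y -> h t = c) ->
  leb.-integrable `[x, y] (EFin \o h) /\
  \int[leb]_(t in `[x, y]) h t = c * (y - x).
Proof.
rewrite le_eqVlt => /predU1P[->{x}|xy] hc.
  rewrite subrr mulr0 set_itv1 Rintegral_set1; split=> //.
  apply/integrableP; split; first exact: measurable_fun_set1.
  by rewrite integral_set1 ltry.
have hi : leb.-integrable `[x, y] (EFin \o h).
  have E : `[x, y]%classic = `]x, y[%classic `|` ([set x] `|` [set y]).
    apply/seteqP; split=> t /=; rewrite !in_itv/=.
      move=> /andP[]; rewrite le_eqVlt => /predU1P[<-|xt]; first by right; left.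
      by rewrite le_eqVlt => /predU1P[->|ty]; [right; right|left; rewrite xt].
    by move=> [/andP[/ltW -> /ltW ->]//|[->|->]]; rewrite lexx ltW.
  have set1i t : leb.-integrable [set t] (EFin \o h).
    by apply/integrableP; split; [exact: measurable_fun_set1|rewrite integral_set1 ltry].
  rewrite E; apply: integrable_setU => //; last exact: integrable_setU.
  - by apply: measurableU; exact: measurable_set1.
  - have ci : leb.-integrable `]x, y[ (EFin \o cst c).
      apply: integrableS (continuous_integrable_itv x y (@cst_continuous _ _ c)) => //.
      exact: subset_itv_oo_cc.
    apply: eq_integrable ci => // t.
    by rewrite inE/= in_itv/= => /andP[? ?]; rewrite hc.
split=> //.
have hio : leb.-integrable `]x, y] (EFin \o h).
  by apply: integrableS hi => //; exact: subset_itv_oc_cc.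
have hioo : leb.-integrable `]x, y[ (EFin \o h).
  by apply: integrableS hi => //; exact: subset_itv_oo_cc.
rewrite -(Rintegral_itv_obnd_cbnd hio) -(Rintegral_itv_bndo_bndc hioo).
rewrite (@eq_Rintegral _ _ _ _ _ (cst c)); last first.
  by move=> t; rewrite inE/= in_itv/= => /andP[? ?]; rewrite hc.
rewrite Rintegral_cst//.
by rewrite [X in fine X]lebesgue_measure_itv/= lte_fin xy.
Qed.

(** Nothing is asked at t = d, where the edge meets the chord: functions of [IND_loc] are free
    there. *)
Lemma line_integral_two_values (f : R * R -> R) (a b : R * R) (d c0 c1 : R) :
  a != b -> 0 <= d -> d <= 1 ->
  (forall t, 0 < t -> t < d -> enorm (b - a) * f (line a b t) = c0) ->
  (forall t, d < t -> t < 1 -> enorm (b - a) * f (line a b t) = c1) ->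
  line_integral a b f = d * c0 + (1 - d) * c1.
Proof.
move=> ab d0 d1 h0 h1.
have N0 : enorm (b - a) != 0 by rewrite gt_eqF// enorm_gt0// subr_eq0 eq_sym.
pose h := f \o line a b.
have [i0 I0] : leb.-integrable `[0, d] (EFin \o h) /\
    \int[leb]_(t in `[0, d]) h t = ((enorm (b - a))^-1 * c0) * (d - 0).
  by apply: Rintegral_itv_cst => // t t0 td; rewrite -(h0 t)// mulKf.
have [i1 I1] : leb.-integrable `[d, 1] (EFin \o h) /\
    \int[leb]_(t in `[d, 1]) h t = ((enorm (b - a))^-1 * c1) * (1 - d).
  by apply: Rintegral_itv_cst => // t t0 td; rewrite -(h1 t)// mulKf.
have hi : leb.-integrable `[0, 1] (EFin \o h).
  apply: integrableS (integrable_setU _ _ i0 i1) => //; first exact: measurableU.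
  move=> t /=; rewrite !in_itv/= => /andP[-> ->].
  by case: (leP t d) => td; [left|right; rewrite ltW].
have := @Rintegral_itvB _ h (BLeft 0) (BRight 1) d hi.
rewrite !bnd_simp => /(_ d0 d1).
rewrite (Rintegral_itv_obnd_cbnd (b := BRight 1)); last first.
  by apply: integrableS i1 => //; exact: subset_itv_oc_cc.
rewrite I0 I1 => /eqP; rewrite subr_eq => /eqP H.
rewrite /line_integral -[X in _ * X]/(\int[leb]_(t in `[0, 1]) h t) H subr0.
by field.
Qed.

Lemma line_integral_constant (f : R * R -> R) (a b : R * R) (c : R) :
  a != b ->
  (forall t, 0 < t -> t < 1 -> enorm (b - a) * f (line a b t) = c) ->
  line_integral a b f = c.
Proof.
move=> ab h; rewrite (@line_integral_two_values f a b 1 c 0)//.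
- by rewrite subrr mul0r addr0 mul1r.
- by move=> t t1 /(lt_trans t1); rewrite ltxx.
Qed.

End PiecewiseConstant.

(** * Elements of the mesh *)

Lemma card3_third (T : finType) (K : {set T}) (i j : T) :
  #|K| = 3 -> i \in K -> j \in K -> i != j ->
  exists k, [/\ i != k, j != k & K = [set i; j; k]%SET].
Proof.
move=> K3 iK jK ij.
have jKi : j \in (K :\ i)%SET by rewrite !inE eq_sym ij.
have /cards1P[k kE] : #|(K :\ i) :\ j|%SET == 1%N.
  have := cardsD1 i K; rewrite iK K3 add1n => -[K2].
  by have := cardsD1 j (K :\ i)%SET; rewrite jKi -K2 add1n => -[<-].
have : k \in ((K :\ i) :\ j)%SET by rewrite kE inE.
rewrite !inE => /and3P[kj ki kK]; exists k; rewrite eq_sym ki eq_sym kj; split=> //.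
apply/setP => x; rewrite !inE.
have := congr1 (fun A : {set T} => x \in A) kE; rewrite !inE => <-.
by have [->//|xi] := eqVneq x i; have [->|xj] := eqVneq x j; rewrite ?iK ?jK.
Qed.

Section MeshElements.
Context {R : realType}.
Variables (Omega : set (R * R)) (gam : R -> R * R) (Om : bool -> set (R * R)).
Variables (mu beta : bool -> R).
Variables (n : nat) (node : 'I_n -> R * R) (elems : {set {set 'I_n}}).
Variables (D E nb : {set 'I_n} -> R * R).
Hypothesis hOmega : polygonal_domain Omega.
Hypothesis hGamma : interface Omega gam Om.
Hypothesis hmesh : triangulation Omega node elems.

Lemma hull_closure_domain K : K \in elems -> hull node K `<=` closure Omega.
Proof. by move=> KE x hx; case: hmesh => _ _ _ _ ->; exists K. Qed.

Lemma interior_hull_domain K : K \in elems -> interior (hull node K) `<=` Omega.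
Proof.
move=> KE; case: hOmega => _ _ _ _ [-> _].
exact/interiorS/hull_closure_domain.
Qed.

Lemma hull_elem K i j k : K \in elems -> i != j -> i != k -> j != k ->
  K = [set i; j; k]%SET ->
  hull node K = triangle (node i) (node j) (node k) /\
  det2 (node j - node i) (node k - node i) != 0.
Proof.
move=> KE ij ik jk KS.
have hK : hull node K = triangle (node i) (node j) (node k) by rewrite KS hull_triangle.
split=> //; apply: det2_triangle; rewrite -hK.
by case: hmesh => _ _ /(_ K KE)[].
Qed.

Lemma line_triangle (A B C : R * R) t : t \in `[0, 1] -> triangle A B C (line A B t).
Proof.
rewrite in_itv/= => /andP[t0 t1]; exists t, 0; rewrite addr0 lexx; split=> //.
by rewrite /bary scale0r addr0.
Qed.

Section EdgeIntegral.
Hypothesis hcut : mesh_cuts gam Om node elems D E nb.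

(** If K is not an interface element, its interior misses the curve, and it is enough that the strip
    lies in the interior. Otherwise the curve meets the boundary of K only in [D K] and [E K]; the
    point at t is neither, so a neighbourhood of it misses the closed curve. Convexity then selects
    the side. *)
Lemma strip_off_interface K i j k (ax : bool) (s t : R) :
  K \in elems -> i != j -> i != k -> j != k -> K = [set i; j; k]%SET ->
  let A := node i in let u := node j - node i in let v := node k - node i in
  0 < det2 u (s *: axis ax) / det2 u v ->
  t \in `]0, 1[ -> t \notin [:: baryp A (node j) (node k) (D K); baryp A (node j) (node k) (E K)] ->
  exists r al be e0, [/\ [/\ 0 <= al, al < t, t < be & be <= 1], 0 < e0 &
     strip A u ax s al be e0 `<=` Om r].
Proof.
move=> KE ij ik jk KS A u v pos t01 tl.
have [hK D0] := hull_elem KE ij ik jk KS; rewrite -/A -/u -/v in D0 hK.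
have DN : det2 u (s *: axis ax) != 0 by apply: contraTneq pos => ->; rewrite mul0r ltxx.
case: hGamma => gamJ gamO OmP Om0 OmU.
have tI : t \in `[0, 1] by move: t01; rewrite !in_itv/= => /andP[/ltW -> /ltW ->].
have [t0 t1] : 0 < t /\ t < 1 by move: t01; rewrite in_itv/= => /andP[].
have [al [be [e1 [[al0 alt tbe be1 e10] avoid]]]] : exists al be e1,
    [/\ 0 < al, al < t, t < be, be < 1 & 0 < e1] /\
    (forall x, strip A u ax s al be e1 x -> interior (hull node K) x -> ~ range gam x).
  have [[_ KI]|nI] := pselect (interface_elem gam node elems K); last first.
    exists (t / 2), ((1 + t) / 2), 1; split; first by split; lra.
    by move=> x _ ix gx; apply: nI; split=> //; exists x.
  have [[DE bd] _ _ _ _] := hcut (conj KE KI).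
  have lt_notin : ~ range gam (line A (node j) t).
    move=> gl.
    have bl : bdry (hull node K) (line A (node j) t).
      split; first by apply: subset_closure; rewrite hK; exact: line_triangle.
      rewrite hK => /(interior_triangle_gt0 D0).
      have -> : line A (node j) t = bary A (node j) (node k) t 0 by rewrite /bary scale0r addr0.
      by rewrite baryq_bary// ltxx.
    have lE : baryp A (node j) (node k) (line A (node j) t) = t.
      have -> : line A (node j) t = bary A (node j) (node k) t 0 by rewrite /bary scale0r addr0.
      by rewrite baryp_bary.
    have : [set D K; E K] (line A (node j) t) by rewrite -bd.
    by case=> lDE; move: tl; rewrite -lDE lE !inE eqxx ?orbT.
  have og : open (~` range gam) by apply/closed_openC/closed_range_jordan.
  have : nbhs ((t, 0) : R * R) (par A u (s *: axis ax) @^-1` (~` range gam)).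
    apply: continuous_par; apply: open_nbhs_nbhs; split=> //.
    by rewrite /par /= scale0r addr0.
  move=> /nbhs_ballP[r /= r0 rB].
  exists (Num.max (t / 2) (t - r / 2)), (Num.min ((1 + t) / 2) (t + r / 2)), (r / 2).
  split.
    by split; rewrite ?lt_max ?gt_max ?lt_min ?gt_min; try (apply/orP; left); try (apply/andP;
      split); lra.
  move=> x [xt xe] _; rewrite -(par_pcoord A DN x); apply: rB; split; rewrite /ball/=.
    move: xt; rewrite in_itv/= ge_max le_min => /andP[/andP[_ ?] /andP[_ ?]].
    by rewrite ltr_norml; apply/andP; split; lra.
  move: xe; rewrite in_itv/= => /andP[? ?].
  by rewrite ltr_norml; apply/andP; split; lra.
have [e2 e20 sT] := strip_triangle (al := al) (be := be) D0 pos al0 be1.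
pose e0 := Num.min e1 e2.
have e00 : 0 < e0 by rewrite lt_min e10.
have sI x : strip A u ax s al be e0 x -> interior (hull node K) x /\ ~ range gam x.
  move=> [xt xe].
  have [xe1 xe2] : peta A u ax s x \in `]0, e1] /\ peta A u ax s x \in `]0, e2].
    by move: xe; rewrite !in_itv/= le_min => /andP[-> /andP[-> ->]].
  have ix : interior (hull node K) x by rewrite hK; apply: sT.
  by split=> //; apply: avoid => //.
have [r sr] : exists r, strip A u ax s al be e0 `<=` Om r.
  apply: (strip_one_side DN _ Om0) => [r|x /sI[ix gx]]; first by have [] := OmP r.
  by rewrite OmU; split=> //; exact: (interior_hull_domain KE).
exists r, al, be, e0; split=> //.
by split=> //; exact: ltW.
Qed.

Variables (v : R * R -> R) (gradv : R * R -> R * R).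
Hypothesis hgradv : forall s, H1grad (Om s) v gradv.
Variables (w : {set 'I_n} -> R * R -> R) (z : {set 'I_n} -> R * R -> R * R).
Hypothesis hw : nodal_interpolant Omega gam node elems beta D E nb v w.
Hypothesis hz : edge_interpolant gam Om node elems mu beta D E nb gradv z.

Lemma edge_interpolant_value K i j : K \in elems -> i \in K -> j \in K -> i != j ->
  line_integral (node i) (node j) (fun x => dot (z K x) (tangent (node i) (node j)))
  = w K (node j) - w K (node i).
Proof.
move=> KE iK jK ij.
have [k [ik jk KS]] : exists k, [/\ i != k, j != k & K = [set i; j; k]%SET].
  by apply: card3_third => //; case: hmesh => _ _ /(_ K KE)[].
have [hK D0] := hull_elem KE ij ik jk KS.
have [ax [s pos]] := transverse_axis D0.
have DN : det2 (node j - node i) (s *: axis ax) != 0.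
  by apply: contraTneq pos => ->; rewrite mul0r ltxx.
have [g trg ->] := hz.2 K i j (And4 KE iK jK ij).
have [ui [cui aei <-]] := hw.2 K i KE iK.
have [uj [cuj aej <-]] := hw.2 K j KE jK.
case: (hOmega) => _ oO _ _ _.
case: (hGamma) => gamJ gamO OmP Om0 OmU.
have lC t : t \in `[0, 1] -> closure Omega (line (node i) (node j) t).
  by move=> t01; apply: (hull_closure_domain KE); rewrite hK; exact: line_triangle.
have <- : ui (node j) = uj (node j).
  apply: (continuous_representative_unique oO cui cuj aei aej).
  by rewrite -(line1 (node i) (node j)); apply: lC; rewrite in_itv/= lexx ler01.
have OmS r : Om r `<=` Omega.
  move=> x Ox; have : (Omega `\` range gam) x by rewrite -OmU; case: r Ox; [right|left].
  by case.
apply: (@edge_ftc _ (closure Omega) Om v ui g gradv (node i) (node j) ax s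
  [:: baryp (node i) (node j) (node k) (D K); baryp (node i) (node j) (node k) (E K)]) => //.
- by move=> r; have [] := OmP r.
- move=> r; case: aei => Z [mZ Z0 uZ]; exists Z; split=> //.
  by apply: subset_trans uZ => x; apply: contra_not => h /(OmS r); exact: h.
- by move=> r; apply: subset_trans (OmS r) _; exact: subset_closure.
- by move=> t t01 tl; exact: (strip_off_interface KE ij ik jk KS pos t01 tl).
Qed.

End EdgeIntegral.
End MeshElements.

(** * Affine functions and fields *)

Section AffineFields.
Context {R : realType}.
Implicit Types (a g x : R * R) (b c : R).

Lemma is_derive_affine2 (c0 c1 c2 : R) (x d : R * R) :
  is_derive x d (fun x => c0 + c1 * x.1 + c2 * x.2) (c1 * d.1 + c2 * d.2).
Proof.
have := @is_derive_affine_comp R id (fun=> 1) c0 c1 c2 x d (fun y => is_derive_id y 1).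
by rewrite mul1r.
Qed.

Lemma grad_near_affine (f : R * R -> R) c g x :
  (\forall y \near x, f y = c + dot g y) -> grad f x = g.
Proof.
move=> fE; have d i : partial i f x = g.1 * (@axis R i).1 + g.2 * (@axis R i).2.
  suff h : is_derive x (axis i) f (g.1 * (@axis R i).1 + g.2 * (@axis R i).2).
    by rewrite /partial derive_val.
  apply: near_eq_is_derive (is_derive_affine2 c g.1 g.2 x (axis i)).
  by apply: filterS fE => y ->; rewrite /dot addrA.
by rewrite /grad !d /= !mulr0 !mulr1 addr0 add0r -surjective_pairing.
Qed.

Lemma curl_affine (V : R * R -> R * R) a b x :
  (forall x, V x = a + b *: (x.2, - x.1)) -> curl V x = - 2 * b.
Proof.
move=> VE; rewrite /curl /partial.
have -> : pcoord true \o V = (fun x : R * R => a.2 + (- b) * x.1 + 0 * x.2).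
  by apply/funext => y /=; rewrite VE /= -![_ *: _]/(_ * _); ring.
have -> : pcoord false \o V = (fun x : R * R => a.1 + 0 * x.1 + b * x.2).
  by apply/funext => y /=; rewrite VE /= -![_ *: _]/(_ * _); ring.
have [_ ->] := is_derive_affine2 a.2 (- b) 0 x (axis false).
have [_ ->] := is_derive_affine2 a.1 0 b x (axis true).
by rewrite /=; ring.
Qed.

Lemma enorm_tangent (y A B : R * R) : A != B ->
  enorm (B - A) * dot y (tangent A B) = dot y (B - A).
Proof.
move=> AB; rewrite /tangent dotZr mulrA mulfV ?mul1r// gt_eqF// enorm_gt0//.
by rewrite subr_eq0 eq_sym.
Qed.

Lemma segment_sym (A B x : R * R) : segment A B x -> segment B A x.
Proof.
case=> t; rewrite /= in_itv/= => /andP[t0 t1] <-; exists (1 - t).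
  by rewrite /= in_itv/=; apply/andP; split; lra.
rewrite /line [LHS]surjective_pairing [RHS]surjective_pairing/= -![_ *: _]/(_ * _).
by congr pair; ring.
Qed.

End AffineFields.

(** * Comparison of the two interpolants on a cut element *)

Section CutElement.
Context {R : realType}.
Variables (A B C Dp Ep nu : R * R) (d e : R).
Let u := B - A.
Let v := C - A.
Hypothesis D0 : det2 u v != 0.
Hypotheses (DE : Dp = line A B d) (EE : Ep = line A C e).
Hypotheses (d0 : 0 < d) (d1 : d <= 1) (e0 : 0 < e) (e1 : e <= 1).
Hypothesis de : ~ (d = 1 /\ e = 1).
Hypotheses (nu0 : nu != 0) (nuDE : dot nu (Ep - Dp) = 0).

Lemma cut_chord : Ep - Dp = e *: v - d *: u.
Proof.
rewrite DE EE /line -/u -/v [LHS]surjective_pairing [RHS]surjective_pairing/=.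
by congr pair; ring.
Qed.

Let m := d * dot u nu.

Let mE : m = e * dot v nu.
Proof.
move: nuDE; rewrite cut_chord /m /dot/= -![_ *: _]/(_ * _) => h.
by apply/eqP; rewrite -subr_eq0 -oppr_eq0 -h; apply/eqP; ring.
Qed.

Let m_neq0 : m != 0.
Proof.
apply: contraNneq nu0 => m0; apply/eqP; apply: (dot_eq0 D0).
  move/eqP: m0; rewrite /m mulf_eq0 gt_eqF//= => /eqP <-.
  by rewrite /dot; ring.
move/eqP: m0; rewrite mE mulf_eq0 gt_eqF//= => /eqP <-.
by rewrite /dot; ring.
Qed.

(** The chord passes through the points (d, 0) and (0, e) in barycentric coordinates, so its
    equation is p / d + q / e = 1. *)
Let sideE (p q : R) : dot (bary A B C p q - Dp) nu = m * (p / d + q / e - 1).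
Proof.
have -> : m * (p / d + q / e - 1) = p * (m / d) + q * (m / e) - m by ring.
have -> : m / d = dot u nu by rewrite /m mulrC mulKf// gt_eqF.
have -> : m / e = dot v nu by rewrite mE mulrC mulKf// gt_eqF.
by rewrite /m DE /bary /line -/u -/v /dot/= -![_ *: _]/(_ * _); ring.
Qed.

(** The side of the chord that contains A: the linear form of [side] takes the value [- m] at A, and
    m has the sign of [dot u nu]. *)
Definition corner_side : bool := dot u nu < 0.

Let sE : corner_side = (m < 0).
Proof. by rewrite /corner_side /m pmulr_rlt0. Qed.

Lemma side_corner (p q : R) : p / d + q / e < 1 -> side Dp nu corner_side (bary A B C p q).
Proof.
move=> pq; rewrite /side/= sideE sE; case: ltgtP m_neq0 => // m0 _.
  by rewrite nmulr_rgt0//; lra.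
by rewrite pmulr_rlt0//; lra.
Qed.

Lemma side_opposite (p q : R) : 1 < p / d + q / e -> side Dp nu (~~ corner_side) (bary A B C p q).
Proof.
move=> pq; rewrite /side/= sideE sE; case: ltgtP m_neq0 => // m0 _ /=.
  by rewrite nmulr_rlt0//; lra.
by rewrite pmulr_rgt0//; lra.
Qed.

Lemma on_chord (p q : R) : 0 <= p -> 0 <= q -> p / d + q / e = 1 ->
  segment Dp Ep (bary A B C p q).
Proof.
move=> p0 q0 pq; exists (q / e).
  rewrite /= in_itv/= divr_ge0 ?(ltW e0)//=.
  by rewrite -pq lerDr divr_ge0// ltW.
have pE : p = d * (1 - q / e) by rewrite -pq addrK mulrC divfK// gt_eqF.
rewrite DE EE /line /bary -/u -/v [LHS]surjective_pairing [RHS]surjective_pairing/= -![_ *: _]/(_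
  * _) pE.
have en : e != 0 by rewrite gt_eqF.
by congr pair; field; exact: en.
Qed.

Variables (mu beta : bool -> R) (vv : bool -> R * R -> R * R) (p : bool -> R * R -> R).
Variables (zK : R * R -> R * R) (wK : R * R -> R).
Hypotheses (hmu : forall s, 0 < mu s) (hbeta : forall s, 0 < beta s).
Hypotheses (uv : 0 <= dot u v) (uu : 0 <= dot u (u - v)) (vvu : 0 <= dot v (v - u)).
Variables (va : bool -> R * R) (vb : bool -> R) (pc : bool -> R) (pg : bool -> R * R).
Hypothesis vE : forall s x, vv s x = va s + vb s *: (x.2, - x.1).
Hypothesis pE : forall s x, p s x = pc s + dot (pg s) x.
Hypothesis ct1 : forall x, segment Dp Ep x ->
  dot (vv true x) (tangent Dp Ep) = dot (vv false x) (tangent Dp Ep).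
Hypothesis ct2 : forall x, (mu true)^-1 * curl (vv true) x = (mu false)^-1 * curl (vv false) x.
Hypothesis ct3 : let Xm := line Dp Ep (1 / 2) in
  beta true * dot (vv true Xm) nu = beta false * dot (vv false Xm) nu.
Hypothesis zE : forall s x, triangle A B C x -> side Dp nu s x -> zK x = vv s x.
Hypothesis pc0 : forall x, segment Dp Ep x -> p true x = p false x.
Hypothesis pflux : forall x, beta false * dot (grad (p false) x) nu = beta true * dot (grad (p
  true) x) nu.
Hypothesis wE : forall s x, triangle A B C x ->
  side Dp nu s x \/ segment Dp Ep x -> wK x = p s x.
Hypothesis edgeAB : line_integral A B (fun x => dot (zK x) (tangent A B)) = wK B - wK A.
Hypothesis edgeAC : line_integral A C (fun x => dot (zK x) (tangent A C)) = wK C - wK A.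
Hypothesis edgeBC : line_integral B C (fun x => dot (zK x) (tangent B C)) = wK C - wK B.

Let s := corner_side.
Let o := ~~ s.

Let AB : A != B.
Proof.
by apply: contraNneq D0 => h; rewrite /u h subrr /det2/= !mul0r subrr.
Qed.
Let AC : A != C.
Proof.
by apply: contraNneq D0 => h; rewrite /v h subrr /det2/= !mulr0 subrr.
Qed.
Let BC : B != C.
Proof.
by apply: contraNneq D0 => h; rewrite /u h -/v /det2 mulrC subrr.
Qed.

Let lineAB t : line A B t = bary A B C t 0.
Proof. by rewrite /bary scale0r addr0. Qed.
Let lineAC t : line A C t = bary A B C 0 t.
Proof. by rewrite /bary scale0r addr0. Qed.
Let lineBC t : line B C t = bary A B C (1 - t) t.
Proof.
rewrite /line /bary [LHS]surjective_pairing [RHS]surjective_pairing/= -![_ *: _]/(_ * _).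
by congr pair; ring.
Qed.

Let tri q r : 0 <= q -> 0 <= r -> q + r <= 1 -> triangle A B C (bary A B C q r).
Proof. by move=> *; exists q, r. Qed.

Let pg_grad r x : grad (p r) x = pg r.
Proof. by apply: (@grad_near_affine _ _ (pc r)); exact: (@filterE _ (nbhs x) _ _ (pE r)). Qed.

Let segD : segment Dp Ep Dp.
Proof. by exists 0; rewrite ?line0//= in_itv/= lexx ler01. Qed.
Let segE : segment Dp Ep Ep.
Proof. by exists 1; rewrite ?line1//= in_itv/= lexx ler01. Qed.

Let wA : wK A = p s A.
Proof.
have AE : A = bary A B C 0 0 by rewrite /bary !scale0r !addr0.
rewrite AE; apply: wE; first by apply: tri; rewrite ?addr0.
by left; apply: side_corner; rewrite !mul0r addr0.
Qed.

Let wB : wK B = p o B.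
Proof.
have BE : B = bary A B C 1 0 by rewrite -lineAB line1.
rewrite BE; apply: wE; first by apply: tri; rewrite ?addr0.
(* For d = 1 the vertex B is the cut point itself; it lies on no open side, but on the chord both
   pieces are available. *)
have [dE|dn] := eqVneq d 1.
  by right; apply: on_chord; rewrite // dE divr1 mul0r addr0.
left; apply: side_opposite; rewrite mul0r addr0 mul1r invf_gt1//.
by rewrite lt_neqAle dn.
Qed.

Let wC : wK C = p o C.
Proof.
have CE : C = bary A B C 0 1 by rewrite -lineAC line1.
rewrite CE; apply: wE; first by apply: tri; rewrite ?add0r.
have [eE|en] := eqVneq e 1.
  by right; apply: on_chord; rewrite // eE divr1 mul0r add0r.
left; apply: side_opposite; rewrite mul0r add0r mul1r invf_gt1//.
by rewrite lt_neqAle en.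
Qed.

Let pD : p o Dp = p s Dp.
Proof. by rewrite /o; case: (s) => /=; [exact/esym/pc0|exact: pc0]. Qed.
Let pEp : p o Ep = p s Ep.
Proof. by rewrite /o; case: (s) => /=; [exact/esym/pc0|exact: pc0]. Qed.

(* The value at A of the difference of the two fields. *)
Let al r := va r + vb r *: rot A - pg r.

Let H1 : d * dot (al s) u + (1 - d) * dot (al o) u = 0.
Proof.
have := edgeAB.
(* The tangential component of a field of [ND] is constant along a line, so for both pieces it may
   be evaluated at A, including the piece that lives away from A. *)
rewrite (@line_integral_two_values _ _ A B d (dot (va s + vb s *: rot A) u) (dot (va o + vb o *:
  rot A) u))//; last 3 first.
- exact: ltW.
- move=> t t0 td; rewrite enorm_tangent// (zE (s := s)).
  + rewrite vE /u /line /rot /dot/= -![_ *: _]/(_ * _); ring.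
  + by rewrite lineAB; apply: tri; rewrite ?addr0 ?(ltW t0)// (le_trans (ltW td)). 
  + by rewrite lineAB; apply: side_corner; rewrite mul0r addr0 ltr_pdivrMr// mul1r.
- move=> t td t1; rewrite enorm_tangent// (zE (s := o)).
  + rewrite vE /u /line /rot /dot/= -![_ *: _]/(_ * _); ring.
  + by rewrite lineAB; apply: tri; rewrite ?addr0 ?(ltW t1)// (le_trans _ (ltW td)) ?ltW. 
  + by rewrite lineAB; apply: side_opposite; rewrite mul0r addr0 ltr_pdivlMr// mul1r.
rewrite wA wB => h.
(* The two pieces agree at the cut point, where the increment along the edge is split. *)
have k : p o B - p s A = d * dot (pg s) u + (1 - d) * dot (pg o) u.
  have := pD; rewrite !pE DE /line /u /dot/= -![_ *: _]/(_ * _) => h'.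
  by move: h'; move: (pc o) (pc s) (pg o) (pg s) => ? ? [? ?] [? ?] /= ?; lra.
move: h; rewrite k /al /dot/=; lra.
Qed.

Let H2 : e * dot (al s) v + (1 - e) * dot (al o) v = 0.
Proof.
have := edgeAC.
rewrite (@line_integral_two_values _ _ A C e (dot (va s + vb s *: rot A) v) (dot (va o + vb o *:
  rot A) v))//; last 3 first.
- exact: ltW.
- move=> t t0 td; rewrite enorm_tangent// (zE (s := s)).
  + rewrite vE /v /line /rot /dot/= -![_ *: _]/(_ * _); ring.
  + by rewrite lineAC; apply: tri; rewrite ?add0r ?(ltW t0)// (le_trans (ltW td)). 
  + by rewrite lineAC; apply: side_corner; rewrite mul0r add0r ltr_pdivrMr// mul1r.
- move=> t td t1; rewrite enorm_tangent// (zE (s := o)).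
  + rewrite vE /v /line /rot /dot/= -![_ *: _]/(_ * _); ring.
  + by rewrite lineAC; apply: tri; rewrite ?add0r ?(ltW t1)// (le_trans _ (ltW td)) ?ltW. 
  + by rewrite lineAC; apply: side_opposite; rewrite mul0r add0r ltr_pdivlMr// mul1r.
rewrite wA wC => h.
have k : p o C - p s A = e * dot (pg s) v + (1 - e) * dot (pg o) v.
  have := pEp; rewrite !pE EE /line /v /dot/= -![_ *: _]/(_ * _) => h'.
  by move: h'; move: (pc o) (pc s) (pg o) (pg s) => ? ? [? ?] [? ?] /= ?; lra.
move: h; rewrite k /al /dot/=; lra.
Qed.

Let H3 : dot (al o + vb o *: rot u) (v - u) = 0.
Proof.
have := edgeBC.
rewrite (@line_integral_constant _ _ B C (dot (va o + vb o *: rot B) (C - B)))//; last first.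
  move=> t t0 t1; rewrite enorm_tangent// (zE (s := o)).
  + rewrite vE /line /rot /dot/= -![_ *: _]/(_ * _); ring.
  + by rewrite lineBC; apply: tri; lra.
  + rewrite lineBC; apply: side_opposite.
    have h1 : 1 - t <= (1 - t) / d by rewrite ler_pdivlMr// ler_piMr//; lra.
    have h2 : t <= t / e by rewrite ler_pdivlMr// ler_piMr//; lra.
    (* By [de] one of d, e is below 1, which makes one of [h1], [h2] strict: the open edge BC lies
       on the side opposite to A. *)
    have [dE|dn] := eqVneq d 1.
      have en : e < 1 by rewrite lt_neqAle e1 andbT; apply/eqP => eE; exact: de.
      suff : t < t / e by lra.
      by rewrite ltr_pdivlMr// gtr_pMr.
    suff : 1 - t < (1 - t) / d by lra.
    by rewrite ltr_pdivlMr// gtr_pMr ?lt_neqAle ?dn//; lra.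
rewrite wB wC !pE => h.
suff <- : dot (va o + vb o *: rot B) (C - B) - (pc o + dot (pg o) C - (pc o + dot (pg o) B)) =
    dot (al o + vb o *: rot u) (v - u) by rewrite h subrr.
by rewrite /al /u /v /rot /dot/= -![_ *: _]/(_ * _); ring.
Qed.

Let gDE : dot (pg o) (e *: v - d *: u) = dot (pg s) (e *: v - d *: u).
Proof.
have := pD; have := pEp; rewrite !pE -cut_chord /dot/= => h h'.
by move: h h'; move: (pc o) (pc s) (pg o) (pg s) => ? ? [? ?] [? ?] /= ? ?; lra.
Qed.

Let DpEp : Dp != Ep.
Proof.
apply/eqP => h; have : det2 u (Ep - Dp) = 0 by rewrite h subrr /det2/= !mulr0 subrr.
rewrite cut_chord => h'.
have : e * det2 u v = 0 by rewrite -h' /det2/= -![_ *: _]/(_ * _); ring.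
by move/eqP; rewrite mulf_eq0 gt_eqF//= (negbTE D0).
Qed.

Let H4 : dot (al o + vb o *: rot (d *: u)) (e *: v - d *: u) =
         dot (al s + vb s *: rot (d *: u)) (e *: v - d *: u).
Proof.
have h : dot (vv o Dp) (e *: v - d *: u) = dot (vv s Dp) (e *: v - d *: u).
  have := ct1 segD => /(congr1 (fun x => enorm (Ep - Dp) * x)).
  by rewrite !enorm_tangent// -cut_chord /o; case: (s) => //=.
have E r : dot (al r + vb r *: rot (d *: u)) (e *: v - d *: u) =
    dot (vv r Dp) (e *: v - d *: u) - dot (pg r) (e *: v - d *: u).
  by rewrite vE DE /al /line -/u /rot /dot/= -![_ *: _]/(_ * _); ring.
by rewrite !E h gDE.
Qed.

Let H5 : (mu o)^-1 * vb o = (mu s)^-1 * vb s.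
Proof.
have h : (mu true)^-1 * vb true = (mu false)^-1 * vb false.
  have := ct2 A; rewrite !(curl_affine _ (vE _)).
  by lra.
by rewrite /o; case: s.
Qed.

Let H6 : let m' := (1 / 2 : R) *: (d *: u + e *: v) in
  beta o * dot (al o + vb o *: rot m') nu = beta s * dot (al s + vb s *: rot m') nu.
Proof.
have h : let Xm := line Dp Ep (1 / 2) in
    beta o * dot (vv o Xm) nu = beta s * dot (vv s Xm) nu.
  by rewrite /o; case: (s) => /=; rewrite ct3.
have k : beta o * dot (pg o) nu = beta s * dot (pg s) nu.
  have := pflux A; rewrite !pg_grad /o; case: (s) => /=; by move=> ->.
move=> m'.
have E r : dot (al r + vb r *: rot m') nu = dot (vv r (line Dp Ep (1 / 2))) nu - dot (pg r) nu.
  rewrite vE /al /m' /rot /line DE EE /line -/u -/v /dot/= -![_ *: _]/(_ * _).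
  by field.
by rewrite !E !mulrBr h k.
Qed.

Lemma cut_element_eq r x : vv r x = pg r.
Proof.
have nw : dot nu (e *: v - d *: u) = 0 by rewrite -cut_chord.
have [as0 bs0 ao0 bo0] := cut_unisolvence D0 uv uu vvu d0 d1 e0 e1 (hmu s) (hmu o)
  (hbeta s) (hbeta o) nu0 nw H1 H2 H3 H4 H5 H6.
have key q : al q = 0 -> vb q = 0 -> vv q x = pg q.
  rewrite vE /al => + b0; rewrite b0 !scale0r !addr0 => /eqP.
  by rewrite subr_eq0 => /eqP.
have [rs|rs] : r = s \/ r = o.
  by rewrite /o; case: (s); case: (r); [left|right|right|left].
by rewrite rs; exact: key.
by rewrite rs; exact: key.
Qed.

Lemma cut_element_grad x : interior (triangle A B C) x -> ~ segment Dp Ep x ->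
  zK x = grad wK x.
Proof.
move=> ix nseg; have tx := interior_subset ix.
have [q [r [q0 r0 qr xE]]] := tx.
have [t st] : exists t, side Dp nu t x.
  rewrite xE; have [h|h|h] := ltgtP (q / d + r / e) 1.
  - by exists corner_side; exact: side_corner.
  - by exists (~~ corner_side); exact: side_opposite.
  - by exfalso; apply: nseg; rewrite xE; exact: on_chord.
rewrite (zE tx st) cut_element_eq; apply/esym.
apply: (@grad_near_affine _ _ (pc t)).
have ns : \forall y \near x, side Dp nu t y.
  have cs : continuous (fun y : R * R => dot (y - Dp) nu).
    move=> y; rewrite /dot; apply: cvgD; apply: cvgMl => /=.
      by apply: cvgB; [exact: cvg_fst|exact: cvg_cst].
    by apply: cvgB; [exact: cvg_snd|exact: cvg_cst].
  move: st; rewrite /side; case: (t) => /= st.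
    exact: (cs x _ (lt_nbhsr st)).
  exact: (cs x _ (lt_nbhsl st)).
apply: filterS2 ix ns => y ty sy.
by rewrite (wE ty (or_introl sy)) pE.
Qed.

End CutElement.

Lemma card3_eq (T : finType) (K : {set T}) (i j k : T) :
  #|K| = 3 -> i \in K -> j \in K -> k \in K -> i != j -> i != k -> j != k ->
  K = [set i; j; k]%SET.
Proof.
move=> K3 iK jK kK ij ik jk; have [l [_ _ KE]] := card3_third K3 iK jK ij.
by move: kK; rewrite KE !inE !(eq_sym k) (negbTE ik) (negbTE jk) => /eqP ->.
Qed.

Lemma cards3_exists (T : finType) (K : {set T}) : #|K| = 3 ->
  exists i j k, [/\ i != j, i != k, j != k & K = [set i; j; k]%SET].
Proof.
move=> K3; have [i iK] : exists i, i \in K by apply/set0Pn; rewrite -card_gt0 K3.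
have [j] : exists j, j \in (K :\ i)%SET.
  apply/set0Pn; rewrite -card_gt0; have := cardsD1 i K.
  by rewrite K3 iK add1n => -[<-].
rewrite !inE eq_sym => /andP[ij jK].
by have [k [ik jk KS]] := card3_third K3 iK jK ij; exists i, j, k.
Qed.

(** * Position of the chord, and the two kinds of elements *)

Section Interpolants.
Context {R : realType}.
Variables (Omega : set (R * R)) (gam : R -> R * R) (Om : bool -> set (R * R)).
Variables (n : nat) (node : 'I_n -> R * R) (elems : {set {set 'I_n}}).
Hypothesis hmesh : triangulation Omega node elems.

(** Two edges of a triangle that carry one cut point each share a vertex, which is named i. That no
    edge contains both points gives the rest: d = 0 or e = 0 would put a cut point at the shared
    vertex, hence on the edge of the other, and d = e = 1 would put both on the third edge. *)
Lemma cut_frame K (Dp Ep nu : R * R) :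
  K \in elems -> Defs.cut gam Om node elems K Dp Ep nu ->
  exists i j k d e,
    [/\ [/\ i \in K, j \in K & k \in K], [/\ i != j, i != k & j != k],
        Dp = line (node i) (node j) d /\ Ep = line (node i) (node k) e,
        [/\ 0 < d, d <= 1, 0 < e & e <= 1] & ~ (d = 1 /\ e = 1)].
Proof.
move=> KE [[_ bd] noedge _ _ _].
have K3 : #|K| = 3 by case: hmesh => _ _ /(_ K KE)[].
have corner i j k : i \in K -> j \in K -> k \in K -> i != j -> i != k -> j != k ->
    segment (node i) (node j) Dp -> segment (node i) (node k) Ep ->
    exists i j k d e,
    [/\ [/\ i \in K, j \in K & k \in K], [/\ i != j, i != k & j != k],
        Dp = line (node i) (node j) d /\ Ep = line (node i) (node k) e,
        [/\ 0 < d, d <= 1, 0 < e & e <= 1] & ~ (d = 1 /\ e = 1)].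
  move=> iK jK kK ij ik jk sD sE.
  have [d + dE] := sD; rewrite /= in_itv/= => /andP[d0 d1].
  have [e + eE] := sE; rewrite /= in_itv/= => /andP[e0 e1].
  have s0 (A B : R * R) : segment A B A by exists 0; rewrite ?line0//= in_itv/= lexx ler01.
  have s1 (A B : R * R) : segment A B B by exists 1; rewrite ?line1//= in_itv/= lexx ler01.
  have dn : d != 0.
    apply/eqP => dz; apply: (noedge i k); first by split.
    by split=> //; rewrite -dE dz line0.
  have en : e != 0.
    apply/eqP => ez; apply: (noedge i j); first by split.
    by split=> //; rewrite -eE ez line0.
  exists i, j, k, d, e; split=> //; first by split; rewrite // lt0r ?dn ?en.
  move=> [dz ez]; apply: (noedge j k); first by split.
  by rewrite -dE -eE dz ez !line1.
have [i [j [k [ij ik jk KS]]]] := cards3_exists K3.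
have [iK jK kK] : [/\ i \in K, j \in K & k \in K] by rewrite KS !inE !eqxx !orbT.
have [hK D0] := hull_elem hmesh KE ij ik jk KS.
have [bD _] : (bdry (hull node K) `&` range gam) Dp by rewrite bd; left.
have [bE _] : (bdry (hull node K) `&` range gam) Ep by rewrite bd; right.
rewrite hK in bD bE.
have ji : j != i by rewrite eq_sym.
have ki : k != i by rewrite eq_sym.
have kj : k != j by rewrite eq_sym.
have sS := @segment_sym R.
case: (bdry_triangle D0 bD) => sD; case: (bdry_triangle D0 bE) => sE.
- by exfalso; apply: (noedge i j).
- exact: (corner i j k).
- by apply: (corner j i k) => //; exact: sS.
- exact: (corner i k j).
- by exfalso; apply: (noedge i k).
- by apply: (corner k i j) => //; exact: sS.
- by apply: (corner j k i) => //; exact: sS.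
- by apply: (corner k j i) => //; exact: sS.
- by exfalso; apply: (noedge j k).
Qed.

End Interpolants.

(** The difference V - g is again of the form of [ND]; [ND_unisolvence] applies to it with the
    origin moved to A. *)
Lemma uncut_element_grad {R : realType} (A B C : R * R) (z V : R * R -> R * R)
    (w p : R * R -> R) a g (b c : R) x :
  let tangential P Q := line_integral P Q (fun x => dot (z x) (tangent P Q)) in
  det2 (B - A) (C - A) != 0 ->
  (forall x, V x = a + b *: (x.2, - x.1)) -> (forall x, p x = c + dot g x) ->
  (forall x, triangle A B C x -> z x = V x) ->
  (forall x, triangle A B C x -> w x = p x) ->
  tangential A B = w B - w A -> tangential A C = w C - w A ->
  tangential B C = w C - w B ->
  interior (triangle A B C) x -> z x = grad w x.
Proof.
move=> tangential D0 VE pE zE wE eAB eAC eBC ix.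
have AB : A != B by apply: contraNneq D0 => ->; rewrite subrr /det2/= !mul0r subrr.
have AC : A != C by apply: contraNneq D0 => ->; rewrite subrr /det2/= !mulr0 subrr.
have BC : B != C by apply: contraNneq D0 => ->; rewrite /det2 mulrC subrr.
have tri q r : 0 <= q -> 0 <= r -> q + r <= 1 -> triangle A B C (bary A B C q r).
  by move=> *; exists q, r.
have lineAB t : line A B t = bary A B C t 0 by rewrite /bary scale0r addr0.
have lineAC t : line A C t = bary A B C 0 t by rewrite /bary scale0r addr0.
have lineBC t : line B C t = bary A B C (1 - t) t.
  rewrite /line /bary [LHS]surjective_pairing [RHS]surjective_pairing/= -![_ *: _]/(_ * _).
  by congr pair; ring.
have tA : triangle A B C A by have := tri 0 0; rewrite -lineAB line0; apply; rewrite ?addr0.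
have tB : triangle A B C B by have := tri 1 0; rewrite -lineAB line1; apply; rewrite ?addr0.
have tC : triangle A B C C by have := tri 0 1; rewrite -lineAC line1; apply; rewrite ?add0r.
have edge P Q : P != Q -> (forall t, 0 < t -> t < 1 -> triangle A B C (line P Q t)) ->
    triangle A B C P -> triangle A B C Q -> tangential P Q = w Q - w P ->
    dot (a + b *: rot P - g) (Q - P) = 0.
  move=> PQ tPQ tP tQ; rewrite /tangential.
  rewrite (@line_integral_constant _ _ P Q (dot (a + b *: rot P) (Q - P)))//; last first.
    move=> t t0 t1; rewrite enorm_tangent// zE ?VE; last exact: tPQ.
    by rewrite /line /rot /dot/= -![_ *: _]/(_ * _); ring.
  rewrite !wE// !pE => h.
  suff <- : dot (a + b *: rot P) (Q - P) - (c + dot g Q - (c + dot g P)) =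
      dot (a + b *: rot P - g) (Q - P) by rewrite h subrr.
  by rewrite /rot /dot/= -![_ *: _]/(_ * _); ring.
have [a0 b0] : a + b *: rot A - g = 0 /\ b = 0.
  apply: (ND_unisolvence D0).
  - by apply: edge => // t t0 t1; rewrite lineAB; apply: tri; rewrite ?addr0// ltW.
  - by apply: edge => // t t0 t1; rewrite lineAC; apply: tri; rewrite ?add0r// ltW.
  - rewrite -[RHS](edge B C) //; last first.
      by move=> t t0 t1; rewrite lineBC; apply: tri; lra.
    by rewrite /rot /dot/= -![_ *: _]/(_ * _); ring.
have -> : z x = g.
  rewrite zE; last exact: interior_subset.
  move: a0; rewrite VE b0 !scale0r !addr0 => /eqP.
  by rewrite subr_eq0 => /eqP.
apply/esym/(@grad_near_affine _ _ c); apply: filterS ix => y ty.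
by rewrite wE.
Qed.

Theorem theorem3p3 (R : realType)
    (Omega : set (R * R)) (gam : R -> R * R) (Om : bool -> set (R * R))
    (mu beta : bool -> R)
    (n : nat) (node : 'I_n -> R * R) (elems : {set {set 'I_n}})
    (D E nb : {set 'I_n} -> R * R)
    (hOmega : polygonal_domain Omega)
    (hGamma : interface Omega gam Om)
    (hmu : forall s, 0 < mu s) (hbeta : forall s, 0 < beta s)
    (hmesh : triangulation Omega node elems)
    (hangle : no_obtuse_angle node elems)
    (hcut : mesh_cuts gam Om node elems D E nb)
    (v : R * R -> R) (hv : H2tilde0 Omega gam Om beta v)
    (gradv : R * R -> R * R) (hgradv : forall s, H1grad (Om s) v gradv)
    (w : {set 'I_n} -> R * R -> R)
    (hw : nodal_interpolant Omega gam node elems beta D E nb v w)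
    (z : {set 'I_n} -> R * R -> R * R)
    (hz : edge_interpolant gam Om node elems mu beta D E nb gradv z) :
  eq_broken_grad gam node elems D E z w.
Proof.
move=> K x KE ix nseg.
have edge := edge_interpolant_value hOmega hGamma hmesh hcut hgradv hw hz KE.
have [K3 _] : #|K| = 3 /\ _ := let: And5 _ _ h _ _ := hmesh in h K KE.
have [ie|nie] := pselect (interface_elem gam node elems K).
  have cK := hcut K ie.
  have [i [j [k [d [e [[iK jK kK] [ij ik jk] [DE EE] [d0 d1 e0 e1] de]]]]]] :=
    cut_frame hmesh KE cK.
  have KS := card3_eq K3 iK jK kK ij ik jk.
  have [hK D0] := hull_elem hmesh KE ij ik jk KS.
  have [_ _ nb1 nbDE _] := cK.
  have nb0 : nb K != 0.
    apply: contra_eq_neq nb1 => ->.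
    by rewrite /enorm /dot/= !mulr0 addr0 sqrtr0 eq_sym oner_eq0.
  have [vv [vND [ct1 ct2 ct3]] zE] := (hz.1.1 K KE).1 ie.
  have [p [pP pc0 pflux] wE] := (hw.1.1 K KE).1 ie.
  have [va /choice[vb vE]] := choice vND.
  have [pc /choice[pg pE]] := choice pP.
  rewrite hK in ix zE wE.
  apply: (cut_element_grad D0 DE EE d0 d1 e0 e1 de nb0 nbDE hmu hbeta _ _ _
    vE pE ct1 ct2 ct3 zE pc0 pflux wE) (nseg ie) => //.
  - exact: hangle KE iK jK kK.
  - rewrite (_ : dot _ _ = dot (node i - node j) (node k - node j)).
      exact: hangle KE jK iK kK.
    by rewrite /dot/=; ring.
  - rewrite (_ : dot _ _ = dot (node i - node k) (node j - node k)).
      exact: hangle KE kK iK jK.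
    by rewrite /dot/=; ring.
  - exact: edge.
  - exact: edge.
  - exact: edge.
have [i [j [k [ij ik jk KS]]]] := cards3_exists K3.
have [iK jK kK] : [/\ i \in K, j \in K & k \in K] by rewrite KS !inE !eqxx !orbT.
have [hK D0] := hull_elem hmesh KE ij ik jk KS.
have [vv [a [b vE]] zE] := (hz.1.1 K KE).2 nie.
have [p [c [g pE]] wE] := (hw.1.1 K KE).2 nie.
rewrite hK in ix zE wE.
exact: (uncut_element_grad D0 vE pE zE wE (edge _ _ iK jK ij) (edge _ _ iK kK ik) (edge _ _ jK kK
  jk) ix).
Qed.
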